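(* Let $\varphi:S^2\to G_3(\mathbb R^6)$ be a harmonic map. (1) If $\varphi$ is associated to the pair $(\zeta_1,\sigma_\varrho)$, then $\varphi$ is $S^1$-invariant and, up to isometry, is given by $\varphi=V_0\oplus V\oplus\overline V$, where $V$ is a holomorphic isotropic subbundle of $S^2\times V_0^\perp$ of rank $1$ satisfying $\partial V\subseteq\overline V^\perp$. (2) If $\varphi$ is associated to the pair $(\zeta_1+\zeta_2,\sigma_\varrho)$ and is $S^1$-invariant, then, up to isometry, $\varphi=V_0\oplus(W\cap V^\perp)\oplus(\overline{W\cap V^\perp})$, where $V\subset W$ are holomorphic isotropic subbundles of $S^2\times V_0^\perp$ of rank $1$ and $2$, respectively, satisfying $\partial V\subset W$ and $\partial W\subset\overline W^\perp$. (3) If $\varphi$ is associated to the pair $(\zeta_2,\sigma_{\varrho,1})$ and is $S^1$-invariant, then, up to isometry, $\varphi=\{(L_1\oplus\overline L_1)^\perp\cap(V_0\oplus V_1\oplus\overline V_1)\}\oplus(L_2\oplus\overline L_2)$, where $L_1$ and $L_2$ are holomorphic isotropic line subbundles of $S^2\times(V_0\oplus V_1\oplus\overline V_1)$ and $S^2\times(V_0\oplus V_1\oplus\overline V_1)^\perp$, respectively. The corresponding extended solutions have uniton number $2$, $4$ and $2$, respectively, with respect to the standard representation of $SO(6)$. The harmonic maps in the classes $(\zeta_1,\sigma_{\varrho,2})$, $(\zeta_1+\zeta_2,\sigma_{\varrho,2})$ and $(\zeta_2,\mathrm{Ad}(\exp\pi\zeta_2)\circ\sigma_{\varrho,1})$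 are precisely the orthogonal complements of the harmonic maps in the classes $(\zeta_1,\sigma_\varrho)$, $(\zeta_1+\zeta_2,\sigma_\varrho)$ and $(\zeta_2,\sigma_{\varrho,1})$, respectively.
   Context: $G_3(\mathbb R^6)$ is the Grassmannian of $3$-dimensional real subspaces of $\mathbb R^6$; $G=SO(6)$. $\mathbb R^6$ has its standard inner product, extended complex-bilinearly to $\mathbb C^6$ as $\langle\cdot,\cdot\rangle$; $\{u_1,u_2,u_3,\overline u_1,\overline u_2,\overline u_3\}$ is a basis of $\mathbb C^6$ with $\langle u_i,u_j\rangle=0$, $\langle u_i,\overline u_j\rangle=\delta_{ij}$. $E_i\in\mathfrak{so}(6)$ is given by $E_iu_i=\mathrm iu_i$, $E_i\overline u_i=-\mathrm i\overline u_i$, zero on the other basis vectors; $\mathfrak t=\mathrm{span}_{\mathbb R}\{E_1,E_2,E_3\}$, with $L_i(E_j)=\mathrm i\delta_{ij}$ and positive roots $L_i\pm L_j$, $i<j$. Put $\zeta_1=E_1$, $\zeta_2=E_1+E_2$. $V_0$ is the real line spanned by $(u_3+\overline u_3)/\sqrt2$, $V_1$ the complex line spanned by $\overline u_1$; $s_0=\pi_{V_0}-\pi_{V_0}^\perp$; $\sigma_\varrho=\mathrm{Ad}(s_0)$; $\sigma_{\varrho,i}=\mathrm{Ad}(\exp\pi\zeta_i)\circ\sigma_\varrho$, $i=1,2$. Loops. $\Omega G$: smooth based loops in $G$; $\Omega_{\mathrm{alg}}G$: those that are Laurent polynomials in $\lambda$; $\Lambda^+_{\mathrm{alg}}G^{\mathbb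 C}$: algebraic loops in $G^{\mathbb C}$ extending holomorphically to $|\lambda|<1$. By the Iwasawa decomposition each loop in $G^{\mathbb C}$ is uniquely $\gamma_R\gamma_+$ with $\gamma_R\in\Omega G$ and $\gamma_+$ extending holomorphically to the disc in $G^{\mathbb C}$; $h\cdot g:=(hg)_R$. With $\gamma_\zeta(\lambda)=\exp(-\mathrm i\ln(\lambda)\zeta)$ set $U_\zeta(G)=\Lambda^+_{\mathrm{alg}}G^{\mathbb C}\cdot\gamma_\zeta$, and let $\Omega_\zeta(G)$ be the conjugacy class $\{g\gamma_\zeta g^{-1}\}$. For an involution $\tau$ of $G$, $T_\tau(\gamma)(\lambda)=\tau(\gamma(-\lambda)\gamma(-1)^{-1})$, $\Omega^\tau G$ is its fixed set, $U^\tau_\zeta(G)=U_\zeta(G)\cap\Omega^\tau G$; $P^\tau=\{g\mid\tau(g)=g^{-1}\}$ and $P^\tau_\zeta$ is its component containing $\exp\pi\zeta$. A smooth map $\Phi:S^2\to\Omega G$ is an extended solution if $\Phi_\lambda^{-1}d\Phi_\lambda=\tfrac12(1-\lambda^{-1})\alpha'+\tfrac12(1-\lambda)\alpha''$ for a $\mathfrak g$-valued 1-form $\alpha=\alpha'+\alpha''$ (type decomposition). If $\Phi=\sum_{i=r}^s A_i\lambda^i$ in the standard representation with $A_r,A_s\not\equiv0$, its uniton number is $s-r$. Classes. Take $x_0=V_0\oplus V_1\oplus\overline V_1$ (its real points) as base point; the associated involution is $\sigma_{\varrho,1}$, and $G_3(\mathbb R^6)$ is identified with $P^{\sigma_\varrho}_{\zeta_1}$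 by $g\cdot x_0\mapsto\exp(\pi\zeta_1)g\sigma_{\varrho,1}(g^{-1})$. Let $\zeta\in\{\zeta_1,\zeta_2,\zeta_1+\zeta_2\}$ and $\tau=\mathrm{Ad}(\exp\pi(\zeta'-\zeta))\circ\sigma_\varrho$ where $\zeta'=m_1\zeta_1+m_2\zeta_2$, $m_i\in\{0,1,2\}$, satisfies $\zeta'-\zeta\in\mathbb N_0\zeta_1+\mathbb N_0\zeta_2$ and $P^{\sigma_\varrho}_{\zeta'}=P^{\sigma_\varrho}_{\zeta_1}$. Then $P^\tau_\zeta=\exp(\pi(\zeta'-\zeta))P^{\sigma_\varrho}_{\zeta_1}$, and $G_3(\mathbb R^6)$ is identified with $P^\tau_\zeta$ by composing the map $g\cdot x_0\mapsto\exp(\pi\zeta_1)g\sigma_{\varrho,1}(g^{-1})$ from $G_3(\mathbb R^6)$ onto $P^{\sigma_\varrho}_{\zeta_1}$ with left multiplication by $\exp(\pi(\zeta'-\zeta))$. A harmonic map $\varphi:S^2\to G_3(\mathbb R^6)$ is associated to the pair (is in the class) $(\zeta,\tau)$ if, up to isometry and under this identification, $\varphi=\Phi_{-1}$ for an extended solution $\Phi:S^2\to\Omega_{\mathrm{alg}}G$ with $\Phi(S^2\setminus D)\subset U^\tau_\zeta(G)$ for a discrete set $D$ (a ''corresponding extended solution''). It is $S^1$-invariant (in that class) if $\Phi$ can be chosen $S^1$-invariant, i.e. with values in $\Omega_\zeta(G)$ off a discrete set. Bundles. Real spaces such as $V_0^\perp$ and $V_0\oplus V_1\oplus\overline V_1$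 are complexified where needed; maps into Grassmannians are viewed as subbundles of trivial bundles. A subbundle is isotropic if $\langle\cdot,\cdot\rangle$ vanishes on it; $\perp$ is the Hermitian orthogonal complement; $\partial A\subseteq B$ means $\partial s/\partial z$ is a section of $B$ for every local section $s$ of $A$. *)

(* Defs.v *)
From HB Require Import structures.
From mathcomp Require Import all_boot all_order all_algebra.
From mathcomp Require Import all_classical all_reals all_analysis.
From mathcomp Require Import complex.

Set Implicit Arguments.
Unset Strict Implicit.
Unset Printing Implicit Defensive.

Import Order.TTheory GRing.Theory Num.Theory.
Import numFieldNormedType.Exports.

Local Open Scope classical_set_scope.
Local Open Scope ring_scope.
Local Open Scope complex_scope.

Section LinearAlgebra.
Variable F : fieldType.
Implicit Types U : {vspace 'cV[F]_6}.

(* The orthogonal of U for the bilinear form <u, v> = u^T v.  Over the reals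
   this is the orthogonal complement. *)
Definition annih U : {vspace 'cV[F]_6} :=
  (\bigcap_(u <- vbasis U) lker (linfun (mulmx u^T)))%VS.

Definition act (g : 'M[F]_6) U : {vspace 'cV[F]_6} :=
  (linfun (mulmx g) @: U)%VS.

(* The matrix of the orthogonal projection onto U, along [annih U]; only used
   over the reals, where U and [annih U] are complementary. *)
Definition oproj U : 'M[F]_6 :=
  \matrix_(i, j) daddv_pi U (annih U) (delta_mx j 0) i 0.

Definition SO6 (g : 'M[F]_6) : Prop := g^T *m g = 1%:M /\ \det g = 1.

Definition O6 (g : 'M[F]_6) : Prop := g^T *m g = 1%:M.

Definition so6 (X : 'M[F]_6) : Prop := X^T = - X.

Definition Ad (c g : 'M[F]_6) : 'M[F]_6 := c *m g *m invmx c.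

End LinearAlgebra.

Section Complexification.
Variable R : realType.
Local Notation C := (R[i]).

Definition mxC m n (A : 'M[R]_(m, n)) : 'M[C]_(m, n) := map_mx (real_complex R) A.
Definition mxRe m n (A : 'M[C]_(m, n)) : 'M[R]_(m, n) := map_mx (@complex.Re R) A.
Definition mxIm m n (A : 'M[C]_(m, n)) : 'M[R]_(m, n) := map_mx (@complex.Im R) A.
Definition mxconj m n (A : 'M[C]_(m, n)) : 'M[C]_(m, n) := map_mx (@conjc R) A.

Implicit Types U : {vspace 'cV[C]_6}.

Definition cplx (W : {vspace 'cV[R]_6}) : {vspace 'cV[C]_6} :=
  <<[seq mxC v | v <- vbasis W]>>%VS.

Definition conjv U : {vspace 'cV[C]_6} := <<[seq mxconj v | v <- vbasis U]>>%VS.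

(* Hermitian orthogonal complement: <conj u, v> = 0 for all u in U. *)
Definition hperp U : {vspace 'cV[C]_6} := annih (conjv U).

(* The real points of a conjugation-invariant U: these are the real parts of
   the elements of U. *)
Definition real_points U : {vspace 'cV[R]_6} :=
  <<[seq mxRe v | v <- vbasis U] ++ [seq mxIm v | v <- vbasis U]>>%VS.

Definition isotropic U : Prop :=
  forall v w, v \in U -> w \in U -> v^T *m w = 0.

(* U = A (+) B (+) conj B *)
Definition decomposes U A B : Prop :=
  directv (A + B + conjv B) /\ U = (A + B + conjv B)%VS.

End Complexification.

Section Calculus.
Variable R : realType.
Local Notation C := (R[i]).

Fixpoint Ck (V W : normedModType R) (k : nat) (U : set V) (f : V -> W) : Prop :=
  match k with
  | 0 => forall x, U x -> {for x, continuous f}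
  | k'.+1 => (forall x v, U x -> derivable f x v) /\
             (forall v, Ck k' U (fun x => 'D_v f x))
  end.

(* C^oo on the open set U, V being finite-dimensional *)
Definition smooth (V W : normedModType R) (U : set V) (f : V -> W) : Prop :=
  forall k, Ck k U f.

Definition csmooth (V : normedModType R) m n (U : set V)
    (f : V -> 'M[C]_(m.+1, n.+1)) : Prop :=
  smooth U (fun x => mxRe (f x)) /\ smooth U (fun x => mxIm (f x)).

Definition cx (p : R * R) : C := p.1 +i* p.2.
Definition pt (z : C) : R * R := (complex.Re z, complex.Im z).
Definition expi (t : R) : C := cos t +i* sin t.

Definition e_x : R * R := (1, 0).
Definition e_y : R * R := (0, 1).

Definition partial m n (v : R * R) (f : C -> 'M[C]_(m.+1, n.+1)) (z : C) :
    'M[C]_(m.+1, n.+1) :=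
  mxC ('D_v (fun p => mxRe (f (cx p))) (pt z))
  + 'i%C *: mxC ('D_v (fun p => mxIm (f (cx p))) (pt z)).

Definition d_z m n (f : C -> 'M[C]_(m.+1, n.+1)) (z : C) :=
  2^-1 *: (partial e_x f z - 'i%C *: partial e_y f z).
Definition d_zbar m n (f : C -> 'M[C]_(m.+1, n.+1)) (z : C) :=
  2^-1 *: (partial e_x f z + 'i%C *: partial e_y f z).

Definition laplacian m n (f : R * R -> 'M[R]_(m.+1, n.+1)) (p : R * R) :=
  'D_e_x (fun q => 'D_e_x f q) p + 'D_e_y (fun q => 'D_e_y f q) p.

(* The topology and the complex differentiability are those of [R[i]] as a
   normed module over itself, which the library attaches to [R[i]^o]. *)
Definition holomorphic_on m n (U : set C^o) (f : C -> 'M[C]_(m, n)) : Prop :=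
  forall i j (z : C^o), U z -> derivable (fun w : C^o => f w i j : C^o) z 1.

Definition mexp (A : 'M[R]_6) : 'M[R]_6 :=
  limn (fun n => \sum_(k < n) (k`!%:R)^-1 *: A ^+ k).

End Calculus.

Section Sphere.
Variable R : realType.
Local Notation C := (R[i]).

(* S^2 is the Riemann sphere C u {oo}, [None] being the point at infinity,
   with the coordinates z and w = 1/z. *)
Definition sphere : Type := option C.

Definition chart (b : bool) (z : C) : sphere :=
  if b then (if z == 0 then None else Some z^-1) else Some z.

(* discrete: without accumulation point in the sphere *)
Definition discrete_set (D : set sphere) : Prop :=
  forall (b : bool) (z : C^o), \forall w \near z^', ~ D (chart b w).

(* G_3(R^6) is seen in the Euclidean space of symmetric matrices, with norm
   \tr (X X^T), by sending a subspace to its orthogonal projection; up to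
   scale, the induced metric is the one of the symmetric space.  The tangent
   space at the projection P is {X | X^T = X, X P + P X = X}, and the tension
   field is, up to the conformal factor of the chart, the tangential part of
   the Laplacian. *)
Definition harmonic_map (phi : sphere -> {vspace 'cV[R]_6}) : Prop :=
  (forall p, \dim (phi p) = 3%N) /\
  forall b : bool, let P := fun q : R * R => oproj (phi (chart b (cx q))) in
    smooth setT P /\
    forall (q : R * R) (X : 'M[R]_6),
      X^T = X -> X *m P q + P q *m X = X -> \tr (laplacian P q *m X) = 0.

Definition bundle : Type := sphere -> {vspace 'cV[C]_6}.
Implicit Types A B : bundle.

Definition holo_subbundle (r : nat) A : Prop :=
  forall (b : bool) (z0 : C^o), exists (U : set C^o) (s : 'I_r -> C -> 'cV[C]_6),
    [/\ open U, U z0, forall i, holomorphic_on U (s i) &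
        forall z : C, U z ->
          basis_of (A (chart b z)) [seq s i z | i <- enum 'I_r]].

Definition subbundle_of A (E : {vspace 'cV[C]_6}) : Prop :=
  forall p, (A p <= E)%VS.

Definition isotropic_bundle A : Prop := forall p, isotropic (A p).

Definition d_sub A B : Prop :=
  forall (b : bool) (U : set C^o) (s : C -> 'cV[C]_6),
    open U -> csmooth [set q | U (cx q)] (fun q : R * R => s (cx q)) ->
    (forall z, U z -> s z \in A (chart b z)) ->
    forall z, U z -> d_z s z \in B (chart b z).

End Sphere.

Section Loops.
Variable R : realType.
Local Notation C := (R[i]).

(* A loop is a function of a complex variable of which only the values on the
   unit circle matter. *)
Definition circle (l : C) : Prop := `|l| = 1.

Implicit Types (g : C -> 'M[R]_6) (h : C -> 'M[C]_6).

Definition OmegaG g : Prop :=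
  [/\ forall l, circle l -> SO6 (g l), g 1 = 1%:M &
      smooth setT (fun t : R => g (expi t))].

Definition laurent h : Prop :=
  exists (r : int) (n : nat) (A : nat -> 'M[C]_6),
    forall l, circle l -> h l = \sum_(k < n) l ^ (r + k%:Z) *: A k.

Definition Omega_alg g : Prop := OmegaG g /\ laurent (fun l => mxC (g l)).

Definition extends_to_disc h : Prop :=
  exists H : C -> 'M[C]_6,
    [/\ forall l, circle l -> H l = h l,
        holomorphic_on [set l : C^o | `|l| < 1] H,
        forall i j, {within [set l : C^o | `|l| <= 1],
                      continuous (fun l : C^o => H l i j : C^o)} &
        forall l : C, `|l| <= 1 -> SO6 (H l)].

(* Lambda^+ G^C *)
Definition Lambda_plus h : Prop :=
  csmooth setT (fun t : R => h (expi t)) /\ extends_to_disc h.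

(* Lambda^+_alg G^C *)
Definition Lambda_plus_alg h : Prop := laurent h /\ extends_to_disc h.

(* g = f_R in the Iwasawa decomposition f = f_R f_+ *)
Definition iwasawa_R (f : C -> 'M[C]_6) g : Prop :=
  OmegaG g /\ exists2 f_plus, Lambda_plus f_plus &
    forall l, circle l -> f l = mxC (g l) *m f_plus l.

(* A real t with exp(i t) = l, i.e. a value of -i ln(l). *)
Definition arg (l : C) : R := xget 0 [set t | expi t = l].

(* gamma_zeta(l) = exp(-i ln(l) zeta); independent of the choice of the
   logarithm when exp(2 pi zeta) = 1. *)
Definition gamma (zeta : 'M[R]_6) (l : C) : 'M[R]_6 := mexp (arg l *: zeta).

Definition U_ (zeta : 'M[R]_6) g : Prop :=
  exists2 h, Lambda_plus_alg h & iwasawa_R (fun l => h l *m mxC (gamma zeta l)) g.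

Definition Omega_ (zeta : 'M[R]_6) g : Prop :=
  exists2 a, SO6 a & forall l, circle l -> g l = Ad a (gamma zeta l).

Definition Omega_tau (tau : 'M[R]_6 -> 'M[R]_6) g : Prop :=
  OmegaG g /\
  forall l, circle l -> tau (g (- l) *m invmx (g (-1))) = g l.

Definition U_tau (zeta : 'M[R]_6) tau g : Prop := U_ zeta g /\ Omega_tau tau g.

Definition P_ (tau : 'M[R]_6 -> 'M[R]_6) : set 'M[R]_6 :=
  [set g | SO6 g /\ tau g = invmx g].

Definition P_comp (tau : 'M[R]_6 -> 'M[R]_6) (zeta : 'M[R]_6) : set 'M[R]_6 :=
  connected_component (P_ tau) (mexp (pi *: zeta)).

Implicit Type Phi : sphere R -> C -> 'M[R]_6.

(* Smoothness into the Frechet manifold of smooth loops is joint smoothness in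
   the point of the sphere and in the loop parameter.  The form is
   alpha = ax dx + ay dy; it is determined by Phi (take l = -1), so that the
   forms obtained in the two charts agree. *)
Definition extended_solution Phi : Prop :=
  (forall p, OmegaG (Phi p)) /\
  forall b : bool,
    smooth setT (fun q : R * R * R => Phi (chart b (cx q.1)) (expi q.2)) /\
    exists ax ay : C -> 'M[R]_6,
      [/\ forall z, so6 (ax z) /\ so6 (ay z),
          smooth setT (fun q => ax (cx q)) /\ smooth setT (fun q => ay (cx q)) &
          forall z l, circle l ->
            let Phi_l := fun w => mxC (Phi (chart b w) l) in
            invmx (Phi_l z) *m d_z Phi_l z =
              (2^-1 * (1 - l^-1)) *: (2^-1 *: (mxC (ax z) - 'i%C *: mxC (ay z))) /\
            invmx (Phi_l z) *m d_zbar Phi_l z =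
              (2^-1 * (1 - l)) *: (2^-1 *: (mxC (ax z) + 'i%C *: mxC (ay z)))].

(* Phi = \sum_(r <= i <= s) A_i l^i with A_r, A_s not identically zero and
   s - r = n; below A k stands for A_(r + k). *)
Definition uniton_number Phi (n : nat) : Prop :=
  exists (r : int) (A : nat -> sphere R -> 'M[C]_6),
    [/\ exists p, A 0 p <> 0, exists p, A n p <> 0 &
        forall p l, circle l ->
          mxC (Phi p l) = \sum_(k < n.+1) l ^ (r + k%:Z) *: A k p].

End Loops.

Section Classes.
Variable R : realType.
Local Notation C := (R[i]).
Variable u : 'I_3 -> 'cV[C]_6.

Definition isotropic_frame : Prop :=
  [/\ forall i j, (u i)^T *m u j = 0,
      forall i j, (u i)^T *m mxconj (u j) = (i == j)%:R%:M &
      basis_of fullv ([seq u i | i <- enum 'I_3] ++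
                      [seq mxconj (u i) | i <- enum 'I_3])].

(* The real matrix of i (u_i <conj u_i, .> - conj u_i <u_i, .>), which has
   E_i u_i = i u_i, E_i (conj u_i) = - i conj u_i and vanishes on the other
   vectors of the basis. *)
Definition E (i : 'I_3) : 'M[R]_6 :=
  mxRe ('i%C *: (u i *m (mxconj (u i))^T - mxconj (u i) *m (u i)^T)).

(* The indices 0, 1, 2 are those of u_1, u_2, u_3. *)
Definition zeta1 : 'M[R]_6 := E 0.
Definition zeta2 : 'M[R]_6 := E 0 + E 1.

Definition V0 : {vspace 'cV[R]_6} :=
  <[(mxRe ((Num.sqrt 2)%:C^-1 *: (u 2 + mxconj (u 2))))%R]>%VS.
Definition V1 : {vspace 'cV[C]_6} := <[mxconj (u 0%R)]>%VS.

Definition s0 : 'M[R]_6 := oproj V0 - oproj (annih V0).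
Definition sigma (g : 'M[R]_6) : 'M[R]_6 := Ad s0 g.
Definition sigma1 (g : 'M[R]_6) : 'M[R]_6 := Ad (mexp (pi *: zeta1)) (sigma g).
Definition sigma2 (g : 'M[R]_6) : 'M[R]_6 := Ad (mexp (pi *: zeta2)) (sigma g).

(* V_0 (+) V_1 (+) conj V_1, complexified *)
Definition X0 : {vspace 'cV[C]_6} := (cplx V0 + V1 + conjv V1)%VS.
Definition x0 : {vspace 'cV[R]_6} := real_points X0.

(* tau is the involution attached to zeta and zeta'. *)
Definition admissible (zeta zeta' : 'M[R]_6) (tau : 'M[R]_6 -> 'M[R]_6) : Prop :=
  [/\ zeta = zeta1 \/ zeta = zeta2 \/ zeta = zeta1 + zeta2,
      exists m1 m2 : nat, [/\ (m1 <= 2)%N, (m2 <= 2)%N &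
        zeta' = zeta1 *+ m1 + zeta2 *+ m2],
      exists k1 k2 : nat, zeta' - zeta = zeta1 *+ k1 + zeta2 *+ k2,
      P_comp sigma zeta' = P_comp sigma zeta1 &
      forall g, SO6 g -> tau g = Ad (mexp (pi *: (zeta' - zeta))) (sigma g)].

(* The element of P^tau_zeta identified with W = g . x_0 is q. *)
Definition identified (zeta zeta' : 'M[R]_6) (W : {vspace 'cV[R]_6})
    (q : 'M[R]_6) : Prop :=
  exists2 g, SO6 g & W = act g x0 /\
    q = mexp (pi *: (zeta' - zeta)) *m
        (mexp (pi *: zeta1) *m g *m sigma1 (invmx g)).

Implicit Types (phi : sphere R -> {vspace 'cV[R]_6}) (Phi : sphere R -> C -> 'M[R]_6).

(* Isometries are those induced by O(6). *)
Definition corresponding (zeta : 'M[R]_6) (tau : 'M[R]_6 -> 'M[R]_6) phi Phi : Prop :=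
  [/\ extended_solution Phi,
      forall p, Omega_alg (Phi p),
      exists2 D, discrete_set D & forall p, ~ D p -> U_tau zeta tau (Phi p) &
      exists2 zeta', admissible zeta zeta' tau &
        exists2 a, O6 a & forall p,
          identified zeta zeta' (act a (phi p)) (Phi p (-1))].

Definition associated zeta tau phi : Prop :=
  exists Phi, corresponding zeta tau phi Phi.

Definition S1_invariant zeta tau phi : Prop :=
  exists2 Phi, corresponding zeta tau phi Phi &
    exists2 D, discrete_set D & forall p, ~ D p -> Omega_ zeta (Phi p).

End Classes.

(* Main.v *)
From HB Require Import structures.
From mathcomp Require Import all_boot all_order all_algebra.
From mathcomp Require Import all_classical all_reals all_analysis.
From mathcomp Require Import perm complex ring lra zify.
Require Import Defs.

(** Off a discrete set the extended solution Phi lies in U_zeta with zeta = a E_1 + b E_2, so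
there h gamma_zeta = Phi f with h and f algebraic loops that extend to the disc. A Laurent
polynomial that extends to the disc is a polynomial ([disc_laurent_nonneg], from Goursat's
theorem [goursat]). Hence the powers of lambda in Phi start at -a, with the nonzero
coefficient h(0) M f(0)^T ([U_coef]), and by reality they end at a. The coefficients are
smooth on the sphere, so Phi = sum_k A_k lambda^(k-2), k < 5, everywhere, and the uniton
number is 2a ([class_uniton_number]).

Comparing powers of lambda in the equation of extended solutions gives
d_z A_k = (A_k - A_(k+1)) alpha and d_zbar A_k = (A_k - A_(k-1)) beta up to constant factors
([coef_equations]). If Phi is S^1-invariant, the A_k are the spectral projections of a
conjugate of gamma_zeta: orthogonal idempotents of constant rank whose transposes and whose
conjugates are the A_(4-k). Their images are the bundles of the theorem. The equations for
d_zbar make the images of the lowest A_k and of A_0 + A_1 holomorphic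
([holo_subbundle_of_projection]), those for d_z give the inclusions of derivatives
([d_sub_colspace]), and the relations between the A_k give isotropy.

The involutions sigma and sigma_1 are Ad s with a reflection s = 2 P - 1. The
symmetry of Phi under T_tau forces s to commute with the A_k ([idem_commute]), so
Phi(-1) s = (1 - 2 B) (2 P - 1), B = A_1 + A_3, is the reflection in the image of
(1 - B) P + B (1 - P), and up to an isometry this image is phi ([identified_refl]). When P
projects onto the line V_0, only A_2 can act on V_0, because A_k and A_k^T have product 0
([coef_xi]); so phi is the sum of V_0, the image of A_1 and its conjugate ([line_bundle],
[flag_bundles], [plane_meets_perp]). When P projects onto x_0 and zeta = zeta_2, a trace
computation shows that A_1 P and A_1 (1 - P) have rank one ([traces]), and their images are
L_1 and L_2 ([X0_bundles], [X0_decomposes]).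

In the class of zeta_1 every loop is S^1-invariant: with three coefficients, the lowest of
rank one, orthogonality and the value 1 at lambda = 1 make the loop a one-parameter
subgroup ([zeta1_loop]).

For the complements, let K be the rotation by a right angle in the plane of u_3 and
e_2 = exp (pi zeta_2). Then e_2 s_0 K = - K s_0, so conjugation by K carries the symmetry
under tau to that under Ad e_2 o tau, while the sign turns the reflection in phi into the
one in its orthogonal complement ([corresponding_complement], [harmonic_complement]). *)

Set Implicit Arguments.
Unset Strict Implicit.
Unset Printing Implicit Defensive.

Import Order.TTheory GRing.Theory Num.Theory.
Import numFieldNormedType.Exports.

Local Open Scope classical_set_scope.
Local Open Scope ring_scope.
Local Open Scope complex_scope.

Import Normc.

(** * Goursat's theorem *)

Section Goursat.
Variable R : realType.

Lemma increment_bound (f df : R -> R) (a b e : R) : a <= b ->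
  (forall x, a <= x <= b -> is_derive x 1 f (df x)) ->
  (forall x, a <= x <= b -> `|df x| <= e) ->
  `|f b - f a| <= e * (b - a).
Proof.
move=> ab d bd.
have [||c cab ->] := @MVT_segment R f df a b ab.
- by move=> x xab; apply: d; rewrite !ltW ?(itvP xab).
- apply: derivable_within_continuous => x xab.
  by have [] := d x _; rewrite ?(itvP xab).
rewrite normrM (ger0_norm (x := b - a)) ?subr_ge0//.
by apply: ler_wpM2r; rewrite ?subr_ge0// bd// ?(itvP cab).
Qed.

(** Total differentiability at (x0, y0), by closed inequalities on squares, the form in
which it is applied to the small rectangles of a bisection. *)
Definition differential2 (f : R -> R -> R) (x0 y0 fx fy : R) :=
  forall e : R, 0 < e -> exists2 d : R, 0 < d & forall x y : R,
    `|x - x0| <= d -> `|y - y0| <= d ->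
    `|f x y - f x0 y0 - fx * (x - x0) - fy * (y - y0)| <= e * (`|x - x0| + `|y - y0|).

(** The integral of P dx + Q dy around a rectangle, where A is an antiderivative of P in
x and B one of Q in y: with antiderivatives no line integral is needed. *)
Definition circulation (A B : R -> R -> R) (a c w h : R) :=
  (A (a + w) c - A a c) + (B (a + w) (c + h) - B (a + w) c)
  - (A (a + w) (c + h) - A a (c + h)) - (B a (c + h) - B a c).

(** The linear parts of P and Q share the coefficient py, so they form a closed form and
contribute nothing; what is left are the errors of the two differentials, estimated
side by side with the mean value inequality. *)
Lemma circulation_small (A B P Q : R -> R -> R) (x0 y0 e : R) (px py qy : R) :
  0 < e ->
  differential2 P x0 y0 px py -> differential2 Q x0 y0 py qy ->
  exists2 d : R, 0 < d & forall a c w h : R, 0 <= w <= d -> 0 <= h <= d ->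
    a <= x0 <= a + w -> c <= y0 <= c + h ->
    (forall x y, a <= x <= a + w -> c <= y <= c + h ->
       is_derive x 1 (A^~ y) (P x y)) ->
    (forall x y, a <= x <= a + w -> c <= y <= c + h ->
       is_derive y 1 (B x) (Q x y)) ->
    `|circulation A B a c w h| <= 2 * e * (w + h) ^+ 2.
Proof.
move=> e0 dP dQ.
have [d1 d10 HP] := dP _ e0; have [d2 d20 HQ] := dQ _ e0.
exists (Num.min d1 d2); first by rewrite lt_min d10.
move=> a c w h; rewrite !le_min => /and3P[w0 w1 w2] /and3P[h0 h1 h2].
move=> /andP[ax xa] /andP[cy yc] dA dB.
pose eA (y x : R) := A x y - (P x0 y0 * x + px * ((x - x0) * (x - x0) / 2) + py * (y - y0) * x).
pose eB (x y : R) := B x y - (Q x0 y0 * y + py * (x - x0) * y + qy * ((y - y0) * (y - y0) / 2)).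
have bA y : c <= y <= c + h -> `|eA y (a + w) - eA y a| <= e * (w + h) * w.
  move=> yI.
  have -> : e * (w + h) * w = e * (w + h) * ((a + w) - a) by ring.
  apply: (@increment_bound _ (fun x => P x y - P x0 y0 - px * (x - x0) - py * (y - y0))).
  - by rewrite lerDl.
  - move=> x xI; have H := dA _ _ xI yI.
    rewrite /eA; apply: is_derive_eq.
    rewrite /GRing.scale /=; by field.
  - move=> x /andP[x1 x2'].
    have xx : `|x - x0| <= w by rewrite ler_norml; lra.
    have yy : `|y - y0| <= h by rewrite ler_norml; lra.
    apply: (le_trans (HP _ _ _ _)); [lra|lra|].
    by rewrite ler_pM2l // lerD.
have bB x : a <= x <= a + w -> `|eB x (c + h) - eB x c| <= e * (w + h) * h.
  move=> xI.
  have -> : e * (w + h) * h = e * (w + h) * ((c + h) - c) by ring.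
  apply: (@increment_bound _ (fun y => Q x y - Q x0 y0 - py * (x - x0) - qy * (y - y0))).
  - by rewrite lerDl.
  - move=> y yI; have H := dB _ _ xI yI.
    rewrite /eB; apply: is_derive_eq.
    rewrite /GRing.scale /=; by field.
  - move=> y /andP[y1 y2'].
    have xx : `|x - x0| <= w by move: xI => /andP[? ?]; rewrite ler_norml; lra.
    have yy : `|y - y0| <= h by rewrite ler_norml; lra.
    apply: (le_trans (HQ _ _ _ _)); [lra|lra|].
    by rewrite ler_pM2l // lerD.
have -> : circulation A B a c w h =
  (eA c (a + w) - eA c a) + (eB (a + w) (c + h) - eB (a + w) c)
  - (eA (c + h) (a + w) - eA (c + h) a) - (eB a (c + h) - eB a c).
  by rewrite /circulation /eA /eB; field.
have aI : a <= a <= a + w by rewrite lexx lerDl.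
have awI : a <= a + w <= a + w by rewrite lexx lerDl w0.
have cI : c <= c <= c + h by rewrite lexx lerDl.
have chI : c <= c + h <= c + h by rewrite lexx lerDl h0.
have := bA _ cI; have := bA _ chI; have := bB _ aI; have := bB _ awI.
rewrite !ler_norml; nra.
Qed.

(** The four quarters of a rectangle share the circulation among them. *)
Lemma circulation_quarter (A B : R -> R -> R) (a c w h : R) :
  exists q : R * R, [/\ q.1 = a \/ q.1 = a + w / 2, q.2 = c \/ q.2 = c + h / 2 &
    `|circulation A B a c w h| <= 4 * `|circulation A B q.1 q.2 (w / 2) (h / 2)|].
Proof.
have E : circulation A B a c w h =
   circulation A B a c (w / 2) (h / 2) + circulation A B (a + w / 2) c (w / 2) (h / 2)
 + circulation A B a (c + h / 2) (w / 2) (h / 2)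
 + circulation A B (a + w / 2) (c + h / 2) (w / 2) (h / 2).
  have ew (x : R) : x / 2 + x / 2 = x by lra.
  by rewrite /circulation -!addrA !ew; ring.
have [h1|h1] := leP `|circulation A B a c w h| (4 * `|circulation A B a c (w / 2) (h / 2)|).
  by exists (a, c); split => //; left.
have [h2|h2] := leP `|circulation A B a c w h| (4 * `|circulation A B (a + w / 2) c (w / 2) (h / 2)|).
  by exists (a + w / 2, c); split => //; [right|left].
have [h3|h3] := leP `|circulation A B a c w h| (4 * `|circulation A B a (c + h / 2) (w / 2) (h / 2)|).
  by exists (a, c + h / 2); split => //; [left|right].
exists (a + w / 2, c + h / 2); split; [by right|by right|].
move: E h1 h2 h3; move: (circulation _ _ _ _ _ _) => I.
move: (circulation _ _ _ _ _ _) => I1; move: (circulation _ _ _ _ _ _) => I2.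
move: (circulation _ _ _ _ _ _) => I3 /=.
move: (circulation _ _ _ _ _ _) => I4 -> h1 h2 h3.
have := ler_normD (I1 + I2 + I3) I4; have := ler_normD (I1 + I2) I3; have := ler_normD I1 I2.
lra.
Qed.

(** Bisection keeps at each step a quarter with at least a fourth of the circulation, and
the quarters shrink to a point of differentiability, where the circulation is of
smaller order than the area. *)
Theorem goursat (A B P Q : R -> R -> R) (a c w h : R) : 0 <= w -> 0 <= h ->
  (forall x y, a <= x <= a + w -> c <= y <= c + h ->
     is_derive x 1 (A^~ y) (P x y)) ->
  (forall x y, a <= x <= a + w -> c <= y <= c + h ->
     is_derive y 1 (B x) (Q x y)) ->
  (forall x y, a <= x <= a + w -> c <= y <= c + h ->
     exists px py qy, differential2 P x y px py /\ differential2 Q x y py qy) ->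
  circulation A B a c w h = 0.
Proof.
move=> w0 h0 dA dB dPQ.
pose W n := w / 2 ^+ n; pose H n := h / 2 ^+ n.
have WS n : W n.+1 = W n / 2 by rewrite /W exprS; field; rewrite expf_neq0.
have HS n : H n.+1 = H n / 2 by rewrite /H exprS; field; rewrite expf_neq0.
have W0 n : 0 <= W n by rewrite divr_ge0// exprn_ge0.
have H0 n : 0 <= H n by rewrite divr_ge0// exprn_ge0.
pose good n (p q : R * R) := [/\ q.1 = p.1 \/ q.1 = p.1 + W n / 2, q.2 = p.2 \/ q.2 = p.2 + H n / 2 &
    `|circulation A B p.1 p.2 (W n) (H n)| <= 4 * `|circulation A B q.1 q.2 (W n / 2) (H n / 2)|].
pose s := fix s n := if n is m.+1 then xget (s m) [set q | good m (s m) q] else (a, c).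
have sP n : good n (s n) (s n.+1).
  rewrite /=; case: xgetP => [q _ //|].
  have [q qP] := circulation_quarter A B (s n).1 (s n).2 (W n) (H n).
  by move=> /(_ q).
have lo n m : (s n).1 <= (s (n + m)%N).1 /\ (s n).2 <= (s (n + m)%N).2 /\
   (s (n + m)%N).1 + W (n + m)%N <= (s n).1 + W n /\
   (s (n + m)%N).2 + H (n + m)%N <= (s n).2 + H n.
  elim: m => [|m [i1 [i2 [i3 i4]]]]; first by rewrite addn0.
  have [g1 g2 _] := sP (n + m)%N; rewrite addnS.
  have := W0 (n + m)%N; have := H0 (n + m)%N; rewrite WS HS.
  by case: g1 => ->; case: g2 => ->; lra.
have ubd (n : nat) : ubound (range (fun k => (s k).1)) ((s n).1 + W n) /\
  ubound (range (fun k => (s k).2)) ((s n).2 + H n).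
  split => _ [k _ <-] /=.
    have [nk|/ltnW kn] := leqP n k.
      by have := lo n (k - n)%N; rewrite subnKC//; have := W0 k; lra.
    by have := lo k (n - k)%N; rewrite subnKC//; have := W0 n; lra.
  have [nk|/ltnW kn] := leqP n k.
    by have := lo n (k - n)%N; rewrite subnKC//; have := H0 k; lra.
  by have := lo k (n - k)%N; rewrite subnKC//; have := H0 n; lra.
pose x0 := sup (range (fun k => (s k).1)); pose y0 := sup (range (fun k => (s k).2)).
have x0P n : (s n).1 <= x0 <= (s n).1 + W n.
  apply/andP; split.
    by apply: ub_le_sup; [exists ((s n).1 + W n); have [] := ubd n|exists n].
  by apply: ge_sup; [exists (s 0).1; exists 0%N|have [] := ubd n].
have y0P n : (s n).2 <= y0 <= (s n).2 + H n.
  apply/andP; split.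
    by apply: ub_le_sup; [exists ((s n).2 + H n); have [] := ubd n|exists n].
  by apply: ge_sup; [exists (s 0).2; exists 0%N|have [] := ubd n].
have big n : `|circulation A B a c w h| <= 4 ^+ n * `|circulation A B (s n).1 (s n).2 (W n) (H n)|.
  elim: n => [|n IH]; first by rewrite /W /H !expr0 !divr1 mul1r.
  apply: (le_trans IH); rewrite exprSr -mulrA ler_pM2l ?exprn_gt0//.
  by have [_ _] := sP n; rewrite WS HS.
have W00 : W 0 = w by rewrite /W expr0 divr1.
have H00 : H 0 = h by rewrite /H expr0 divr1.
have [||px [py [qy [dP dQ]]]] := dPQ x0 y0.
- by have := x0P 0; rewrite W00.
- by have := y0P 0; rewrite H00.
apply/eqP; apply: contraT => Ineq0.
have Ipos : 0 < `|circulation A B a c w h| by rewrite normr_gt0.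
pose e := `|circulation A B a c w h| / (4 * ((w + h) ^+ 2 + 1)).
have e0 : 0 < e by rewrite divr_gt0// mulr_gt0// ltr_wpDl// sqr_ge0.
have [d d0 small] := circulation_small A B e0 dP dQ.
have [n nP] : exists n : nat, (w + h) / 2 ^+ n <= d.
  have [n] : exists n : nat, (w + h) / d < n%:R.
    by exists (Num.truncn ((w + h) / d)).+1; rewrite truncnS_gt// real0 ?num_real.
  move=> nP; exists n; rewrite ler_pdivrMr ?exprn_gt0//.
  move: nP; rewrite ltr_pdivrMr// => /ltW/le_trans; apply.
  rewrite mulrC ler_pM2l// -natrX ler_nat; exact: ltnW (ltn_expl _ _).
have Wd : 0 <= W n <= d.
  rewrite W0/= (le_trans _ nP)// ler_pM2r ?invr_gt0 ?exprn_gt0//; lra.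
have Hd : 0 <= H n <= d.
  rewrite H0/= (le_trans _ nP)// ler_pM2r ?invr_gt0 ?exprn_gt0//; lra.
have := small _ _ _ _ Wd Hd (x0P n) (y0P n).
have sub x y : (s n).1 <= x <= (s n).1 + W n -> (s n).2 <= y <= (s n).2 + H n ->
   a <= x <= a + w /\ c <= y <= c + h.
  have := lo 0 n; rewrite add0n W00 H00 /=; lra.
move=> {}small; have {small}Is : `|circulation A B (s n).1 (s n).2 (W n) (H n)| <= 2 * e * (W n + H n) ^+ 2.
  by apply: small => x y xI yI; have [? ?] := sub _ _ xI yI; [exact: dA|exact: dB].
have : `|circulation A B a c w h| <= 2 * e * (w + h) ^+ 2.
  apply: (le_trans (big n)); rewrite mulrC -ler_pdivlMr ?exprn_gt0//.
  have E : (W n + H n) ^+ 2 = (w + h) ^+ 2 / 4 ^+ n.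
    rewrite /W /H -mulrDl expr_div_n -exprM mulnC exprM.
    by have -> : 2 ^+ 2 = 4 :> R by ring.
  by move: Is; rewrite E mulrA.
rewrite leNgt => /negP[].
rewrite /e; set I := `|circulation _ _ _ _ _ _|; set t := (w + h) ^+ 2.
have t0 : 0 <= t by rewrite sqr_ge0.
have -> : 2 * (I / (4 * (t + 1))) * t = I * (t / (2 * (t + 1))).
  by field; apply/eqP; lra.
rewrite gtr_pMr // ltr_pdivrMr; lra.
Qed.

End Goursat.

(** * Complex derivatives and the exponential *)

Section ComplexDerivative.
Variable R : realType.
Local Notation C := R[i].

(** Complex differentiability by real bounds, so that it splits easily into real and
imaginary parts; see [derivable_cdiff]. *)
Definition cdiff (f : C -> C) (z a : C) :=
  forall e : R, 0 < e -> exists2 d : R, 0 < d & forall w : C, normc (w - z) <= d ->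
    normc (f w - f z - a * (w - z)) <= e * normc (w - z).

Lemma normC_normc (z : C) : `|z| = (normc z)%:C.
Proof. by case: z => x y; rewrite normc_def. Qed.

Lemma normc_ge0 (z : C) : 0 <= normc z.
Proof. by case: z => x y /=; rewrite sqrtr_ge0. Qed.

Lemma normcB (x y : C) : normc (x - y) = normc (y - x).
Proof. by rewrite -opprB normcN. Qed.

Lemma normRe_le (z : C) : `|complex.Re z| <= normc z.
Proof.
case: z => x y /=; rewrite -sqrtr_sqr ler_sqrt ?addr_ge0 ?sqr_ge0//.
by rewrite lerDl sqr_ge0.
Qed.

Lemma normIm_le (z : C) : `|complex.Im z| <= normc z.
Proof.
case: z => x y /=; rewrite -sqrtr_sqr ler_sqrt ?addr_ge0 ?sqr_ge0//.
by rewrite lerDr sqr_ge0.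
Qed.

Lemma normc_le (x y : R) : normc (x +i* y) <= `|x| + `|y|.
Proof.
rewrite /= -(ler_pXn2r (n := 2)) ?nnegrE ?sqrtr_ge0 ?addr_ge0//.
rewrite sqr_sqrtr ?addr_ge0 ?sqr_ge0// sqrrD !real_normK ?num_real//.
by rewrite -addrA (addrC (_ *+ 2)) addrA lerDl mulrn_wge0// mulr_ge0.
Qed.

Lemma nbhs_normcP (z : C^o) (P : set C^o) :
  (\forall w \near z, P w) <->
  exists2 d : R, 0 < d & forall w : C, normc (w - z) < d -> P w.
Proof.
split.
  move=> /nbhs_ballP[e /= e0 H].
  have er : e = (complex.Re e)%:C by rewrite RRe_real// gtr0_real.
  exists (complex.Re e); first by move: e0; rewrite {1}er ltcR.
  move=> w wz; apply: H; rewrite /ball/= er distrC normC_normc ltcR//.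
move=> [d d0 H]; apply/nbhs_ballP; exists d%:C; first by rewrite /= ltcR.
by move=> w /=; rewrite /ball/= normC_normc ltcR normcB => /H.
Qed.

Lemma dnbhs_normcP (z : C^o) (P : set C^o) :
  (\forall w \near z^', P w) <->
  exists2 d : R, 0 < d & forall w : C, w != z -> normc (w - z) < d -> P w.
Proof.
rewrite /dnbhs /within /=.
split.
  by move=> /nbhs_normcP[d d0 H]; exists d => // w wz /H; apply.
by move=> [d d0 H]; apply/nbhs_normcP; exists d => // w /H; move=> + wz; apply.
Qed.

Lemma derivable_cdiff (f : C^o -> C^o) (z : C^o) :
  derivable f z 1 <-> exists a, cdiff f z a.
Proof.
split.
  move=> df; exists ('D_1 f z) => e e0.
  have := df; rewrite /derivable => /cvg_ex[l fl].
  have -> : 'D_1 f z = l by apply: cvg_lim fl; exact: norm_hausdorff.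
  move/cvgrPdist_le : fl => /(_ e%:C); rewrite ltcR => /(_ e0).
  move=> /(@dnbhs_normcP 0)[d d0 H]; exists (d / 2); first by rewrite divr_gt0.
  move=> w wz; have [->|wz0] := eqVneq w z.
    by rewrite !subrr mulr0 subr0 normc0 mulr0.
  have := H (w - z); rewrite subr_eq0 subr0 => /(_ wz0).
  have wd : normc (w - z) < d by lra.
  move=> /(_ wd) /=; rewrite /GRing.scale /= mulr1 subrK normC_normc lecR => le.
  have -> : f w - f z - l * (w - z) = - (l - (w - z)^-1 * (f w - f z)) * (w - z).
    by field; rewrite subr_eq0.
  by rewrite normcM normcN ler_wpM2r ?normc_ge0.
move=> [a fa]; apply/cvg_ex; exists a; apply/cvgrPdist_le => e e0.
have er : e = (complex.Re e)%:C by rewrite RRe_real// gtr0_real.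
have e'0 : 0 < complex.Re e by move: e0; rewrite {1}er ltcR.
have [d d0 H] := fa _ e'0.
apply/(@dnbhs_normcP 0); exists d => // h h0; rewrite subr0 => hd.
have := H (z + h); rewrite addrAC subrr add0r => /(_ (ltW hd)) le.
rewrite er normC_normc lecR /GRing.scale/= mulr1 (addrC h).
have -> : a - h^-1 * (f (z + h) - f z) = - (f (z + h) - f z - a * h) / h by field.
rewrite normcM normcN normcV ler_pdivrMr// lt_neqAle normc_ge0 andbT eq_sym.
by apply: contra h0 => /eqP/eq0_normc ->.
Qed.

Lemma cdiff_comp (f g : C -> C) (z a b : C) :
  cdiff g z b -> cdiff f (g z) a -> cdiff (f \o g) z (a * b).
Proof.
move=> dg df e e0.
have na := normc_ge0 a; have nb := normc_ge0 b.
pose e1 := e / (2 * (normc b + 1)); have e10 : 0 < e1 by rewrite divr_gt0// mulr_gt0// ltr_wpDl.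
pose e2 := Num.min 1 (e / (2 * (normc a + 1))).
have e20 : 0 < e2 by rewrite lt_min ltr01 divr_gt0// mulr_gt0// ltr_wpDl.
have [d1 d10 H1] := df _ e10; have [d2 d20 H2] := dg _ e20.
exists (Num.min d2 (d1 / (normc b + 1))); first by rewrite lt_min d20 divr_gt0// ltr_wpDl.
move=> w; rewrite le_min => /andP[w2 w1].
have G := H2 _ w2; have nw := normc_ge0 (w - z).
have gl : normc (g w - g z) <= (normc b + 1) * normc (w - z).
  have -> : g w - g z = (g w - g z - b * (w - z)) + b * (w - z) by ring.
  apply: (le_trans (le_normcD _ _)); rewrite normcM mulrDl addrC mul1r lerD2l.
  by apply: (le_trans G); rewrite -[leRHS]mul1r ler_wpM2r// ge_min lexx.
have gd : normc (g w - g z) <= d1.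
  by apply: (le_trans gl); rewrite mulrC -ler_pdivlMr// ltr_wpDl.
have -> : (f \o g) w - (f \o g) z - a * b * (w - z) =
  (f (g w) - f (g z) - a * (g w - g z)) + a * (g w - g z - b * (w - z)).
  by rewrite /=; ring.
apply: (le_trans (le_normcD _ _)); rewrite normcM.
have F := H1 _ gd.
have -> : e * normc (w - z) = e / 2 * normc (w - z) + e / 2 * normc (w - z) by field.
apply: lerD.
  apply: (le_trans F); apply: (le_trans (ler_wpM2l (ltW e10) gl)).
  by rewrite mulrA ler_wpM2r// /e1 le_eqVlt; apply/orP; left; apply/eqP; field; lra.
apply: (le_trans (ler_wpM2l na G)); rewrite mulrA ler_wpM2r//.
have : e2 <= e / (2 * (normc a + 1)) by rewrite ge_min lexx orbT.
move=> /(ler_wpM2l na)/le_trans; apply.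
rewrite mulrA ler_pdivrMr; last by lra.
by nra.
Qed.

Lemma cdiff_continuous (f : C -> C) (z a : C) : cdiff f z a ->
  forall e : R, 0 < e -> exists2 d : R, 0 < d & forall w : C, normc (w - z) <= d ->
    normc (f w - f z) <= e.
Proof.
move=> /(_ 1 ltr01)[d d0 H] e e0; have na := normc_ge0 a.
exists (Num.min d (e / (normc a + 1))); first by rewrite lt_min d0 divr_gt0// ltr_wpDl.
move=> w; rewrite le_min => /andP[/H w1 w2].
have -> : f w - f z = (f w - f z - a * (w - z)) + a * (w - z) by ring.
apply: (le_trans (le_normcD _ _)); rewrite normcM.
apply: (le_trans (lerD w1 (lexx _))); rewrite -mulrDl addrC mulrC -ler_pdivlMr//.
by rewrite ltr_wpDl.
Qed.

Definition cexp (z : C) : C := (expR (complex.Re z))%:C * expi (complex.Im z).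

Lemma cexpD z w : cexp (z + w) = cexp z * cexp w.
Proof.
case: z w => [x y] [s t]; rewrite /cexp /= /expi expRD sinD cosD.
by apply/eqP; rewrite eq_complex /=; apply/andP; split; apply/eqP; ring.
Qed.

Lemma cexp0 : cexp 0 = 1.
Proof.
rewrite /cexp /= expR0 /expi cos0 sin0.
by apply/eqP; rewrite eq_complex /=; apply/andP; split; apply/eqP; ring.
Qed.

Lemma normc_expi (t : R) : normc (expi t) = 1.
Proof. by rewrite /= cos2Dsin2 sqrtr1. Qed.

Lemma normc_cexp z : normc (cexp z) = expR (complex.Re z).
Proof.
by rewrite /cexp normcM normc_expi mulr1 /= expr0n addr0 sqrtr_sqr ger0_norm// expR_ge0.
Qed.

Lemma derive_eps (f : R -> R) (x a : R) : is_derive x 1 f a ->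
  forall e : R, 0 < e -> exists2 d : R, 0 < d & forall y, `|y - x| <= d ->
    `|f y - f x - a * (y - x)| <= e * `|y - x|.
Proof.
move=> [df dv] e e0.
have : (fun h : R => h^-1 *: (f (h *: 1 + x) - f x)) @ 0^' --> a.
  by rewrite -dv; exact: df.
move=> /cvgrPdist_le/(_ _ e0).
rewrite near_withinE => /nbhs_ballP[d /= d0 H].
exists (d / 2); first by rewrite divr_gt0.
move=> y yd; have [->|yx] := eqVneq y x; first by rewrite !subrr mulr0 subr0 normr0 mulr0.
have := H (y - x); rewrite /ball /= sub0r normrN subr_eq0 => /(_ _ yx).
have yd' : `|y - x| < d by lra.
move=> /(_ yd'); rewrite /GRing.scale /= mulr1 subrK => le.
have -> : f y - f x - a * (y - x) = - (a - (y - x)^-1 * (f y - f x)) * (y - x).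
  by field; rewrite subr_eq0.
by rewrite normrM normrN ler_wpM2r.
Qed.

(** The addition formula reduces the claim to the point 0, where it follows from the
derivatives of the real exponential, cosine and sine. *)
Lemma cdiff_cexp z : cdiff cexp z (cexp z).
Proof.
suff H : cdiff cexp 0 1.
  move=> e e0; have ne : 0 < normc (cexp z) by rewrite normc_cexp expR_gt0.
  have [d d0 Hd] := H (e / normc (cexp z)) (divr_gt0 e0 ne).
  exists d => // w wz; have := Hd (w - z); rewrite subr0 => /(_ wz).
  rewrite cexp0 mul1r => Hw.
  have -> : cexp w - cexp z - cexp z * (w - z) = cexp z * (cexp (w - z) - 1 - (w - z)).
    have {1}-> : w = z + (w - z) by ring.
    by rewrite cexpD; ring.
  by rewrite normcM mulrC -ler_pdivlMr// mulrAC.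
move=> e e0; pose e' := Num.min 1 (e / 8).
have e'0 : 0 < e' by rewrite lt_min ltr01 divr_gt0.
have e'1 : e' <= 1 by rewrite ge_min lexx.
have e'e : e' <= e / 8 by rewrite ge_min lexx orbT.
have [d1 d10 H1] := derive_eps (is_derive_expR 0) e'0.
have [d2 d20 H2] := derive_eps (is_derive_cos 0) e'0.
have [d3 d30 H3] := derive_eps (is_derive_sin 0) e'0.
pose d := Num.min (Num.min d1 d2) (Num.min d3 (e' / 2)).
have : [/\ d <= d1, d <= d2, d <= d3 & d <= e' / 2].
  by rewrite /d; split; rewrite !ge_min lexx ?orbT.
have d0 : 0 < d by rewrite !lt_min d10 d20 d30 divr_gt0.
move: d d0 => d d0 [dd1 dd2 dd3 dd4].
exists d => // -[x y]; rewrite subr0 => wd.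
have xn := le_trans (normRe_le (x +i* y)) wd; have yn := le_trans (normIm_le (x +i* y)) wd.
move: (normRe_le (x +i* y)) (normIm_le (x +i* y)) xn yn; rewrite [complex.Re _]/= [complex.Im _]/=.
move: (normc _) => N xN yN xd yd.
have := H1 x; have := H2 y; have := H3 y.
rewrite !subr0 expR0 cos0 sin0 oppr0 mul0r !mul1r !subr0 addr0 => h3 h2 h1.
have {h1} := h1 (le_trans xd dd1); have {h2} := h2 (le_trans yd dd2); have {h3} := h3 (le_trans yd dd3).
rewrite cexp0 -[cexp _]/((expR x)%:C * (cos y +i* sin y)).
move: (expR x) (cos y) (sin y) => E c s h3 h2 h1.
have -> : E%:C * (c +i* s) - 1 - (x +i* y) = (E * c - 1 - x) +i* (E * s - y).
  by apply/eqP; rewrite eq_complex /=; apply/andP; split; apply/eqP; ring.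
apply: (le_trans (normc_le _ _)).
have x0 := normr_ge0 x; have y0 := normr_ge0 y.
have Eb : `|E - 1| <= e'.
  have : E - 1 = (E - 1 - x) + x by ring.
  move=> ->; apply: (le_trans (ler_normD _ _)); nra.
have E2 : `|E| <= 2.
  have -> : E = (E - 1) + 1 by ring.
  by apply: (le_trans (ler_normD _ _)); rewrite normr1; lra.
have b1 : `|E * c - 1 - x| <= 3 * e' * N.
  have -> : E * c - 1 - x = (E - 1 - x) + E * (c - 1) by ring.
  apply: (le_trans (ler_normD _ _)); rewrite normrM.
  have := normr_ge0 (c - 1); nra.
have b2 : `|E * s - y| <= 3 * e' * N.
  have -> : E * s - y = E * (s - y) + (E - 1) * y by ring.
  apply: (le_trans (ler_normD _ _)); rewrite !normrM.
  have := normr_ge0 (s - y); have := normr_ge0 (E - 1); nra.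
nra.
Qed.

End ComplexDerivative.

(** * Circle means of functions on the disc *)

Section DiscExtension.
Variable R : realType.
Local Notation C := R[i].

Lemma ReB (a b : C) : complex.Re (a - b) = complex.Re a - complex.Re b.
Proof. by case: a => ? ?; case: b. Qed.

Lemma ImB (a b : C) : complex.Im (a - b) = complex.Im a - complex.Im b.
Proof. by case: a => ? ?; case: b. Qed.

Lemma expiD (s t : R) : expi (s + t) = expi s * expi t.
Proof.
rewrite /expi sinD cosD.
by apply/eqP; rewrite eq_complex /=; apply/andP; split; apply/eqP; ring.
Qed.

Lemma expi0 : expi (0 : R) = 1.
Proof. by rewrite /expi cos0 sin0. Qed.

Lemma expi_neq0 (t : R) : expi t != 0.
Proof.
apply/eqP => e0; have := normc_expi t; rewrite e0 normc0 => /eqP.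
by rewrite eq_sym oner_eq0.
Qed.

Lemma expiN (t : R) : expi (- t) = (expi t)^-1.
Proof.
by apply: (mulfI (expi_neq0 t)); rewrite mulfV ?expi_neq0// -expiD subrr expi0.
Qed.

Lemma expiX (t : R) (n : nat) : expi t ^+ n = expi (n%:R * t).
Proof.
elim: n => [|n IH]; first by rewrite mul0r expi0 expr0.
by rewrite exprS IH -expiD -[n.+1]add1n natrD mulrDl mul1r.
Qed.

Lemma expiz (t : R) (m : int) : expi t ^ m = expi (m%:~R * t).
Proof.
case: m => n; first by rewrite -exprnP expiX.
by rewrite NegzE -exprnN expiX -expiN mulrNz mulNr.
Qed.

Lemma cdiff_differential2 (g : C -> C) (x y : R) (a : C) :
  cdiff g (x +i* y) a ->
  differential2 (fun s t => complex.Im (g (s +i* t))) x y (complex.Im a) (complex.Re a) /\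
  differential2 (fun s t => complex.Re (g (s +i* t))) x y (complex.Re a) (- complex.Im a).
Proof.
move=> dg; split => e e0; have [d d0 H] := dg _ e0.
- exists (d / 2); first by rewrite divr_gt0.
  move=> s t sx ty.
  have E : s +i* t - x +i* y = (s - x) +i* (t - y) by [].
  have nl := normc_le (s - x) (t - y).
  have := H (s +i* t); rewrite E => /(_ (le_trans nl _)); rewrite [X in X <= d -> _]addrC.
  have dd : `|t - y| + `|s - x| <= d by lra.
  move=> /(_ dd) => le.
  apply: (le_trans _ (le_trans le (ler_wpM2l (ltW e0) nl))).
  apply: (le_trans _ (normIm_le _)).
  rewrite le_eqVlt; apply/orP; left; apply/eqP; congr `|_|.
  case: a {dg H le} => p q; case: (g _) => a1 a2; case: (g _) => a3 a4 /=; ring.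
- exists (d / 2); first by rewrite divr_gt0.
  move=> s t sx ty.
  have E : s +i* t - x +i* y = (s - x) +i* (t - y) by [].
  have nl := normc_le (s - x) (t - y).
  have := H (s +i* t); rewrite E => /(_ (le_trans nl _)); rewrite [X in X <= d -> _]addrC.
  have dd : `|t - y| + `|s - x| <= d by lra.
  move=> /(_ dd) => le.
  apply: (le_trans _ (le_trans le (ler_wpM2l (ltW e0) nl))).
  apply: (le_trans _ (normRe_le _)).
  rewrite le_eqVlt; apply/orP; left; apply/eqP; congr `|_|.
  case: a {dg H le} => p q; case: (g _) => a1 a2; case: (g _) => a3 a4 /=; ring.
Qed.

Lemma eps_continuous (f : R -> R) (x : R) :
  (forall e : R, 0 < e -> exists2 d : R, 0 < d & forall y : R, `|y - x| <= d -> `|f y - f x| <= e) ->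
  {for x, continuous f}.
Proof.
move=> H; apply/cvgrPdist_le => e e0; have [d d0 {}H] := H _ e0.
apply/nbhs_ballP; exists d => // y; rewrite /ball /= distrC => yd.
by rewrite distrC; apply/H/ltW.
Qed.

Lemma antiderivative_itv (f : R -> R) (a b : R) :
  (forall x : R, a < x < b -> {for x, continuous f}) -> forall s t : R, a < s -> t < b ->
  exists F : R -> R, forall x : R, s < x < t -> is_derive x 1 F (f x).
Proof.
move=> cf s t ast tb.
have [ts|st] := leP t s.
  by exists (fun _ => 0) => x /andP[sx xt]; have := lt_trans sx xt; rewrite ltNge ts.
exists (fun x => \int[lebesgue_measure]_(t in [set` `[s, x]]) (f t))%R.
move=> x /andP[sx xt].
have fi : lebesgue_measure.-integrable `[s, t] (EFin \o f).
  apply: continuous_compact_integrable; first exact: segment_compact.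
  apply: continuous_in_subspaceT => y; rewrite inE /= in_itv /= => /andP[sy yt].
  by apply: cf; lra.
have cx : {for x, continuous f} by apply: cf; lra.
have [d e] := continuous_FTC1_closed xt fi sx cx.
by apply: DeriveDef; [exact: d | rewrite -e derive1E].
Qed.

(** In the coordinate z = exp (x + i y) the circles about 0 become vertical segments, and
Goursat's theorem on a rectangle of height 2 pi compares the integrals of Re F over
two of them. B x is an antiderivative along the segment of abscissa x. *)
Lemma disc_circle_means (F : C -> C) :
  (forall z, normc z < 1 -> exists a, cdiff F z a) ->
  forall x1 x2 : R, x1 < x2 -> x2 < 0 ->
  exists B : R -> R -> R,
    (forall x y : R, x1 <= x <= x2 -> 0 <= y <= pi *+ 2 ->
      is_derive y 1 (B x) (complex.Re (F (cexp (x +i* y))))) /\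
    B x1 (pi *+ 2) - B x1 0 = B x2 (pi *+ 2) - B x2 0.
Proof.
move=> dF x1 x2 x12 x20.
pose g := F \o @cexp R.
have dg (x y : R) : x < 0 -> exists a, cdiff g (x +i* y) a.
  move=> x0; have [|a da] := dF (cexp (x +i* y)).
    by rewrite normc_cexp /= expR_lt1.
  by exists (a * cexp (x +i* y)); apply: cdiff_comp da; exact: cdiff_cexp.
have cRe (x y : R) : x < 0 -> {for y, continuous (fun t : R => complex.Re (g (x +i* t)))}.
  move=> x0; apply: eps_continuous => e e0; have [a /cdiff_continuous/(_ _ e0)[d d0 H]] := dg _ y x0.
  exists d => // t ty; have E : x +i* t - x +i* y = 0 +i* (t - y) by rewrite -[LHS]/((x - x) +i* (t - y)) subrr.
  have := H (x +i* t); rewrite E /= expr0n add0r sqrtr_sqr => /(_ ty); apply: le_trans.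
  by rewrite -ReB normRe_le.
have cIm (x y : R) : x < 0 -> {for x, continuous (fun s : R => complex.Im (g (s +i* y)))}.
  move=> x0; apply: eps_continuous => e e0; have [a /cdiff_continuous/(_ _ e0)[d d0 H]] := dg _ y x0.
  exists d => // t ty; have E : t +i* y - x +i* y = (t - x) +i* 0 by rewrite -[LHS]/((t - x) +i* (y - y)) subrr.
  have := H (t +i* y); rewrite E /= expr0n addr0 sqrtr_sqr => /(_ ty); apply: le_trans.
  by rewrite -ImB normIm_le.
have pi0 := pi_gt0 R.
have [B dB] : exists B : R -> R -> R, forall x y : R, x1 <= x <= x2 -> 0 <= y <= pi *+ 2 ->
    is_derive y 1 (B x) (complex.Re (g (x +i* y))).
  have : forall x : R, exists b : R -> R, x1 <= x <= x2 -> forall y : R, 0 <= y <= pi *+ 2 ->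
    is_derive y 1 b (complex.Re (g (x +i* y))).
    move=> x; have [xI|] := boolP (x1 <= x <= x2); last by exists id.
    have [|||F0 F0P] := @antiderivative_itv (fun t : R => complex.Re (g (x +i* t))) (-2) (pi *+ 2 + 2) _ (-1) (pi *+ 2 + 1).
    - by move=> y _; apply: cRe; lra.
    - lra.
    - lra.
    by exists F0 => _ y yI; apply: F0P; lra.
  by move=> /choice[B HB]; exists B => x y xI yI; exact: HB.
have [A dA] : exists A : R -> R -> R, forall y x : R, x1 <= x <= x2 ->
    is_derive x 1 (A y) (complex.Im (g (x +i* y))).
  have : forall y : R, exists a : R -> R, forall x : R, x1 <= x <= x2 -> 
    is_derive x 1 a (complex.Im (g (x +i* y))).
    move=> y; have [|||a aP] := @antiderivative_itv (fun t : R => complex.Im (g (t +i* y))) (x1 - 2) 0 _ (x1 - 1) (x2 / 2).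
    - by move=> x xI; apply: cIm; lra.
    - lra.
    - lra.
    by exists a => x xI; apply: aP; lra.
  by move=> /choice[A HA]; exists A.
exists B; split; first exact: dB.
(* g is 2 pi-periodic in y: one antiderivative serves both horizontal sides, which then cancel *)
pose A' (x y : R) := A (if y == pi *+ 2 then 0 else y) x.
have := @goursat _ A' B (fun x y : R => complex.Im (g (x +i* y))) (fun x y : R => complex.Re (g (x +i* y)))
  x1 0 (x2 - x1) (pi *+ 2).
have -> : x1 + (x2 - x1) = x2 by ring.
rewrite add0r => H.
have {H} : circulation A' B x1 0 (x2 - x1) (pi *+ 2) = 0.
  apply: H.
  - lra.
  - lra.
  - move=> x y xI yI; rewrite /A'; case: eqP => [->|_]; last exact: dA.
    have -> : g (x +i* (pi *+ 2)) = g (x +i* 0).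
      by rewrite /g /= /cexp /= /expi cos2pi sin2pi cos0 sin0.
    exact: dA.
  - move=> x y xI yI; have [|a da] := dg x y; first by lra.
    have [d1 d2] := cdiff_differential2 da.
    by exists (complex.Im a), (complex.Re a), (- complex.Im a).
rewrite /circulation /A' add0r eqxx.
have -> : x1 + (x2 - x1) = x2 by ring.
have -> : (0 == pi *+ 2 :> R) = false by rewrite lt_eqF//; lra.
lra.
Qed.

Definition disc_continuous (F : C -> C) :=
  forall z, normc z <= 1 -> forall e : R, 0 < e -> exists2 d : R, 0 < d &
    forall w, normc w <= 1 -> normc (w - z) < d -> normc (F w - F z) <= e.

(** Compactness of the circle makes the radial limits uniform. *)
Lemma near_circle (F : C -> C) : disc_continuous F ->
  forall e : R, 0 < e -> exists2 d : R, 0 < d & forall x y : R,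
    - d < x < 0 -> 0 <= y <= pi *+ 2 -> normc (F (cexp (x +i* y)) - F (expi y)) <= e.
Proof.
move=> cF e e0.
pose P (x : R) (y : R) := x < 0 -> normc (F (cexp (x +i* y)) - F (expi y)) <= e.
have /compact_near_coveringP/(_ R (nbhs (0 : R)) P _) := @segment_compact R 0 (pi *+ 2).
have H : \forall x \near (0 : R), `[0, pi *+ 2] `<=` P x -> True by near=> x.
move=> cov.
have : \forall x \near (0:R), `[0, pi *+ 2] `<=` P x.
  apply: cov => y _.
  have e2 : 0 < e / 2 by rewrite divr_gt0.
  have [|d d0 Hd] := cF (expi y) _ _ e2; first by rewrite normc_expi.
  have d2 : 0 < d / 2 by rewrite divr_gt0.
  have d4 : 0 < d / 4 by rewrite divr_gt0.
  near=> t x.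
  rewrite /P /= => x0.
  have near_t : normc (expi t - expi y) < d / 2.
    apply: (le_lt_trans (normc_le _ _)).
    have c1 : `|cos t - cos y| < d / 4.
      rewrite distrC; near: t; have := @continuous_cos R y.
      by move=> /cvgrPdist_lt; apply.
    have c2 : `|sin t - sin y| < d / 4.
      rewrite distrC; near: t; have := @continuous_sin R y.
      by move=> /cvgrPdist_lt; apply.
    lra.
  have near_x : `|expR x - 1| < d / 2.
    rewrite distrC; near: x; have /cvgrPdist_lt := @continuous_expR R 0.
    by rewrite expR0; apply.
  have E : cexp (x +i* t) - expi y = (expR x - 1)%:C * expi t + (expi t - expi y).
    by rewrite /cexp /= rmorphB /=; ring.
  have N : normc (cexp (x +i* t) - expi y) < d.
    rewrite E; apply: (le_lt_trans (le_normcD _ _)); rewrite normcM normc_expi mulr1.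
    by rewrite [normc _%:C]/= expr0n addr0 sqrtr_sqr; lra.
  have -> : F (cexp (x +i* t)) - F (expi t) =
     (F (cexp (x +i* t)) - F (expi y)) + (F (expi y) - F (expi t)) by ring.
  apply: (le_trans (le_normcD _ _)).
  have h1 : normc (F (cexp (x +i* t)) - F (expi y)) <= e / 2.
    by apply: Hd => //; rewrite normc_cexp /= expR_le1// ltW.
  have h2 : normc (F (expi t) - F (expi y)) <= e / 2.
    by apply: Hd; rewrite ?normc_expi//; lra.
  by rewrite normcB in h2; lra.
move=> /nbhs_ballP[d /= d0 Hd]; exists d => // x y xI yI.
by apply: (Hd x); rewrite /ball /= ?sub0r ?normrN ?in_itv//= ?ltr_norml; lra.
Unshelve. all: by end_near. Qed.

End DiscExtension.

(** * Laurent polynomials that extend to the disc *)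

Section LaurentCoefficient.
Variable R : realType.
Local Notation C := R[i].

(** The means over the circles about 0 are all equal; they tend to F 0 = 0 at the centre
and to the constant term at the boundary. *)
Lemma disc_laurent_constant_re (F : C -> C) (r : int) (n : nat) (c : nat -> C) :
  (forall z, normc z < 1 -> exists a, cdiff F z a) -> disc_continuous F -> F 0 = 0 ->
  (forall t, F (expi t) = \sum_(k < n) expi t ^ (r + k%:Z) * c k) ->
  forall k0 : nat, (k0 < n)%N -> r + k0%:Z = 0 -> complex.Re (c k0) = 0.
Proof.
move=> dF cF F0 FE k0 k0n rk0.
pose j (k : nat) : R := (r + k%:Z)%:~R.
pose b (k : nat) (t : R) : R := if r + k%:Z == 0 then t * complex.Re (c k)
  else (sin (j k * t) * complex.Re (c k) + cos (j k * t) * complex.Im (c k)) / j k.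
pose B0 (t : R) := \sum_(k < n) b k t.
have db (k : nat) (t : R) : is_derive t 1 (b k) (complex.Re (expi t ^ (r + k%:Z) * c k)).
  rewrite /b; case: eqP => [->|/eqP jk].
    rewrite expr0z mul1r; apply: is_derive_eq; rewrite /GRing.scale /=; ring.
  have j0 : j k != 0 by rewrite /j intr_eq0.
  rewrite expiz -/(j k) /expi; move: (j k) j0 => J J0.
  apply: is_derive_eq; rewrite /GRing.scale /=; case: (c k) => p q /=; by field.
have dB0 (t : R) : is_derive t 1 B0 (complex.Re (F (expi t))).
  have -> : B0 = \sum_(k < n) b k by apply/funext => s; rewrite fct_sumE.
  rewrite FE (big_morph (@complex.Re R) (id1 := 0) (op1 := +%R)) //; last by move=> [? ?] [? ?].
  by apply: is_derive_sum => k; exact: db.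
have B0E : B0 (pi *+ 2) - B0 0 = pi *+ 2 * complex.Re (c k0).
  rewrite /B0 -sumrB (bigD1 (Ordinal k0n)) //= big1 ?addr0 => [|k kk0].
    by rewrite /b rk0 eqxx mul0r subr0.
  rewrite /b; case: eqP => [jk|/eqP jk].
    exfalso; move/eqP: kk0; apply; apply/val_inj => /=.
    by apply/eqP; rewrite -eqz_nat -(inj_eq (addrI r)) jk rk0.
  have E2 : expi (j k * (pi *+ 2)) = 1.
    by rewrite /j -expiz /expi cos2pi sin2pi -[_ +i* _]/(1 : C) exp1rz.
  by case: E2 => -> ->; rewrite mulr0 cos0 sin0 subrr.
suff : `|pi *+ 2 * complex.Re (c k0)| <= 0.
  rewrite normr_le0 mulf_eq0 => /orP[|/eqP //].
  by rewrite mulrn_eq0 /= gt_eqF// pi_gt0.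
have pi0 := pi_gt0 R.
apply/ler_addgt0Pr => e0 e00; rewrite add0r; pose e := e0 / 2 / (pi *+ 2).
have e_gt0 : 0 < e by rewrite !divr_gt0// mulrn_wgt0.
have [d d0 Hd] := near_circle cF e_gt0.
have [|d' d'0 Hd'] := cF 0 _ _ e_gt0; first by rewrite normc0.
pose x2 := - (Num.min d 1) / 2 : R; pose x1 := Num.min (x2 - 1) (ln (Num.min d' 1 / 2)).
have mind : Num.min d 1 <= d by rewrite ge_min lexx.
have mind0 : 0 < Num.min d 1 by rewrite lt_min d0 ltr01.
have mind' : Num.min d' 1 <= d' by rewrite ge_min lexx.
have mind'0 : 0 < Num.min d' 1 by rewrite lt_min d'0 ltr01.
have mind'1 : Num.min d' 1 <= 1 by rewrite ge_min lexx orbT.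
have x12 : x1 < x2 by apply: (@le_lt_trans _ _ (x2 - 1)); [rewrite ge_min lexx|lra].
have x20 : x2 < 0 by rewrite /x2; lra.
have x1d : expR x1 <= Num.min d' 1 / 2.
  apply: (@le_trans _ _ (expR (ln (Num.min d' 1 / 2)))); last by rewrite lnK// posrE; lra.
  by rewrite ler_expR ge_min lexx orbT.
have [B [dB BE]] := disc_circle_means dF x12 x20.
have I1 : `|B x1 (pi *+ 2) - B x1 0| <= e * (pi *+ 2 - 0).
  apply: (increment_bound (df := fun y => complex.Re (F (cexp (x1 +i* y))))).
  - lra.
  - by move=> y yI; apply: dB => //; lra.
  - move=> y yI; apply: (le_trans (normRe_le _)).
    have := Hd' (cexp (x1 +i* y)); rewrite F0 !subr0 normc_cexp /=; apply; lra.
have I2 : `|(B x2 (pi *+ 2) - B0 (pi *+ 2)) - (B x2 0 - B0 0)| <= e * (pi *+ 2 - 0).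
  apply: (@increment_bound _ (fun y => B x2 y - B0 y) (fun y => complex.Re (F (cexp (x2 +i* y)) - F (expi y)))).
  - lra.
  - move=> y yI; rewrite ReB; have H1 := dB x2 y; have H2 := dB0 y.
    have x2I : x1 <= x2 <= x2 by lra.
    have {H1} := H1 x2I yI => H1.
    exact: (@is_deriveB _ _ _ (B x2) B0).
  - move=> y yI; apply: (le_trans (normRe_le _)).
    by apply: Hd => //; rewrite /x2; lra.
move: B0E I1 I2; rewrite BE; move: (pi *+ 2 * _) => M ME.
have -> : e * (pi *+ 2 - 0) = e0 / 2 by rewrite /e subr0 divfK// mulrn_eq0 /= gt_eqF.
rewrite !ler_norml; lra.
Qed.

Lemma cdiff_mul (f g : C -> C) (z a b : C) :
  cdiff f z a -> cdiff g z b -> cdiff (fun w => f w * g w) z (a * g z + f z * b).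
Proof.
move=> df dg e e0.
have nf := normc_ge0 (f z); have ng := normc_ge0 (g z); have na := normc_ge0 a.
pose K := normc (f z) + normc (g z) + normc a + 1.
have K0 : 0 < K by rewrite /K; lra.
pose e1 := Num.min 1 (e / K); have e10 : 0 < e1 by rewrite lt_min ltr01 divr_gt0.
have e1K : e1 * K <= e by rewrite -ler_pdivlMr// ge_min lexx orbT.
have e11 : e1 <= 1 by rewrite ge_min lexx.
have [d1 d10 H1] := df _ e10; have [d2 d20 H2] := dg _ e10.
have [d3 d30 H3] := cdiff_continuous dg e10.
exists (Num.min d1 (Num.min d2 d3)); first by rewrite !lt_min d10 d20.
move=> w; rewrite !le_min => /and3P[/H1 h1 /H2 h2 /H3 h3].
have -> : f w * g w - f z * g z - (a * g z + f z * b) * (w - z) =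
  (f w - f z - a * (w - z)) * (g z + (g w - g z)) + f z * (g w - g z - b * (w - z))
  + a * (w - z) * (g w - g z) by ring.
apply: (le_trans (le_normcD _ _)); rewrite !normcM.
have h4 := le_normcD ((f w - f z - a * (w - z)) * (g z + (g w - g z))) (f z * (g w - g z - b * (w - z))).
have h5 := le_normcD (g z) (g w - g z).
move: h4; rewrite !normcM.
have := normc_ge0 (w - z); have := normc_ge0 (f w - f z - a * (w - z)).
have := normc_ge0 (g z + (g w - g z)).
move: h1 h2 h3 h5.
move: (normc (w - z)) => N; move: (normc (f w - f z - _)) => x1; move: (normc (g w - g z - _)) => x2.
move: (normc (g w - g z)) => x3; move: (normc (g z + _)) => x4.
move: (normc (_ + _)) => x5.
move=> h1 h2 h3 h5 x40 x10 N0 h4.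
have y1 : x1 * x4 <= e1 * N * (normc (g z) + 1).
  by apply: ler_pM => //; lra.
have y2 : normc (f z) * x2 <= normc (f z) * (e1 * N) by apply: ler_wpM2l.
have y3 : normc a * N * x3 <= normc a * N * e1 by apply: ler_wpM2l => //; exact: mulr_ge0.
have : e1 * K * N <= e * N by apply: ler_wpM2r.
rewrite /K; lra.
Qed.

Lemma ReZi (z : C) : complex.Re (- 'i%C * z) = complex.Im z.
Proof. by case: z => x y /=; ring. Qed.

(** The imaginary part of the constant term is the real part of that of -i F. *)
Lemma disc_laurent_constant (F : C -> C) (r : int) (n : nat) (c : nat -> C) :
  (forall z, normc z < 1 -> exists a, cdiff F z a) -> disc_continuous F -> F 0 = 0 ->
  (forall t, F (expi t) = \sum_(k < n) expi t ^ (r + k%:Z) * c k) ->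
  forall k0 : nat, (k0 < n)%N -> r + k0%:Z = 0 -> c k0 = 0.
Proof.
move=> dF cF F0 FE k0 k0n rk0.
have Re0 := disc_laurent_constant_re dF cF F0 FE k0n rk0.
have ni : normc (- 'i%C : C) = 1 by rewrite normcN /= expr0n add0r expr1n sqrtr1.
have : complex.Re (- 'i%C * c k0) = 0.
  apply: (@disc_laurent_constant_re (fun z => - 'i%C * F z) r n (fun k => - 'i%C * c k)) => //.
  - move=> z /dF[a da]; exists (- 'i%C * a) => e e0; have [d d0 Hd] := da _ e0.
    exists d => // w /Hd; rewrite -mulrA -!mulrBr normcM ni mul1r; exact.
  - move=> z z1 e e0; have [d d0 Hd] := cF _ z1 _ e0.
    by exists d => // w w1 /(Hd _ w1); rewrite -mulrBr normcM ni mul1r.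
  - by rewrite F0 mulr0.
  - by move=> t; rewrite FE mulr_sumr; apply: eq_bigr => k _; rewrite mulrCA.
by rewrite ReZi => Im0; apply/eqP; rewrite eq_complex Re0 Im0 eqxx.
Qed.

Lemma normcX (z : C) (m : nat) : normc (z ^+ m) = normc z ^+ m.
Proof. by elim: m => [|m IH]; rewrite ?normc1// !exprS normcM IH. Qed.

(** The coefficient of z ^ (-m) is the constant term of z ^ m H z, which vanishes at 0. *)
Theorem disc_laurent_nonneg (H : C -> C) (r : int) (n : nat) (c : nat -> C) :
  (forall z, normc z < 1 -> exists a, cdiff H z a) -> disc_continuous H ->
  (forall t, H (expi t) = \sum_(k < n) expi t ^ (r + k%:Z) * c k) ->
  forall k0 : nat, (k0 < n)%N -> r + k0%:Z < 0 -> c k0 = 0.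
Proof.
move=> dH cH HE k0 k0n rk0.
have [m mE] : exists m : nat, r + k0%:Z = - (m.+1)%:Z.
  by exists (absz (r + k0%:Z)).-1; lia.
have dX (z : C) : exists a, cdiff (fun w => w ^+ m.+1) z a.
  by apply/(@derivable_cdiff _ (fun w : C^o => (w ^+ m.+1 : C^o))); exact: exprn_derivable.
apply: (@disc_laurent_constant (fun w => H w * w ^+ m.+1) (r + m.+1%:Z) n c) => //.
- move=> z /dH[a da]; have [b db] := dX z.
  by exists (a * z ^+ m.+1 + H z * b); exact: cdiff_mul.
- move=> z z1 e e0; have nH := normc_ge0 (H z).
  have e2 : 0 < e / 2 by rewrite divr_gt0.
  have [d1 d10 H1] := cH _ z1 _ e2.
  have [a /cdiff_continuous da] := dX z.
  have e3 : 0 < e / (2 * (normc (H z) + 1)) by rewrite divr_gt0// mulr_gt0// ltr_wpDl.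
  have [d2 d20 H2] := da _ e3.
  exists (Num.min d1 d2); first by rewrite lt_min d10.
  move=> w w1; rewrite lt_min => /andP[/(H1 _ w1) h1 /ltW/H2 h2].
  have -> : H w * w ^+ m.+1 - H z * z ^+ m.+1 =
     (H w - H z) * w ^+ m.+1 + H z * (w ^+ m.+1 - z ^+ m.+1) by ring.
  apply: (le_trans (le_normcD _ _)); rewrite !normcM normcX.
  have -> : e = e / 2 + e / 2 by field.
  apply: lerD.
    rewrite -[leRHS]mulr1; apply: ler_pM; rewrite ?normc_ge0 ?exprn_ge0 ?normc_ge0//.
    by rewrite exprn_ile1 ?normc_ge0.
  apply: (le_trans (ler_wpM2l nH h2)); rewrite mulrA ler_pdivrMr; last by lra.
  nra.
- by rewrite expr0n mulr0.
- move=> t; rewrite HE mulr_suml; apply: eq_bigr => k _.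
  rewrite mulrAC exprnP -expfzDr ?expi_neq0//; congr (_ ^ _ * _); lia.
- by lia.
Qed.

End LaurentCoefficient.

(** * Complex matrices and the isotropic frame *)

Section ComplexMatrices.
Variable R : realType.
Local Notation C := R[i].

Lemma mxC_inj m n : injective (@mxC R m n).
Proof. by move=> A B /matrixP AB; apply/matrixP => i j; have := AB i j; rewrite !mxE => -[]. Qed.

Lemma mxCM m n p (A : 'M[R]_(m, n)) (B : 'M[R]_(n, p)) : mxC (A *m B) = mxC A *m mxC B.
Proof. exact: map_mxM. Qed.

Lemma mxCD m n (A B : 'M[R]_(m, n)) : mxC (A + B) = mxC A + mxC B.
Proof. exact: map_mxD. Qed.

Lemma mxCB m n (A B : 'M[R]_(m, n)) : mxC (A - B) = mxC A - mxC B.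
Proof. exact: map_mxB. Qed.

Lemma mxCN m n (A : 'M[R]_(m, n)) : mxC (- A) = - mxC A.
Proof. exact: map_mxN. Qed.

Lemma mxC0 m n : mxC (0 : 'M[R]_(m, n)) = 0.
Proof. exact: map_mx0. Qed.

Lemma mxC1 n : mxC (1%:M : 'M[R]_n) = 1%:M.
Proof. exact: map_mx1. Qed.

Lemma mxCZ m n (a : R) (A : 'M[R]_(m, n)) : mxC (a *: A) = a%:C *: mxC A.
Proof. exact: map_mxZ. Qed.

Lemma mxC_tr m n (A : 'M[R]_(m, n)) : mxC A^T = (mxC A)^T.
Proof. by rewrite /mxC map_trmx. Qed.

Lemma mxC_invmx n (A : 'M[R]_n) : mxC (invmx A) = invmx (mxC A).
Proof. exact: map_invmx. Qed.

Lemma mxconjM m n p (A : 'M[C]_(m, n)) (B : 'M[C]_(n, p)) :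
  mxconj (A *m B) = mxconj A *m mxconj B.
Proof. exact: map_mxM. Qed.

Lemma mxconjD m n (A B : 'M[C]_(m, n)) : mxconj (A + B) = mxconj A + mxconj B.
Proof. exact: map_mxD. Qed.

Lemma mxconjB m n (A B : 'M[C]_(m, n)) : mxconj (A - B) = mxconj A - mxconj B.
Proof. exact: map_mxB. Qed.

Lemma mxconj0 m n : mxconj (0 : 'M[C]_(m, n)) = 0.
Proof. exact: map_mx0. Qed.

Lemma mxconj1 n : mxconj (1%:M : 'M[C]_n) = 1%:M.
Proof. exact: map_mx1. Qed.

Lemma mxconjZ m n (a : C) (A : 'M[C]_(m, n)) : mxconj (a *: A) = conjc a *: mxconj A.
Proof. exact: map_mxZ. Qed.

Lemma mxconj_tr m n (A : 'M[C]_(m, n)) : mxconj A^T = (mxconj A)^T.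
Proof. by rewrite /mxconj map_trmx. Qed.

Lemma mxconjK m n : involutive (@mxconj R m n).
Proof. by move=> A; apply/matrixP => i j; rewrite !mxE conjcK. Qed.

Lemma mxconjC m n (A : 'M[R]_(m, n)) : mxconj (mxC A) = mxC A.
Proof. by apply/matrixP => i j; rewrite !mxE conjc_real. Qed.

Lemma trmxZ (F : pzRingType) m n (a : F) (A : 'M[F]_(m, n)) : (a *: A)^T = a *: A^T.
Proof. by apply/matrixP => i j; rewrite !mxE. Qed.

Lemma trmxD (F : zmodType) m n (A B : 'M[F]_(m, n)) : (A + B)^T = A^T + B^T.
Proof. by apply/matrixP => i j; rewrite !mxE. Qed.

Lemma trmxB (F : zmodType) m n (A B : 'M[F]_(m, n)) : (A - B)^T = A^T - B^T.
Proof. by apply/matrixP => i j; rewrite !mxE. Qed.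

Lemma mxRe_C m n (A : 'M[R]_(m, n)) : mxRe (mxC A) = A.
Proof. by apply/matrixP => i j; rewrite !mxE. Qed.

Lemma mxC_Re m n (A : 'M[C]_(m, n)) : mxconj A = A -> mxC (mxRe A) = A.
Proof.
move=> /matrixP H; apply/matrixP => i j; have := H i j; rewrite !mxE.
by case: (A i j) => x y [] /eqP; rewrite eqNr => /eqP->.
Qed.

Lemma mxReIm m n (A : 'M[C]_(m, n)) : A = mxC (mxRe A) + 'i%C *: mxC (mxIm A).
Proof. by apply/matrixP => i j; rewrite !mxE [LHS]complexE. Qed.

Lemma mxReM_real m n p (A : 'M[R]_(m, n)) (B : 'M[C]_(n, p)) :
  mxRe (mxC A *m B) = A *m mxRe B.
Proof.
apply/matrixP => i j; rewrite !mxE.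
rewrite (big_morph (@complex.Re R) (id1 := 0) (op1 := +%R)) //; last by move=> [? ?] [? ?].
apply: eq_bigr => k _; rewrite !mxE; case: (B k j) => x y /=; ring.
Qed.

Lemma mxIm_real m n p (A : 'M[R]_(m, n)) (B : 'M[C]_(n, p)) :
  mxIm (mxC A *m B) = A *m mxIm B.
Proof.
apply/matrixP => i j; rewrite !mxE.
rewrite (big_morph (@complex.Im R) (id1 := 0) (op1 := +%R)) //; last by move=> [? ?] [? ?].
apply: eq_bigr => k _; rewrite !mxE; case: (B k j) => x y /=; ring.
Qed.

End ComplexMatrices.

(** The real operator that sends u_i to a u_j, its conjugate to the conjugate of a u_j, and
the other vectors of the frame to 0. It is locked to keep unification from unfolding
the matrix products. *)
HB.lock Definition unit_op {R : realType} (u : 'I_3 -> 'cV[R[i]]_6) (i j : 'I_3) (a : R[i]) :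
    'M[R]_6 :=
  mxRe (a *: (u j *m (mxconj (u i))^T) + conjc a *: (mxconj (u j) *m (u i)^T)).

Section Frame.
Variable R : realType.
Local Notation C := R[i].
Variable u : 'I_3 -> 'cV[C]_6.
Hypothesis hu : isotropic_frame u.

Local Notation cj := (@mxconj R 6 1).

Lemma frame_uu i j : (u i)^T *m u j = 0.
Proof. by have [] := hu. Qed.

Lemma frame_uc i j : (u i)^T *m cj (u j) = (i == j)%:R%:M.
Proof. by have [] := hu. Qed.

Lemma frame_cu i j : (cj (u i))^T *m u j = (i == j)%:R%:M.
Proof.
by have := congr1 trmx (frame_uc j i); rewrite trmx_mul trmxK tr_scalar_mx eq_sym.
Qed.

Lemma frame_cc i j : (cj (u i))^T *m cj (u j) = 0.
Proof. by rewrite -mxconj_tr -mxconjM frame_uu mxconj0. Qed.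

Lemma frame_complete :
  \sum_i (u i *m (cj (u i))^T + cj (u i) *m (u i)^T) = 1%:M.
Proof.
pose U := \matrix_(i < 6, j < 3) u j i 0.
pose F : 'M[C]_6 := row_mx U (mxconj U).
pose G : 'M[C]_6 := col_mx (mxconj U)^T U^T.
have colU j : col j U = u j by apply/matrixP => a b; rewrite !mxE ord1.
have colUc j : col j (mxconj U) = cj (u j) by apply/matrixP => a b; rewrite !mxE ord1.
have UU (A B : 'M[C]_(6, 3)) i j : (A^T *m B) i j = ((col i A)^T *m col j B) 0 0.
  by rewrite !mxE; apply: eq_bigr => k _; rewrite !mxE.
have GF : G *m F = 1%:M.
  rewrite /G /F (@mul_col_row _ 3 3 6 3 3).
  apply: etrans (esym (@scalar_mx_block C 3 3 1)).
  congr block_mx;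
  by apply/matrixP => i j; rewrite UU ?colU ?colUc ?frame_cu ?frame_cc ?frame_uu ?frame_uc !mxE ?eqxx ?mulr1n.
have := mulmx1C GF; rewrite /F /G (@mul_row_col _ 6 3 3 6) => <-.
rewrite big_split /=; congr (_ + _); apply/matrixP => a b; rewrite summxE !mxE.
  by apply: eq_bigr => k _; rewrite !mxE big_ord1 !mxE.
by apply: eq_bigr => k _; rewrite !mxE big_ord1 !mxE.
Qed.

Lemma frame_ext m (A B : 'M[C]_(m, 6)) :
  (forall i, A *m u i = B *m u i) -> (forall i, A *m cj (u i) = B *m cj (u i)) -> A = B.
Proof.
move=> Hu Hc; rewrite -[A]mulmx1 -[B]mulmx1 -frame_complete !mulmx_sumr.
by apply: eq_bigr => i _; rewrite !mulmxDr !mulmxA Hu Hc.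
Qed.

(** A real operator commutes with conjugation, so its values on the u_i give those on
their conjugates. *)
Lemma frame_extR m (A B : 'M[R]_(m, 6)) :
  (forall i, mxC A *m u i = mxC B *m u i) -> A = B.
Proof.
move=> H; apply: mxC_inj; apply: frame_ext => // i.
by have := congr1 (@mxconj R _ _) (H i); rewrite !mxconjM !mxconjC.
Qed.

Lemma mxC_unit_op i j a :
  mxC (unit_op u i j a) = a *: (u j *m (cj (u i))^T) + conjc a *: (cj (u j) *m (u i)^T).
Proof.
rewrite unit_op.unlock mxC_Re// mxconjD !mxconjZ !mxconjM !mxconj_tr !mxconjK conjcK.
by rewrite addrC.
Qed.

Lemma unit_opE i j a l : mxC (unit_op u i j a) *m u l = (a * (i == l)%:R) *: u j.
Proof.
rewrite mxC_unit_op mulmxDl -!scalemxAl -!mulmxA frame_cu frame_uu mulmx0 scaler0 addr0.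
by rewrite mul_mx_scalar scalerA.
Qed.

Lemma unit_op_tr i j a : (unit_op u i j a)^T = unit_op u j i (conjc a).
Proof.
apply: mxC_inj; rewrite mxC_tr !mxC_unit_op trmxD !trmxZ !trmx_mul !trmxK conjcK.
by rewrite addrC.
Qed.

Lemma E_unit_op i : E u i = unit_op u i i 'i%C.
Proof.
rewrite /E unit_op.unlock scalerBr; congr (mxRe (_ + _)).
by rewrite -scaleNr; congr (_ *: _); apply/eqP; rewrite eq_complex /= oppr0 !eqxx.
Qed.

End Frame.

(** * Subspaces as images of idempotents *)

Section Colspace.
Variable F : fieldType.
Implicit Types (U V : {vspace 'cV[F]_6}) (P Q M g : 'M[F]_6) (v w : 'cV[F]_6).

(** Subspaces are handled as images of idempotent matrices, for which sums,
intersections, complements and conjugation become identities between matrices. *)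
Definition colspace M : {vspace 'cV[F]_6} := act M fullv.

Lemma memv_act g U v : reflect (exists2 w, w \in U & v = g *m w) (v \in act g U).
Proof.
apply: (iffP memv_imgP) => -[w wU ->]; exists w => //; by rewrite lfunE.
Qed.

Lemma memv_colspace M v : reflect (exists w, v = M *m w) (v \in colspace M).
Proof.
apply: (iffP (memv_act _ _ _)) => [[w _ ->]|[w ->]]; first by exists w.
by exists w => //; rewrite memvf.
Qed.

Lemma mem_colspace_idem P v : P *m P = P -> (v \in colspace P) = (P *m v == v).
Proof.
move=> PP; apply/memv_colspace/eqP => [[w ->]|<-]; first by rewrite mulmxA PP.
by exists v.
Qed.

Lemma colspace_mul M N : (colspace (M *m N) <= colspace M)%VS.
Proof.
by apply/subvP => v /memv_colspace[w ->]; apply/memv_colspace; exists (N *m w); rewrite mulmxA.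
Qed.

Lemma act_colspace g M : act g (colspace M) = colspace (g *m M).
Proof.
apply/vspaceP => v; apply/memv_act/memv_colspace => [[_ /memv_colspace[w ->] ->]|[w ->]].
  by exists w; rewrite mulmxA.
by exists (M *m w); [apply/memv_colspace; exists w|rewrite mulmxA].
Qed.

Lemma act_mul g h U : act g (act h U) = act (g *m h) U.
Proof.
apply/vspaceP => v; apply/memv_act/memv_act => [[_ /memv_act[w wU ->] ->]|[w wU ->]].
  by exists w => //; rewrite mulmxA.
by exists (h *m w); [apply/memv_act; exists w|rewrite mulmxA].
Qed.

Lemma act1 U : act 1%:M U = U.
Proof.
apply/vspaceP => v; apply/memv_act/idP => [[w wU ->]|vU]; first by rewrite mul1mx.
by exists v => //; rewrite mul1mx.
Qed.

Lemma colspace_mulr M N : N \in unitmx -> colspace (M *m N) = colspace M.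
Proof.
move=> Nu; apply/eqP; rewrite eqEsubv colspace_mul /=.
by rewrite -{1}(mulmxK Nu M) colspace_mul.
Qed.

Lemma colspaceD P Q : P *m P = P -> Q *m Q = Q -> P *m Q = 0 -> Q *m P = 0 ->
  (colspace P + colspace Q)%VS = colspace (P + Q).
Proof.
move=> PP QQ PQ QP; apply/vspaceP => v; apply/memv_addP/memv_colspace.
  move=> [_ /memv_colspace[a ->] [_ /memv_colspace[b ->] ->]].
  exists (P *m a + Q *m b); rewrite mulmxDr !mulmxDl !mulmxA PP QQ PQ QP.
  by rewrite !mul0mx addr0 add0r.
move=> [w ->]; exists (P *m w); first by apply/memv_colspace; exists w.
by exists (Q *m w); [apply/memv_colspace; exists w|rewrite mulmxDl].
Qed.

Lemma colspaceI P Q : P *m P = P -> Q *m Q = Q -> P *m Q = Q *m P ->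
  (colspace P :&: colspace Q)%VS = colspace (P *m Q).
Proof.
move=> PP QQ PQ; apply/vspaceP => v; rewrite memv_cap !mem_colspace_idem//; last first.
  by rewrite mulmxA -(mulmxA P Q P) -PQ mulmxA PP -mulmxA QQ.
apply/andP/eqP => [[/eqP Pv /eqP Qv]|PQv]; first by rewrite -mulmxA Qv.
by rewrite -PQv !mulmxA PP -(mulmxA Q P Q) PQ mulmxA QQ -PQ !eqxx.
Qed.

Lemma colspace0I P Q : P *m P = P -> Q *m Q = Q -> P *m Q = 0 ->
  (colspace P :&: colspace Q)%VS = 0%VS.
Proof.
move=> PP QQ PQ; apply/eqP; rewrite -subv0; apply/subvP => v; rewrite memv_cap memv0.
rewrite !mem_colspace_idem// => /andP[/eqP Pv /eqP Qv].
by rewrite -Pv -Qv mulmxA PQ mul0mx.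
Qed.

Lemma memv_bigcap_seq (I : Type) (s : seq I) (K : I -> {vspace 'cV[F]_6}) v :
  (v \in (\bigcap_(i <- s) K i)%VS) = all (fun i => v \in K i) s.
Proof.
elim: s => [|i s IH]; first by rewrite big_nil memvf.
by rewrite big_cons memv_cap IH.
Qed.

Lemma memv_annih U v : reflect (forall w, w \in U -> w^T *m v = 0) (v \in annih U).
Proof.
rewrite /annih memv_bigcap_seq; apply: (iffP allP) => [H w wU|H w wU].
  rewrite (coord_vbasis wU) -[_^T]/(trmx _) raddf_sum /= mulmx_suml big1// => i _.
  rewrite linearZ /= -scalemxAl.
  have := H (vbasis U)`_i; rewrite mem_nth ?size_tuple// => /(_ isT).
  by rewrite memv_ker lfunE /= => /eqP->; rewrite scaler0.
by rewrite memv_ker lfunE /= H// vbasis_mem.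
Qed.

Lemma annih_colspace P : P *m P = P -> annih (colspace P) = colspace (1%:M - P^T).
Proof.
move=> PP; have PT : P^T *m P^T = P^T by rewrite -trmx_mul PP.
apply/vspaceP => v; rewrite [RHS]mem_colspace_idem; last first.
  by rewrite mulmxBl !mulmxBr !mul1mx mulmx1 PT subrr subr0.
have -> : ((1%:M - P^T) *m v == v) = (P^T *m v == 0).
  by rewrite mulmxBl mul1mx -subr_eq0 addrAC subrr add0r oppr_eq0.
apply/memv_annih/eqP.
  move=> H; apply/matrixP => i j; rewrite ord1.
  have := H (P *m delta_mx i 0); rewrite trmx_mul trmx_delta -mulmxA.
  have -> : P *m delta_mx i 0 \in colspace P by apply/memv_colspace; exists (delta_mx i 0).
  by move=> /(_ isT)/matrixP/(_ 0 0); rewrite -rowE !mxE => ->.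
by move=> Pv _ /memv_colspace[w ->]; rewrite trmx_mul -mulmxA Pv mulmx0.
Qed.

Lemma act_annih g U : g^T *m g = 1%:M -> act g (annih U) = annih (act g U).
Proof.
move=> gg; have gg' := mulmx1C gg.
apply/vspaceP => v; apply/memv_act/memv_annih.
  move=> [w /memv_annih wU ->] _ /memv_act[x xU ->].
  by rewrite trmx_mul -mulmxA (mulmxA g^T) gg mul1mx wU.
move=> H; exists (g^T *m v); last by rewrite mulmxA gg' mul1mx.
apply/memv_annih => w wU; have := H (g *m w); rewrite trmx_mul -mulmxA; apply.
by apply/memv_act; exists w.
Qed.

Lemma directv3 (A B D : {vspace 'cV[F]_6}) : (A :&: B = 0)%VS -> ((A + B) :&: D = 0)%VS ->
  directv (A + B + D).
Proof.
move=> AB ABD; rewrite directv_addE /= directv_addE /= !directv_trivial /=.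
by rewrite AB ABD eqxx.
Qed.

End Colspace.

Section RealSubspaces.
Variable R : realType.
Implicit Types (U : {vspace 'cV[R]_6}) (P : 'M[R]_6).

Lemma real_norm_eq0 n (v : 'cV[R]_n) : v^T *m v = 0 -> v = 0.
Proof.
move=> /matrixP/(_ 0 0); rewrite !mxE => /eqP.
rewrite psumr_eq0 => [|i _]; last by rewrite mxE -expr2 sqr_ge0.
move=> /allP H; apply/matrixP => i j; rewrite ord1 mxE; apply/eqP.
by have := H i (mem_index_enum _); rewrite mxE mulf_eq0 orbb.
Qed.

Lemma cap_annih U : (U :&: annih U = 0)%VS.
Proof.
apply/eqP; rewrite -subv0; apply/subvP => v; rewrite memv_cap memv0.
by move=> /andP[vU /memv_annih/(_ _ vU)/real_norm_eq0 ->].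
Qed.

Lemma oprojE U (v : 'cV[R]_6) : oproj U *m v = daddv_pi U (annih U) v.
Proof.
have E : v = \sum_j v j 0 *: delta_mx j 0.
  apply/matrixP => i k; rewrite ord1 summxE (bigD1 i)//= big1 => [|j ji].
    by rewrite !mxE eqxx mulr1 addr0.
  by rewrite !mxE eq_sym (negPf ji) mulr0.
rewrite {2}E linear_sum /=; apply/matrixP => i k; rewrite ord1 !mxE summxE.
by apply: eq_bigr => j _; rewrite linearZ !mxE mulrC.
Qed.

Lemma daddv_pi0 (U V : {vspace 'cV[R]_6}) v : (U :&: V = 0)%VS -> v \in V -> daddv_pi U V v = 0.
Proof.
move=> UV vV; have VU : (V :&: U = 0)%VS by rewrite capvC.
have := daddv_pi_add UV (subvP (addvSr U V) _ vV).
rewrite (daddv_pi_id VU vV) => /eqP; by rewrite -[X in _ == X]add0r (inj_eq (addIr _)) => /eqP.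
Qed.

Lemma oproj_colspace P : P^T = P -> P *m P = P -> oproj (colspace P) = P.
Proof.
move=> PT PP; apply/matrixP => i j.
have -> : oproj (colspace P) i j = (oproj (colspace P) *m delta_mx j (0 : 'I_1)) i 0.
  by rewrite -colE [RHS]mxE.
rewrite oprojE.
have -> : P i j = (P *m delta_mx j (0 : 'I_1)) i 0 by rewrite -colE [RHS]mxE.
congr (fun_of_matrix _ i 0).
have E : delta_mx j (0 : 'I_1) = P *m delta_mx j 0 + (1%:M - P) *m delta_mx j 0 :> 'cV[R]_6.
  by rewrite -mulmxDl addrC subrK mul1mx.
have cap := cap_annih (colspace P).
rewrite {1}E linearD /= daddv_pi_id//; last by apply/memv_colspace; exists (delta_mx j 0).
have m2 : (1%:M - P) *m delta_mx j 0 \in annih (colspace P).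
  by rewrite annih_colspace// PT; apply/memv_colspace; exists (delta_mx j 0).
by rewrite (daddv_pi0 cap m2) addr0.
Qed.

Lemma dim_act (F : fieldType) (g h : 'M[F]_6) (U : {vspace 'cV[F]_6}) :
  h *m g = 1%:M -> \dim (act g U) = \dim U.
Proof.
move=> hg; apply: limg_dim_eq; apply/eqP; rewrite -subv0; apply/subvP => v.
rewrite memv_cap memv0 memv_ker lfunE /= => /andP[_ /eqP gv].
by rewrite -[v]mul1mx -hg -mulmxA gv mulmx0.
Qed.

Lemma span_vbasis_map (F G : fieldType) (W : {vspace 'cV[G]_6}) (U : {vspace 'cV[F]_6})
  (f : 'cV[F]_6 -> 'cV[G]_6) :
  (forall v, v \in U -> f v \in W) -> (<<[seq f v | v <- vbasis U]>> <= W)%VS.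
Proof.
by move=> H; apply/span_subvP => _ /mapP[v vU ->]; apply/H/vbasis_mem.
Qed.

Lemma cplx_colspace P : cplx (colspace P) = colspace (mxC P).
Proof.
apply/eqP; rewrite eqEsubv; apply/andP; split.
  apply: span_vbasis_map => _ /memv_colspace[w ->]; rewrite mxCM.
  by apply/memv_colspace; exists (mxC w).
have H (w : 'cV[R]_6) : w \in colspace P -> mxC w \in cplx (colspace P).
  move=> /coord_vbasis ->; rewrite (big_morph _ (@mxCD _ _ _) (@mxC0 _ _ _)).
  apply: memv_suml => i _; rewrite mxCZ; apply/memvZ/memv_span/map_f/mem_nth.
  by rewrite size_tuple.
apply/subvP => _ /memv_colspace[w ->]; rewrite [w]mxReIm mulmxDr -scalemxAr -!mxCM.
by apply: memvD; [|apply: memvZ]; apply: H; apply/memv_colspace; eexists.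
Qed.

Lemma conjv_colspace (M : 'M[R[i]]_6) : conjv (colspace M) = colspace (mxconj M).
Proof.
apply/eqP; rewrite eqEsubv; apply/andP; split.
  apply: span_vbasis_map => _ /memv_colspace[w ->]; rewrite mxconjM.
  by apply/memv_colspace; exists (mxconj w).
apply/subvP => _ /memv_colspace[w ->].
have -> : mxconj M *m w = mxconj (M *m mxconj w) by rewrite mxconjM mxconjK.
have : M *m mxconj w \in colspace M by apply/memv_colspace; exists (mxconj w).
move=> /coord_vbasis ->; rewrite (big_morph _ (@mxconjD _ _ _) (@mxconj0 _ _ _)).
apply: memv_suml => i _; rewrite mxconjZ; apply/memvZ/memv_span/map_f/mem_nth.
by rewrite size_tuple.
Qed.

Lemma hperp_colspace (P : 'M[R[i]]_6) : P^T = mxconj P -> P *m P = P ->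
  hperp (colspace P) = colspace (1%:M - P).
Proof.
move=> PT PP; rewrite /hperp conjv_colspace annih_colspace -?mxconjM ?PP//.
by rewrite -PT trmxK.
Qed.

Lemma real_points_colspace P : P *m P = P -> real_points (colspace (mxC P)) = colspace P.
Proof.
move=> PP; have PPC : mxC P *m mxC P = mxC P by rewrite -mxCM PP.
apply/eqP; rewrite eqEsubv; apply/andP; split.
  apply/span_subvP => v; rewrite mem_cat => /orP[] /mapP[w /vbasis_mem wU ->];
  move: wU; rewrite mem_colspace_idem// => /eqP<-; rewrite (mxReM_real, mxIm_real);
  by apply/memv_colspace; eexists.
apply/subvP => v; rewrite mem_colspace_idem// => /eqP Pv.
have : mxC v \in colspace (mxC P) by rewrite mem_colspace_idem// -mxCM Pv.
move=> /coord_vbasis vE.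
have -> : v = mxRe (mxC v) by rewrite mxRe_C.
rewrite vE.
have ReD : {morph @mxRe R 6 1 : x y / x + y >-> x + y}.
  by move=> x y; apply/matrixP => i j; rewrite !mxE; case: (x i j) => ? ?; case: (y i j).
have Re0 : @mxRe R 6 1 0 = 0 by apply/matrixP => i j; rewrite !mxE.
rewrite (big_morph _ ReD Re0); apply: memv_suml => i _.
set b := (vbasis _)`_i; set a := coord _ _ _.
have bin : b \in vbasis (colspace (mxC P)) by apply: mem_nth; rewrite size_tuple.
have -> : mxRe (a *: b) = complex.Re a *: mxRe b - complex.Im a *: mxIm b.
  apply/matrixP => k l; rewrite !mxE; case: a => x y; case: (b k l) => s t //=.
apply: memvB; apply/memvZ/memv_span; rewrite mem_cat; apply/orP; [left|right]; exact: map_f.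
Qed.

End RealSubspaces.

(** * The maximal torus *)

(** The elements of the maximal torus and of its Lie algebra: the conjugate of u_j is an
eigenvector for the conjugate of d j. Locked for the same reason as [unit_op]. *)
HB.lock Definition tdiag {R : realType} (u : 'I_3 -> 'cV[R[i]]_6) (d : 'I_3 -> R[i]) :
    'M[R]_6 := \sum_j unit_op u j j (d j).

Section Torus.
Variable R : realType.
Local Notation C := R[i].
Variable u : 'I_3 -> 'cV[C]_6.
Hypothesis hu : isotropic_frame u.

Lemma tdiag_sum d : tdiag u d = \sum_j unit_op u j j (d j).
Proof. by rewrite tdiag.unlock. Qed.

Lemma tdiagE d i : mxC (tdiag u d) *m u i = d i *: u i.
Proof.
rewrite tdiag_sum (big_morph _ (@mxCD _ _ _) (@mxC0 _ _ _)) mulmx_suml.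
rewrite (bigD1 i) // big1 => [|j ji]; last by rewrite (unit_opE hu) (negPf ji) mulr0 scale0r.
by rewrite [LHS]addr0 (unit_opE hu) eqxx mulr1.
Qed.

Lemma tdiag_eq d d' : d =1 d' -> tdiag u d = tdiag u d'.
Proof. by move=> /funext ->. Qed.

Lemma tdiagM d d' : tdiag u d *m tdiag u d' = tdiag u (fun i => d i * d' i).
Proof.
apply: (frame_extR hu) => i; rewrite mxCM -mulmxA !tdiagE -scalemxAr tdiagE scalerA.
by rewrite mulrC.
Qed.

Lemma tdiagD d d' : tdiag u d + tdiag u d' = tdiag u (fun i => d i + d' i).
Proof.
by apply: (frame_extR hu) => i; rewrite mxCD mulmxDl !tdiagE scalerDl.
Qed.

Lemma tdiagZ a d : a *: tdiag u d = tdiag u (fun i => a%:C * d i).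
Proof.
by apply: (frame_extR hu) => i; rewrite mxCZ -scalemxAl !tdiagE scalerA.
Qed.

Lemma tdiag1 : tdiag u (fun => 1) = 1%:M.
Proof. by apply: (frame_extR hu) => i; rewrite tdiagE mxC1 mul1mx scale1r. Qed.

Lemma tdiag0 : tdiag u (fun => 0) = 0.
Proof. by apply: (frame_extR hu) => i; rewrite tdiagE mxC0 mul0mx scale0r. Qed.

Lemma tdiag_tr d : (tdiag u d)^T = tdiag u (fun i => conjc (d i)).
Proof.
rewrite !tdiag_sum [LHS](big_morph _ (@trmxD _ _ _) (@trmx0 _ _ _)).
by apply: eq_bigr => i _; rewrite (unit_op_tr u).
Qed.

Lemma tdiagX d n : tdiag u d ^+ n = tdiag u (fun i => d i ^+ n).
Proof.
elim: n => [|n IH]; first by rewrite expr0 -[LHS]tdiag1; apply: tdiag_eq => i; rewrite expr0.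
by rewrite exprS IH -mulmxE tdiagM; apply: tdiag_eq => i; rewrite exprS.
Qed.

Lemma unit_opD i j a b : unit_op u i j (a + b) = unit_op u i j a + unit_op u i j b.
Proof.
by apply: (frame_extR hu) => l; rewrite mxCD mulmxDl !(unit_opE hu) mulrDl scalerDl.
Qed.

Lemma unit_opZ i j (x : R) a : unit_op u i j (x%:C * a) = x *: unit_op u i j a.
Proof.
by apply: (frame_extR hu) => l; rewrite mxCZ -scalemxAl !(unit_opE hu) scalerA mulrA.
Qed.

Lemma unit_opRI i j a :
  unit_op u i j a = complex.Re a *: unit_op u i j 1 + complex.Im a *: unit_op u i j 'i%C.
Proof. by rewrite -!unit_opZ -unit_opD mulr1 mulrC {1}[a]complexE mulrC. Qed.

Lemma exp_partial_sum (t : R) (n : nat) :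
  \sum_(k < n) ((k`!%:R)^-1)%:C * (t *i) ^+ k =
  series (cos_coeff t) n +i* series (sin_coeff t) n.
Proof.
elim: n => [|n IH]; first by rewrite big_ord0 /series /= !big_nat !big_pred0.
rewrite big_ord_recr /= IH /series /= !big_nat_recr//=.
have ti : t *i = t%:C * 'i%C by apply/eqP; rewrite eq_complex /=; apply/andP; split; apply/eqP; ring.
have E k : (t *i) ^+ k = ((~~ odd k)%:R * (-1) ^+ k./2 * t ^+ k) +i* ((odd k)%:R * (-1) ^+ k.-1./2 * t ^+ k).
  elim: k => [|k IHk]; first by rewrite !expr0 /= !mul0r !mul1r.
  rewrite exprS IHk /= uphalf_half exprS; case: (boolP (odd k)) => ok /=.
    have -> : k./2 = k.-1./2.
      by case: k ok {IHk} => // k /= ok; rewrite uphalf_half (negPf ok).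
    apply/eqP; rewrite eq_complex /= ; apply/andP; split; apply/eqP; rewrite ?add1n ?exprS; ring.
  apply/eqP; rewrite eq_complex /= ; apply/andP; split; apply/eqP; rewrite ?add0n; ring.
rewrite E; apply/eqP; rewrite eq_complex /= /cos_coeff /sin_coeff /=.
rewrite -(exprnP _ n./2).
by apply/andP; split; apply/eqP; ring.
Qed.

(** The exponential series of a diagonal element is diagonal, with the series of cosine
and sine as real and imaginary parts. *)
Lemma mexp_tdiag (t : 'I_3 -> R) : mexp (tdiag u (fun j => (t j) *i)) = tdiag u (fun j => expi (t j)).
Proof.
rewrite /mexp.
have E : (fun n => \sum_(k < n) (k`!%:R)^-1 *: tdiag u (fun j => (t j) *i) ^+ k) =
  (fun n => \sum_j (series (cos_coeff (t j)) n *: unit_op u j j 1 +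
                    series (sin_coeff (t j)) n *: unit_op u j j 'i%C)).
  apply/funext => n.
  transitivity (tdiag u (fun j => series (cos_coeff (t j)) n +i* series (sin_coeff (t j)) n)).
    apply: (frame_extR hu) => i; rewrite tdiagE -exp_partial_sum scaler_suml.
    rewrite (big_morph _ (@mxCD _ _ _) (@mxC0 _ _ _)) mulmx_suml; apply: eq_bigr => k _.
    by rewrite tdiagX tdiagZ tdiagE.
  by rewrite tdiag_sum; apply: eq_bigr => j _; rewrite unit_opRI.
rewrite E; apply: cvg_lim; first exact: norm_hausdorff.
have -> : tdiag u (fun j => expi (t j)) =
   \sum_j (cos (t j) *: unit_op u j j 1 + sin (t j) *: unit_op u j j 'i%C).
  by rewrite tdiag_sum; apply: eq_bigr => j _; rewrite unit_opRI.
apply: cvg_big => [|j _]; first exact: add_continuous.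
apply: cvgD; apply: cvgZr_tmp.
  by rewrite unlock; exact: is_cvg_series_cos_coeff.
by rewrite unlock; exact: is_cvg_series_sin_coeff.
Qed.

End Torus.

(** * Canonical elements, rotations and the line V_0 *)

Section FrameOperators.
Variable R : realType.
Local Notation C := R[i].
Variable u : 'I_3 -> 'cV[C]_6.
Hypothesis hu : isotropic_frame u.
Local Notation cj := (@mxconj R 6 1).

Lemma ord3_ind (P : 'I_3 -> Prop) : P 0 -> P 1 -> P 2 -> forall i, P i.
Proof.
move=> P0 P1 P2 [[|[|[|i]]] Hi] //.
- by have -> : Ordinal Hi = 0 by apply/val_inj.
- by have -> : Ordinal Hi = 1 by apply/val_inj.
- by have -> : Ordinal Hi = 2 by apply/val_inj.
Qed.

Lemma mulmx_cj (A : 'M[R]_6) i : mxC A *m cj (u i) = cj (mxC A *m u i).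
Proof. by rewrite mxconjM mxconjC. Qed.

Definition weight (a b : nat) (j : 'I_3) : nat :=
  if j == 0 then a else if j == 1 then b else 0%N.

(** The element a E_1 + b E_2: zeta_1, zeta_2 and zeta_1 + zeta_2 are the cases (1, 0),
(1, 1) and (2, 1). *)
Definition zeta (a b : nat) : 'M[R]_6 := tdiag u (fun j => (weight a b j)%:R *i).

Lemma E_zeta : E u 0 = zeta 1 0 /\ E u 1 = zeta 0 1.
Proof.
have H i : E u i = tdiag u (fun j => (i == j)%:R *i).
  apply: (frame_extR hu) => l; rewrite (tdiagE hu) E_unit_op (unit_opE hu).
  case: eqP => [<-|_]; first by rewrite mulr1.
  by rewrite mulr0 scale0r -[0 *i]/(0 : C) scale0r.
by split; rewrite H; apply: tdiag_eq; apply: ord3_ind.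
Qed.

Lemma zetaD a b a' b' : zeta a b + zeta a' b' = zeta (a + a') (b + b').
Proof.
rewrite /zeta (tdiagD hu); apply: tdiag_eq => j; apply/eqP; rewrite eq_complex /= addr0 eqxx /=.
by move: j; apply: ord3_ind; rewrite -natrD.
Qed.

Lemma zeta_mulrn m1 m2 : zeta1 u *+ m1 + zeta2 u *+ m2 = zeta (m1 + m2) m2.
Proof.
have E0 : zeta 0 0 = 0.
  rewrite -(tdiag0 hu); apply: tdiag_eq; exact: ord3_ind.
have [E1 E2] := E_zeta.
have M a b n : zeta a b *+ n = zeta (a * n) (b * n).
  elim: n => [|n IH]; first by rewrite mulr0n !muln0 E0.
  by rewrite mulrS IH zetaD; congr zeta; rewrite mulnS.
rewrite /zeta1 /zeta2 E1 E2 zetaD (M 1 0)%N (M (1 + 0) (0 + 1))%N zetaD.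
by congr zeta; rewrite ?mul1n ?mul0n ?mul1n.
Qed.

Lemma zeta1E : zeta1 u = zeta 1 0.
Proof. by have := zeta_mulrn 1 0; rewrite mulr0n addr0. Qed.

Lemma zeta2E : zeta2 u = zeta 1 1.
Proof. by have := zeta_mulrn 0 1; rewrite mulr0n add0r. Qed.

Lemma zeta12E : zeta1 u + zeta2 u = zeta 2 1.
Proof. exact: (zeta_mulrn 1 1). Qed.

Lemma mexp_zeta (t : R) a b :
  mexp (t *: zeta a b) = tdiag u (fun j => expi (t * (weight a b j)%:R)).
Proof.
rewrite -(mexp_tdiag hu) /zeta (tdiagZ hu); congr mexp; apply: tdiag_eq => j.
by apply/eqP; rewrite eq_complex /=; apply/andP; split; apply/eqP; ring.
Qed.

Lemma mexp_pi_zeta a b :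
  mexp (pi *: zeta a b) = tdiag u (fun j => (-1) ^+ weight a b j).
Proof.
rewrite mexp_zeta; apply: tdiag_eq => j; rewrite mulrC -expiX; congr (_ ^+ _).
by rewrite /expi cospi sinpi; apply/eqP; rewrite eq_complex /= oppr0 !eqxx.
Qed.

Lemma circle_expi (l : C) : circle l -> exists t, expi t = l.
Proof.
rewrite /circle normC_normc; case: l => x y [] /= xy.
have xy1 : x ^+ 2 + y ^+ 2 = 1.
  by rewrite -[RHS](expr1n _ 2) -xy sqr_sqrtr// addr_ge0// sqr_ge0.
have xI : -1 <= x <= 1.
  rewrite -ler_norml -(@ler_pXn2r _ 2) ?nnegrE// real_normK ?num_real// expr1n.
  by rewrite -xy1 lerDl sqr_ge0.
have sE : sin (acos x) = `|y| by rewrite sin_acos// -sqrtr_sqr; congr Num.sqrt; rewrite -xy1; ring.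
have cE : cos (acos x) = x by apply: acosK; rewrite in_itv /=.
have [y0|y0] := leP 0 y.
  by exists (acos x); rewrite /expi cE sE ger0_norm.
by exists (- acos x); rewrite /expi cosN sinN cE sE ltr0_norm// opprK.
Qed.

Lemma expi_circle (t : R) : circle (expi t).
Proof. by rewrite /circle normC_normc normc_expi. Qed.

Lemma arg_expi (l : C) : circle l -> expi (arg l) = l.
Proof. by move=> /circle_expi[t tl]; rewrite /arg; case: xgetP => [_ _ //|/(_ t)]. Qed.

Lemma gamma_zeta a b (l : C) : circle l ->
  gamma (zeta a b) l = tdiag u (fun j => l ^+ weight a b j).
Proof.
move=> lc; rewrite /gamma mexp_zeta; apply: tdiag_eq => j.
by rewrite mulrC -expiX arg_expi.
Qed.

Lemma SO6_sqr (c : 'M[R]_6) : O6 c -> SO6 (c *m c).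
Proof.
move=> cc; have cT : c^T *m c = 1%:M := cc.
split; first by rewrite trmx_mul -mulmxA (mulmxA c^T c c) cT mul1mx.
by have := congr1 determinant cT; rewrite !det_mulmx det_tr det1.
Qed.

Lemma O6_tor (t : 'I_3 -> R) : O6 (tdiag u (fun j => expi (t j))).
Proof.
rewrite /O6 (tdiag_tr u) (tdiagM hu) -(tdiag1 hu); apply: tdiag_eq => j.
have -> : conjc (expi (t j)) = expi (- t j) by rewrite /expi cosN sinN.
by rewrite -expiD addNr expi0.
Qed.

Lemma SO6_tor (t : 'I_3 -> R) : SO6 (tdiag u (fun j => expi (t j))).
Proof.
have -> : tdiag u (fun j => expi (t j)) =
  tdiag u (fun j => expi (t j / 2)) *m tdiag u (fun j => expi (t j / 2)).
  by rewrite (tdiagM hu); apply: tdiag_eq => j; rewrite -expiD; congr expi; field.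
by apply: SO6_sqr; exact: O6_tor.
Qed.

Lemma SO6_mexp_pi_zeta a b : SO6 (mexp (pi *: zeta a b)).
Proof. rewrite mexp_zeta; exact: SO6_tor. Qed.

(** The rotation by the angle t in the two real planes spanned by the real parts and by
the imaginary parts of u_i and u_j. *)
Definition rot (i j : 'I_3) (t : R) : 'M[R]_6 :=
  1%:M + (cos t - 1) *: (unit_op u i i 1 + unit_op u j j 1)
  + sin t *: (unit_op u i j 1 - unit_op u j i 1).

Lemma rotE i j t l : i != j -> mxC (rot i j t) *m u l =
  if l == i then (cos t)%:C *: u i + (sin t)%:C *: u j
  else if l == j then (cos t)%:C *: u j - (sin t)%:C *: u i else u l.
Proof.
move=> ij; rewrite /rot !mxCD mxC1 !mxCZ mxCB mxCD !mulmxDl mul1mx -!scalemxAl !mulmxDl !mulNmx.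
rewrite !(unit_opE hu). rewrite !mul1r. have -> : (cos t - 1)%:C = (cos t)%:C - 1 :> C by rewrite -[LHS]/(_ +i* _) ; apply/eqP; rewrite eq_complex /= subr0 !eqxx.
have ji : (j == i) = false by rewrite eq_sym (negPf ij).
have [->|li] := eqVneq l i.
  by rewrite ji [true%:R]mulr1n [false%:R]mulr0n; apply/matrixP => x y; rewrite !mxE; ring.
have [->|lj] := eqVneq l j.
  rewrite ?eqxx [true%:R]mulr1n [false%:R]mulr0n.
  move: (u i) (u j) ((cos t)%:C) ((sin t)%:C) => a b c s.
  by apply/matrixP => x y; rewrite !mxE; ring.
by rewrite [false%:R]mulr0n; apply/matrixP => x y; rewrite !mxE; ring.
Qed.

Lemma rot_tr i j t : (rot i j t)^T = rot i j (- t).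
Proof.
rewrite /rot !trmxD !trmxZ trmxB trmxD trmx1 !unit_op_tr cosN sinN conjc1.
by rewrite scaleNr -scalerN opprB.
Qed.

Lemma rotM i j s t : i != j -> rot i j s *m rot i j t = rot i j (s + t).
Proof.
move=> ij; apply: (frame_extR hu) => l; rewrite mxCM -mulmxA !rotE//.
have ji : (j == i) = false by rewrite eq_sym (negPf ij).
have cD : (cos (s + t))%:C = (cos s)%:C * (cos t)%:C - (sin s)%:C * (sin t)%:C :> C.
  by rewrite cosD; apply/eqP; rewrite eq_complex /=; apply/andP; split; apply/eqP; ring.
have sD : (sin (s + t))%:C = (sin s)%:C * (cos t)%:C + (cos s)%:C * (sin t)%:C :> C.
  by rewrite sinD; apply/eqP; rewrite eq_complex /=; apply/andP; split; apply/eqP; ring.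
have [li|li] := eqVneq l i.
  rewrite mulmxDr -!scalemxAr !rotE// eqxx ji eqxx cD sD.
  move: (u i) (u j) => a b; by apply/matrixP => x y; rewrite !mxE; ring.
have [lj|lj] := eqVneq l j; last by rewrite rotE// (negPf li) (negPf lj).
rewrite mulmxBr -!scalemxAr !rotE// eqxx ji eqxx cD sD.
move: (u i) (u j) ((cos s)%:C) ((cos t)%:C) ((sin s)%:C) ((sin t)%:C) => a b c1 c2 c3 c4.
by apply/matrixP => x y; rewrite !mxE; ring.
Qed.

Lemma rot0 i j : rot i j 0 = 1%:M.
Proof. by rewrite /rot cos0 sin0 subrr !scale0r !addr0. Qed.

Lemma SO6_rot i j t : i != j -> SO6 (rot i j t).
Proof.
move=> ij; have -> : rot i j t = rot i j (t / 2) *m rot i j (t / 2).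
  by rewrite rotM//; congr rot; field.
by apply: SO6_sqr; rewrite /O6 rot_tr rotM// addNr rot0.
Qed.

(** The unit vector that spans V_0. *)
Definition xi : 'cV[R]_6 := mxRe ((Num.sqrt 2)%:C^-1 *: (u 2 + cj (u 2))).

Lemma sqrt2_inv : (Num.sqrt 2)%:C^-1 = ((Num.sqrt 2)^-1)%:C :> C.
Proof. by rewrite fmorphV. Qed.

Lemma mxC_xi : mxC xi = ((Num.sqrt 2)^-1)%:C *: (u 2 + cj (u 2)).
Proof.
rewrite /xi mxC_Re sqrt2_inv// mxconjZ mxconjD mxconjK conjc_real.
by rewrite [cj (u 2) + _]addrC.
Qed.

Lemma sqrt2_sqr : ((Num.sqrt 2)^-1 * (Num.sqrt 2)^-1 : R) = 2^-1.
Proof. by rewrite -invfM -expr2 sqr_sqrtr. Qed.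

Lemma xi_norm : xi^T *m xi = 1%:M.
Proof.
apply: mxC_inj; rewrite mxCM mxC_tr mxC_xi trmxZ -scalemxAl -scalemxAr scalerA.
rewrite trmxD mulmxDl !mulmxDr (frame_uu hu) (frame_uc hu) (frame_cu hu) (frame_cc hu).
rewrite eqxx add0r addr0 mxC1 -rmorphM /= sqrt2_sqr.
apply/matrixP => i j; rewrite !ord1 !mxE eqxx !mulr1n.
by apply/eqP; rewrite eq_complex /=; apply/andP; split; apply/eqP; [field|ring].
Qed.

Definition pxi : 'M[R]_6 := xi *m xi^T.

Lemma pxi_idem : pxi *m pxi = pxi.
Proof. by rewrite /pxi -mulmxA (mulmxA xi^T xi) xi_norm mul1mx. Qed.

Lemma pxi_tr : pxi^T = pxi.
Proof. by rewrite /pxi trmx_mul trmxK. Qed.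

Lemma pxiE l : mxC pxi *m u l = if l == 2 then 2^-1 *: (u 2 + cj (u 2)) else 0.
Proof.
rewrite /pxi mxCM mxC_tr -mulmxA.
have -> : (mxC xi)^T *m u l = (((Num.sqrt 2)^-1)%:C * (l == 2)%:R)%:M.
  rewrite mxC_xi trmxZ trmxD -scalemxAl mulmxDl (frame_uu hu) (frame_cu hu) add0r.
  by rewrite scale_scalar_mx eq_sym.
rewrite mul_mx_scalar mxC_xi scalerA mulrAC -rmorphM /= sqrt2_sqr.
have -> : (2^-1)%:C = 2^-1 :> C by rewrite fmorphV rmorph_nat.
by case: eqP => _; rewrite ?mulr1 // mulr0 scale0r.
Qed.

Lemma line_colspace (F : fieldType) (v w : 'cV[F]_6) : w^T *m v = 1%:M ->
  <[v]>%VS = colspace (v *m w^T).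
Proof.
move=> wv; apply/vspaceP => x; apply/vlineP/memv_colspace => [[a ->]|[y ->]].
  by exists (a *: v); rewrite -scalemxAr -mulmxA wv mulmx1.
exists ((w^T *m y) 0 0); rewrite -mulmxA [X in v *m X]mx11_scalar.
by rewrite mul_mx_scalar.
Qed.

Lemma V0E : V0 u = colspace pxi.
Proof. exact: line_colspace xi_norm. Qed.

Lemma s0E : s0 u = 2 *: pxi - 1%:M.
Proof.
rewrite /s0 V0E (annih_colspace pxi_idem) pxi_tr !oproj_colspace ?pxi_tr ?pxi_idem//.
- by rewrite opprB addrCA addrA scaler_nat mulr2n; congr (_ + _); rewrite addrC.
- by rewrite trmxB trmx1 pxi_tr.
- by rewrite mulmxBl !mulmxBr !mul1mx mulmx1 pxi_idem subrr subr0.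
Qed.

Lemma s0_frame l : mxC (s0 u) *m u l = if l == 2 then cj (u 2) else - u l.
Proof.
rewrite s0E mxCB mxCZ mxC1 mulmxBl -scalemxAl pxiE mul1mx.
case: eqP => [->|_]; last by rewrite scaler0 sub0r.
rewrite scalerA.
have -> : 2%:C * 2^-1 = 1 :> C by rewrite rmorph_nat mulfV// pnatr_eq0.
by rewrite scale1r addrC addrA addNr add0r.
Qed.

End FrameOperators.

(** * The base point and its reflection *)

Section BasePoint.
Variable R : realType.
Local Notation C := R[i].
Variable u : 'I_3 -> 'cV[C]_6.
Hypothesis hu : isotropic_frame u.
Local Notation cj := (@mxconj R 6 1).

(** x_0 is the sum of the line of xi and of the real plane of the first frame vector, on
which [unit_op u 0 0 1] is the projection. *)
Definition px : 'M[R]_6 := pxi u + unit_op u 0 0 1.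

Lemma conj_half : conjc (2^-1 : C) = 2^-1.
Proof. by rewrite conjc_inv conjc_nat. Qed.

Lemma half2 : 2^-1 + 2^-1 = 1 :> C.
Proof. by rewrite [RHS]splitr mul1r. Qed.

Lemma pxE l : mxC px *m u l =
  if l == 2 then 2^-1 *: (u 2 + cj (u 2)) else if l == 0 then u 0 else 0.
Proof.
rewrite /px mxCD mulmxDl (pxiE hu) (unit_opE hu) mul1r; move: l; apply: ord3_ind => /=.
- by rewrite scale1r add0r.
- by rewrite scale0r addr0.
- by rewrite scale0r addr0.
Qed.

Lemma px_idem : px *m px = px.
Proof.
apply: (frame_extR hu) => l; rewrite mxCM -mulmxA pxE; move: l; apply: ord3_ind => /=.
- by rewrite pxE.
- by rewrite mulmx0.
- rewrite -scalemxAr mulmxDr mulmx_cj pxE /= mxconjZ mxconjD mxconjK conj_half.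
  by rewrite [cj (u 2) + _]addrC -scalerDl half2 scale1r.
Qed.

Lemma px_tr : px^T = px.
Proof. by rewrite /px trmxD pxi_tr unit_op_tr conjc1. Qed.

Lemma X0E : X0 u = colspace (mxC px).
Proof.
pose Qm := cj (u 0) *m (u 0)^T; pose Qp := u 0 *m (cj (u 0))^T.
have V1E : V1 u = colspace Qm by apply: line_colspace; rewrite (frame_uc hu) eqxx.
have cQ : mxconj Qm = Qp by rewrite /Qm mxconjM mxconjK mxconj_tr.
have QmQm : Qm *m Qm = Qm by rewrite /Qm -mulmxA (mulmxA (u 0)^T) (frame_uc hu) eqxx mul1mx.
have QpQp : Qp *m Qp = Qp by rewrite /Qp -mulmxA (mulmxA (cj (u 0))^T) (frame_cu hu) eqxx mul1mx.
have QmQp : Qm *m Qp = 0 by rewrite /Qm /Qp -mulmxA (mulmxA (u 0)^T) (frame_uu hu) mul0mx mulmx0.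
have QpQm : Qp *m Qm = 0 by rewrite /Qm /Qp -mulmxA (mulmxA (cj (u 0))^T) (frame_cc hu) mul0mx mulmx0.
have xu : (mxC (xi u))^T *m u 0 = 0.
  rewrite (mxC_xi u) trmxZ trmxD -scalemxAl mulmxDl (frame_uu hu) (frame_cu hu) /=.
  by rewrite add0r -[false%:R]/(0:C) raddf0 scaler0.
have xc : (mxC (xi u))^T *m cj (u 0) = 0.
  rewrite (mxC_xi u) trmxZ trmxD -scalemxAl mulmxDl (frame_uc hu) (frame_cc hu) /=.
  by rewrite addr0 -[false%:R]/(0:C) raddf0 scaler0.
have ux : (u 0)^T *m mxC (xi u) = 0 by rewrite -[LHS]trmxK trmx_mul trmxK xu trmx0.
have cx : (cj (u 0))^T *m mxC (xi u) = 0 by rewrite -[LHS]trmxK trmx_mul trmxK xc trmx0.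
have xx : mxC (pxi u) *m mxC (pxi u) = mxC (pxi u) by rewrite -mxCM (pxi_idem hu).
have xE : mxC (pxi u) = mxC (xi u) *m (mxC (xi u))^T by rewrite /pxi mxCM mxC_tr.
rewrite /X0 V1E (V0E hu) cplx_colspace conjv_colspace cQ.
have xQm : mxC (pxi u) *m Qm = 0 by rewrite xE /Qm -mulmxA (mulmxA _^T) xc mul0mx mulmx0.
have xQp : mxC (pxi u) *m Qp = 0 by rewrite xE /Qp -mulmxA (mulmxA _^T) xu mul0mx mulmx0.
have Qmx : Qm *m mxC (pxi u) = 0 by rewrite xE /Qm -mulmxA (mulmxA _^T) ux mul0mx mulmx0.
have Qpx : Qp *m mxC (pxi u) = 0 by rewrite xE /Qp -mulmxA (mulmxA _^T) cx mul0mx mulmx0.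
have pE : mxC px = mxC (pxi u) + Qm + Qp.
  rewrite /px mxCD (mxC_unit_op u) conjc1 !scale1r -addrA; congr (_ + _).
  by rewrite addrC.
rewrite pE; move: (mxC (pxi u)) xx xQm xQp Qmx Qpx {xE pE xu xc ux cx V1E cQ} => P xx xQm xQp Qmx Qpx.
move: Qm Qp QmQm QpQp QmQp QpQm xQm xQp Qmx Qpx => Qm Qp QmQm QpQp QmQp QpQm xQm xQp Qmx Qpx.
have s1 : (P + Qm) *m (P + Qm) = P + Qm.
  by rewrite mulmxDl !mulmxDr xx xQm Qmx QmQm addr0 add0r.
have s2 : (P + Qm) *m Qp = 0 by rewrite mulmxDl xQp QmQp addr0.
have s3 : Qp *m (P + Qm) = 0 by rewrite mulmxDr Qpx QpQm addr0.
by rewrite (colspaceD xx QmQm xQm Qmx) (colspaceD s1 QpQp s2 s3).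
Qed.

Lemma x0E : x0 u = colspace px.
Proof. by rewrite /x0 X0E real_points_colspace// px_idem. Qed.

Local Notation e1 := (mexp (pi *: zeta1 u)).
Local Notation e2 := (mexp (pi *: zeta2 u)).

Lemma e1E : e1 = tdiag u (fun j => (-1) ^+ weight 1 0 j).
Proof. by rewrite (zeta1E hu) (mexp_pi_zeta hu). Qed.

Lemma e2E : e2 = tdiag u (fun j => (-1) ^+ weight 1 1 j).
Proof. by rewrite (zeta2E hu) (mexp_pi_zeta hu). Qed.

(** The reflection in x_0, by [s1E]; conjugation by it is the involution attached to the
base point. *)
Definition s1 : 'M[R]_6 := e1 *m s0 u.

Lemma tdiag_cj d l : mxC (tdiag u d) *m cj (u l) = conjc (d l) *: cj (u l).
Proof. by rewrite mulmx_cj (tdiagE hu) mxconjZ. Qed.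

Lemma s1_frame l : mxC s1 *m u l = if l == 2 then cj (u 2) else if l == 0 then u 0 else - u l.
Proof.
rewrite /s1 e1E mxCM -mulmxA (s0_frame hu); move: l; apply: ord3_ind => /=.
- by rewrite mulmxN (tdiagE hu) /= expr1 scaleN1r opprK.
- by rewrite mulmxN (tdiagE hu) /= expr0 scale1r.
- by rewrite tdiag_cj -[_ ^+ _]/1 conjc1 scale1r.
Qed.

Lemma s1E : s1 = 2 *: px - 1%:M.
Proof.
apply: (frame_extR hu) => l; rewrite s1_frame mxCB mxCZ mxC1 mulmxBl mul1mx -scalemxAl pxE.
have E2 : 2%:C = 2 :> C by rewrite rmorph_nat.
rewrite E2; move: l; apply: ord3_ind => /=.
- by rewrite scaler_nat mulr2n addrK.
- by rewrite scaler0 sub0r.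
- by rewrite scalerA mulfV ?pnatr_eq0// scale1r addrAC subrr add0r.
Qed.

Lemma s0_sqr : s0 u *m s0 u = 1%:M.
Proof.
rewrite (s0E hu) mulmxBl mulmxBr !mulmx1 mul1mx -scalemxAl -scalemxAr (pxi_idem hu) scalerA.
move: (pxi u) => P; apply/matrixP => i j; rewrite !mxE; ring.
Qed.

Lemma s0_tr : (s0 u)^T = s0 u.
Proof. by rewrite (s0E hu) trmxB trmxZ pxi_tr trmx1. Qed.

Lemma s1_sqr : s1 *m s1 = 1%:M.
Proof.
rewrite s1E mulmxBl mulmxBr !mulmx1 mul1mx -scalemxAl -scalemxAr px_idem scalerA.
move: px => P; apply/matrixP => i j; rewrite !mxE; ring.
Qed.

Lemma s1_tr : s1^T = s1.
Proof. by rewrite s1E trmxB trmxZ px_tr trmx1. Qed.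

(** The rotation by a right angle in the plane of the third frame vector, where it
anticommutes with s_0; it relates the classes of complementary maps. *)
Definition quarter : 'M[R]_6 := tdiag u (fun j => if j == 2 then 'i%C else 1).

Lemma SO6_quarter : SO6 quarter.
Proof.
have -> : quarter = tdiag u (fun j => expi (if j == 2 then pi / 2 else 0)).
  apply: tdiag_eq => j; case: eqP => _; last by rewrite expi0.
  by rewrite /expi cos_pihalf sin_pihalf.
exact: SO6_tor.
Qed.

(** On the first two planes of the frame e_2 is -1 and [quarter] the identity; on the
third e_2 is the identity and [quarter] anticommutes with s_0. *)
Lemma quarter_s0 d : mexp (pi *: zeta2 u) *m tdiag u d *m s0 u *m quarter =
  - (quarter *m tdiag u d *m s0 u).
Proof.
apply: (frame_extR hu) => l; rewrite e2E mxCN !mxCM mulNmx -!mulmxA (tdiagE hu) -scalemxAr (s0_frame hu).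
move: l; apply: ord3_ind => /=.
- rewrite scale1r !mulmxN !(tdiagE hu) -!scalemxAr !(tdiagE hu) -[_ ^+ _]/(-1) /=.
  by rewrite scaleN1r scale1r scalerN.
- rewrite scale1r !mulmxN !(tdiagE hu) -!scalemxAr !(tdiagE hu) -[_ ^+ _]/(-1) /=.
  by rewrite scaleN1r scale1r scalerN.
- have ci : conjc 'i%C = - 'i%C :> C by apply/eqP; rewrite eq_complex /= oppr0 !eqxx.
  have qc : mxC quarter *m cj (u 2) = - 'i%C *: cj (u 2) by rewrite /quarter tdiag_cj /= -ci.
  have ec : mxC (tdiag u (fun j => (-1) ^+ weight 1 1 j)) *m cj (u 2) = cj (u 2).
    by rewrite tdiag_cj -[_ ^+ _]/1 conjc1 scale1r.
  rewrite -!scalemxAr !(tdiag_cj d) -!scalemxAr qc ec !scalerA.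
  by rewrite -scaleNr mulrN opprK mulrC.
Qed.

(** The rotation exchanges the planes of the first two frame vectors, and [quarter] turns
xi to the orthogonal direction of the third plane, so x_0 goes to its complement. *)
Definition swap : 'M[R]_6 := quarter *m rot u 0 1 (pi / 2).

Lemma SO6M (a b : 'M[R]_6) : SO6 a -> SO6 b -> SO6 (a *m b).
Proof.
move=> [aa da] [bb db]; split; last by rewrite det_mulmx da db mulr1.
by rewrite trmx_mul -mulmxA (mulmxA a^T a b) aa mul1mx.
Qed.

Lemma SO6_swap : SO6 swap.
Proof. by apply: SO6M; [exact: SO6_quarter|apply: SO6_rot]. Qed.

Lemma rot_pihalf i j l : i != j -> mxC (rot u i j (pi / 2)) *m u l =
  if l == i then u j else if l == j then - u i else u l.
Proof.
by move=> ij; rewrite (rotE hu)// cos_pihalf sin_pihalf !scale0r !scale1r add0r sub0r.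
Qed.

Lemma swapE l : mxC swap *m u l = if l == 0 then u 1 else if l == 1 then - u 0 else 'i%C *: u 2.
Proof.
rewrite /swap mxCM -mulmxA rot_pihalf//; move: l; apply: ord3_ind => /=.
- by rewrite (tdiagE hu) scale1r.
- by rewrite mulmxN (tdiagE hu) scale1r.
- by rewrite (tdiagE hu).
Qed.

Lemma swap_s1 : swap *m s1 = - (s1 *m swap).
Proof.
apply: (frame_extR hu) => l; rewrite mxCN mulNmx (mxCM swap s1) (mxCM s1 swap) -!mulmxA s1_frame swapE.
move: l; apply: ord3_ind => /=.
- by rewrite swapE s1_frame /= opprK.
- by rewrite !mulmxN swapE s1_frame /= opprK.
- rewrite mulmx_cj swapE /= -scalemxAr s1_frame /= mxconjZ -scaleNr; congr (_ *: _).
  by apply/eqP; rewrite eq_complex /= oppr0 !eqxx.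
Qed.

Lemma O6_unit (g : 'M[R]_6) : O6 g -> g \in unitmx /\ invmx g = g^T.
Proof.
move=> gg; have gT : g^T *m g = 1%:M := gg.
have [_ gu] := mulmx1_unit gT; split => //.
by rewrite -[RHS]mulmx1 -(mulmxV gu) mulmxA gT mul1mx.
Qed.

Lemma act_swap_x0 : act swap (x0 u) = annih (x0 u).
Proof.
have [_ ] := O6_unit SO6_swap.1; have := SO6_swap.1.
have := mulmx1C SO6_swap.1.
move=> rr' rr ri; rewrite x0E (annih_colspace px_idem) px_tr act_colspace.
have pE : px = 2^-1 *: (s1 + 1%:M).
  by rewrite s1E subrK scalerA mulVf ?scale1r// pnatr_eq0.
have E : swap *m px = (1%:M - px) *m swap.
  rewrite pE mulmxBl mul1mx -scalemxAl -scalemxAr mulmxDr mulmxDl swap_s1 mulmx1 mul1mx.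
  by move: (s1 *m swap) swap => a b; apply/matrixP => i j; rewrite !mxE; field.
by rewrite E colspace_mulr//; have [] := O6_unit SO6_swap.1.
Qed.

End BasePoint.

(** * Admissible involutions *)

Section MatrixTopology.
Variable R : realType.

Lemma cvg_mx (T : Type) (F : set_system T) (m n : nat) (f : T -> 'M[R]_(m.+1, n.+1))
    (M : 'M[R]_(m.+1, n.+1)) :
  Filter F -> (forall i j, f x i j @[x --> F] --> M i j) -> f x @[x --> F] --> M.
Proof.
move=> FF H; apply/cvg_ballP => e e0.
have : \forall x \near F, forall i j, ball (M i j) e (f x i j).
  apply: filter_forall => i; apply: filter_forall => j.
  by have /cvg_ballP/(_ e e0) := H i j.
apply: filterS => x Hx; rewrite mx_norm_ball /ball_ /= /Num.Def.normr /= mx_normrE.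
by apply: bigmax_lt => // -[i j] _; rewrite !mxE; exact: Hx.
Qed.

Lemma cvg_mulmx (T : Type) (F : set_system T) (m n p : nat) (f : T -> 'M[R]_(m.+1, n.+1))
    (g : T -> 'M[R]_(n.+1, p.+1)) (A : 'M[R]_(m.+1, n.+1)) (B : 'M[R]_(n.+1, p.+1)) : Filter F ->
  f x @[x --> F] --> A -> g x @[x --> F] --> B -> (f x *m g x) @[x --> F] --> A *m B.
Proof.
move=> FF fA gB; apply: cvg_mx => i j.
rewrite mxE [X in X @ _ --> _](_ : _ = fun x => \sum_k f x i k * g x k j); last first.
  by apply/funext => x; rewrite mxE.
apply: cvg_big => [|k _]; first exact: add_continuous.
apply: cvgM.
  exact: (cvg_comp f (fun M : 'M[R]_(m.+1, n.+1) => M i k) fA (@coord_continuous R _ _ i k A)).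
exact: (cvg_comp g (fun M : 'M[R]_(n.+1, p.+1) => M k j) gB (@coord_continuous R _ _ k j B)).
Qed.

End MatrixTopology.

Section Admissible.
Variable R : realType.
Local Notation C := R[i].
Variable u : 'I_3 -> 'cV[C]_6.
Hypothesis hu : isotropic_frame u.

Lemma Ad_O6 (c g : 'M[R]_6) : O6 c -> Ad c g = c *m g *m c^T.
Proof. by move=> cO; have [_ E] := O6_unit cO; rewrite /Ad E. Qed.

Lemma O6_s0 : O6 (s0 u).
Proof. by rewrite /O6 (s0_tr hu) (s0_sqr hu). Qed.

Lemma sigmaE g : sigma u g = s0 u *m g *m s0 u.
Proof. by rewrite /sigma Ad_O6 ?(s0_tr hu)//; exact: O6_s0. Qed.

Lemma O6M (a b : 'M[R]_6) : O6 a -> O6 b -> O6 (a *m b).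
Proof.
move=> aO bO; have aa : a^T *m a = 1%:M := aO; have bb : b^T *m b = 1%:M := bO.
by rewrite /O6 trmx_mul -mulmxA (mulmxA a^T a b) aa mul1mx.
Qed.

Lemma O6_tr (a : 'M[R]_6) : O6 a -> O6 a^T.
Proof. by move=> aO; rewrite /O6 trmxK; exact: mulmx1C. Qed.

Lemma SO6_tr (a : 'M[R]_6) : SO6 a -> SO6 a^T.
Proof. by move=> [aa da]; split; [exact: O6_tr | rewrite det_tr]. Qed.

Lemma Ad_mul (a b g : 'M[R]_6) : O6 a -> O6 b -> Ad a (Ad b g) = Ad (a *m b) g.
Proof.
move=> aO bO; rewrite !Ad_O6 //; last exact: O6M.
by rewrite trmx_mul !mulmxA.
Qed.

Lemma det_O6_sqr (a : 'M[R]_6) : O6 a -> \det a * \det a = 1.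
Proof.
move=> aO; have aa : a^T *m a = 1%:M := aO.
by have := congr1 determinant aa; rewrite det_mulmx det_tr det1.
Qed.

Lemma SO6_sigma g : SO6 g -> SO6 (sigma u g).
Proof.
move=> [gg dg]; split.
  by rewrite sigmaE; apply: O6M; [apply: O6M => //|]; exact: O6_s0.
by rewrite sigmaE !det_mulmx dg mulr1 det_O6_sqr//; exact: O6_s0.
Qed.

Lemma sigmaK g : sigma u (sigma u g) = g.
Proof.
by rewrite !sigmaE -!mulmxA (s0_sqr hu) mulmx1 !mulmxA (s0_sqr hu) mul1mx.
Qed.

(** The quotient of the two elements commutes with the rotations that carry u_i to the
third frame vector, hence acts on u_i as it does there, that is trivially. *)
Lemma torus_Ad_inj a b a' b' :
  (forall g, SO6 g -> Ad (mexp (pi *: zeta u a b)) g = Ad (mexp (pi *: zeta u a' b')) g) ->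
  mexp (pi *: zeta u a b) = mexp (pi *: zeta u a' b').
Proof.
move=> H; rewrite !(mexp_pi_zeta hu).
set A := tdiag _ _; set B := tdiag _ _.
have AO : O6 A by rewrite /A -(mexp_pi_zeta hu); have [] := SO6_mexp_pi_zeta hu a b.
have BO : O6 B by rewrite /B -(mexp_pi_zeta hu); have [] := SO6_mexp_pi_zeta hu a' b'.
have AA : A^T *m A = 1%:M := AO; have BB : B^T *m B = 1%:M := BO.
have BT : B^T = B.
  rewrite /B (tdiag_tr u); apply: tdiag_eq => j.
  by rewrite rmorphXn rmorphN1.
have {}H g : SO6 g -> (B *m A) *m g = g *m (B *m A).
  move=> /H; rewrite !(mexp_pi_zeta hu) -/A -/B !Ad_O6// => /(congr1 (fun X => B^T *m X *m A)).
  by rewrite -!mulmxA AA mulmx1 BT (mulmxA B B) -{2}BT BB mul1mx.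
have D : B *m A = 1%:M.
  rewrite /A /B (tdiagM hu) -(tdiag1 hu); apply: tdiag_eq => i.
  have [->|i2] := eqVneq i 2; first by rewrite !expr0 mulr1.
  have := H _ (SO6_rot hu (pi / 2) i2); rewrite /A /B (tdiagM hu) => /(congr1 (fun X => mxC X *m u i)).
  rewrite !mxCM -!mulmxA (tdiagE hu) -scalemxAr !(rot_pihalf hu)// eqxx (tdiagE hu).
  move=> /(congr1 (fun v => (mxconj (u 2))^T *m v)).
  rewrite -!scalemxAr (frame_cu hu) eqxx => /matrixP/(_ 0 0).
  by rewrite !mxE eqxx !mulr1n !mulr1 => <-; rewrite /weight /= ?expr0 ?mulr1.
by rewrite -[A]mul1mx -BB -mulmxA BT D mulmx1.
Qed.

Lemma mexp_pi_zetaD a b a' b' :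
  mexp (pi *: zeta u a b) *m mexp (pi *: zeta u a' b') = mexp (pi *: zeta u (a + a') (b + b')).
Proof.
rewrite !(mexp_pi_zeta hu) (tdiagM hu); apply: tdiag_eq => j.
by rewrite -exprD /weight; case: (j == 0); case: (j == 1).
Qed.

(** The involution alone determines exp (pi (zeta' - zeta)), so the identification of
the Grassmannian is the same for every admissible zeta'. *)
Lemma admissible_mexp z z' tau a b : admissible u z z' tau ->
  (forall g, SO6 g -> tau g = Ad (mexp (pi *: zeta u a b)) (sigma u g)) ->
  mexp (pi *: (z' - z)) = mexp (pi *: zeta u a b).
Proof.
move=> [_ _ [k1 [k2 ->]] _ H] H'; rewrite (zeta_mulrn hu) in H *.
apply: torus_Ad_inj => g gS; rewrite -(sigmaK g).
by rewrite -H -?H'//; exact: SO6_sigma.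
Qed.

(** The two elements exp (pi zeta) are the half turns of the planes of the second and of
the first frame vector. Conjugation by rotations joins them, inside P^sigma because
these rotations commute with s_0. *)
Lemma P_comp_zeta21 : P_comp (sigma u) (zeta u 2 1) = P_comp (sigma u) (zeta u 1 0).
Proof.
rewrite /P_comp; apply/same_connected_component/connected_component_sym.
pose e := mexp (pi *: zeta u 1 0).
have eS : SO6 e := SO6_mexp_pi_zeta hu 1 0.
have eT : e^T = e.
  by rewrite /e (mexp_pi_zeta hu) (tdiag_tr u); apply: tdiag_eq => j; rewrite rmorphXn rmorphN1.
have ee : e *m e = 1%:M by rewrite -{1}eT; have [] := eS.
pose Q (t : R) := rot u 0 1 t *m e *m (rot u 0 1 t)^T.
have rO t : O6 (rot u 0 1 t) by have [] := @SO6_rot _ _ hu 0 1 t isT.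
have Q0 : Q 0 = e by rewrite /Q rot0 mul1mx trmx1 mulmx1.
have Q1 : Q (pi / 2) = mexp (pi *: zeta u 2 1).
  rewrite /Q -[RHS]mulmx1 -(mulmx1C (rO (pi / 2))) [RHS]mulmxA; congr (_ *m _).
  rewrite /e !(mexp_pi_zeta hu); apply: (frame_extR hu) => l.
  rewrite !mxCM -!mulmxA (tdiagE hu) -scalemxAr !(rot_pihalf hu)//; move: l; apply: ord3_ind => /=.
  - by rewrite (tdiagE hu).
  - rewrite mulmxN (tdiagE hu) -[_ ^+ weight 1 0 1]/1 -[_ ^+ weight 2 1 0]/(-1 * -1).
    by rewrite mulrNN mulr1 !scale1r.
  - by rewrite (tdiagE hu).
have QP : range Q `<=` P_ (sigma u).
  move=> _ [t _ <-].
  have QS : SO6 (Q t).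
    rewrite /Q; apply: SO6M; last by apply/SO6_tr/SO6_rot.
    by apply: SO6M => //; exact: SO6_rot.
  have QQ : Q t *m Q t = 1%:M.
    rewrite /Q -!mulmxA (mulmxA _^T (rot _ _ _ _)) (rO t) mul1mx (mulmxA e) ee mul1mx.
    exact: (mulmx1C (rO t)).
  split => //; rewrite sigmaE; have [_ ->] := O6_unit QS.1.
  have -> : (Q t)^T = Q t by rewrite /Q !trmx_mul trmxK eT mulmxA.
  have rs : s0 u *m rot u 0 1 t = rot u 0 1 t *m s0 u.
    apply: (frame_extR hu) => l; rewrite !mxCM -!mulmxA (rotE hu)// (s0_frame hu).
    move: l; apply: ord3_ind => /=.
    - by rewrite mulmxDr -!scalemxAr !(s0_frame hu) mulmxN (rotE hu)//= !scalerN opprD.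
    - by rewrite mulmxBr -!scalemxAr !(s0_frame hu) mulmxN (rotE hu)//= !scalerN opprB opprK addrC.
    - by rewrite mulmx_cj (s0_frame hu) (rotE hu).
  have es : s0 u *m e = e *m s0 u.
    rewrite /e (mexp_pi_zeta hu); apply: (frame_extR hu) => l.
    rewrite !mxCM -!mulmxA (tdiagE hu) -scalemxAr (s0_frame hu); move: l; apply: ord3_ind => /=.
    - by rewrite mulmxN (tdiagE hu) scalerN.
    - by rewrite mulmxN (tdiagE hu) scalerN.
    - by rewrite (tdiag_cj hu) -[_ ^+ weight 1 0 2]/1 conjc1.
  have rsT : s0 u *m (rot u 0 1 t)^T = (rot u 0 1 t)^T *m s0 u.
    by have := congr1 trmx rs; rewrite !trmx_mul (s0_tr hu).
  rewrite /Q !mulmxA rs -!mulmxA (mulmxA (s0 u) e) es -!mulmxA (mulmxA (s0 u) _^T) rsT.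
  by rewrite -!mulmxA (s0_sqr hu) mulmx1.
have rc : continuous (fun t : R => rot u 0 1 t).
  move=> t; rewrite /rot; apply: cvgD; first apply: cvgD; first exact: cvg_cst.
    apply: cvgZr_tmp; apply: cvgB; last exact: cvg_cst.
    exact: continuous_cos.
  by apply: cvgZr_tmp; exact: continuous_sin.
have Qc : continuous Q.
  move=> t; apply: cvg_mulmx; first apply: cvg_mulmx; [exact: rc|exact: cvg_cst|].
  have -> : (rot u 0 1 t)^T = rot u 0 1 (- t) by rewrite rot_tr.
  rewrite [X in X @ _ --> _](_ : _ = (fun s => rot u 0 1 (- s))); last by apply/funext => s; rewrite rot_tr.
  by apply: (cvg_comp _ _ (_ : - s @[s --> t] --> - t) (rc _)); exact: opp_continuous.
have con : connected (range Q).
  apply: connected_continuous_connected; last exact: continuous_subspaceT.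
  by apply/connected_intervalP.
have := connected_component_max (_ : range Q e) QP con.
apply; [by exists 0|by exists (pi / 2)].
Qed.

End Admissible.

(** * Derivatives of matrix-valued maps *)

Section MatrixCalculus.
Variable R : realType.

Lemma quotient_cvg (V W : normedModType R) (f : V -> W) x v : derivable f x v ->
  (h^-1 *: (f (h *: v + x) - f x)) @[h --> (0:R)^'] --> 'D_v f x.
Proof. by []. Qed.

Lemma derive_of_cvg (V W : normedModType R) (f : V -> W) x v (l : W) :
  (h^-1 *: (f (h *: v + x) - f x)) @[h --> (0:R)^'] --> l ->
  derivable f x v /\ 'D_v f x = l.
Proof.
move=> fl; split; first by apply/cvg_ex; exists l.
by apply: cvg_lim fl; exact: norm_hausdorff.
Qed.

Lemma derive_affine (V : normedModType R) (m n p q : nat) (f : V -> 'M[R]_(m.+1, n.+1))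
    (b : 'M[R]_(p.+1, q.+1)) (c : 'M[R]_(p.+1, m.+1)) (c' : 'M[R]_(n.+1, q.+1)) x v :
  derivable f x v ->
  derivable (fun y => b + c *m f y *m c') x v /\
  'D_v (fun y => b + c *m f y *m c') x = c *m 'D_v f x *m c'.
Proof.
move=> /quotient_cvg df; apply: derive_of_cvg.
rewrite [X in X @ _ --> _](_ : _ = fun h : R => c *m (h^-1 *: (f (h *: v + x) - f x)) *m c').
  by apply: cvg_mulmx; [apply: cvg_mulmx; [exact: cvg_cst|exact: df]|exact: cvg_cst].
apply/funext => h /=.
by rewrite opprD addrACA subrr add0r -mulmxBl -mulmxBr -scalemxAr -scalemxAl.
Qed.

Lemma Ck_affine (V : normedModType R) (m n p q : nat) (f : V -> 'M[R]_(m.+1, n.+1))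
    (b : 'M[R]_(p.+1, q.+1)) (c : 'M[R]_(p.+1, m.+1)) (c' : 'M[R]_(n.+1, q.+1)) k :
  Ck k setT f -> Ck k setT (fun y => b + c *m f y *m c').
Proof.
elim: k f b => [|k IH] f b /=.
  move=> cf x _; apply: cvgD; first exact: cvg_cst.
  by apply: cvg_mulmx; [apply: cvg_mulmx; [exact: cvg_cst|exact: cf]|exact: cvg_cst].
move=> [df cf]; split=> [x v _|v].
  by have [] := derive_affine b c c' (df x v I).
have -> : (fun x => 'D_v (fun y => b + c *m f y *m c') x) = (fun x => 0 + c *m 'D_v f x *m c').
  by apply/funext => x; have [_ ->] := derive_affine b c c' (df x v I); rewrite add0r.
exact: IH.
Qed.

Lemma Ck_slice (V T W : normedModType R) (F : V * T -> W) (t : T) k :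
  Ck k setT F -> Ck k setT (fun x => F (x, t)).
Proof.
have E (G : V * T -> W) x v : derivable G (x, t) (v, 0) ->
    derivable (fun y => G (y, t)) x v /\ 'D_v (fun y => G (y, t)) x = 'D_(v, 0) G (x, t).
  move=> /quotient_cvg dG; apply: derive_of_cvg.
  rewrite [X in X @ _ --> _](_ : _ = fun h : R => h^-1 *: (G (h *: (v, 0) + (x, t)) - G (x, t))) //.
  apply/funext => h; congr (_ *: (G _ - _)).
  by rewrite -[RHS]/(h *: v + x, h *: (0 : T) + t) scaler0 add0r.
elim: k F => [|k IH] F /=.
  move=> cF x _.
  have c1 : (y, t) @[y --> x] --> (x, t) by apply: cvg_pair => //; exact: cvg_cst.
  exact: (cvg_comp _ _ c1 (cF (x, t) I)).
move=> [dF cF]; split=> [x v _|v]; first by have [] := E _ _ _ (dF (x, t) (v, 0) I).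
have -> : (fun x => 'D_v (fun x0 => F (x0, t)) x) = (fun x => (fun z => 'D_(v, 0) F z) (x, t)).
  by apply/funext => x; have [_ ->] := E _ _ _ (dF (x, t) (v, 0) I).
exact: (IH (fun z => 'D_(v, 0) F z)).
Qed.

Lemma derive_mulmx (V : normedModType R) (m n p : nat) (f : V -> 'M[R]_(m.+1, n.+1))
    (g : V -> 'M[R]_(n.+1, p.+1)) x v : derivable f x v -> derivable g x v ->
  derivable (fun y => f y *m g y) x v /\
  'D_v (fun y => f y *m g y) x = 'D_v f x *m g x + f x *m 'D_v g x.
Proof.
move=> df dg; have fij := (derivable_mxP f x v).1 df; have gij := (derivable_mxP g x v).1 dg.
have E i j : (fun y => (f y *m g y) i j) = \sum_k ((fun y => f y i k) * (fun y => g y k j)).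
  by apply/funext => y; rewrite mxE fct_sumE.
have dfg : derivable (fun y => f y *m g y) x v.
  apply/derivable_mxP => i j; rewrite E.
  by apply: derivable_sum => k; exact: derivableM.
split => //; rewrite (derive_mx dfg) (derive_mx df) (derive_mx dg).
apply/matrixP => i j; rewrite !mxE E derive_sum; last by move=> k; exact: derivableM.
rewrite -big_split; apply: eq_bigr => k _ /=; rewrite deriveM//.
by rewrite !mxE /GRing.scale /= addrC [g x k j * _]mulrC.
Qed.

End MatrixCalculus.

Section ComplexPartial.
Variable R : realType.
Local Notation C := R[i].

Definition pdiff (m n : nat) (v : R * R) (f : C -> 'M[C]_(m.+1, n.+1)) (z : C) :=
  derivable (fun p => mxRe (f (cx p))) (pt z) v /\
  derivable (fun p => mxIm (f (cx p))) (pt z) v.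

Lemma ptK (z : C) : cx (pt z) = z.
Proof. by case: z. Qed.

Lemma mxIm_mxC m n (A : 'M[R]_(m, n)) : mxIm (mxC A) = 0.
Proof. by apply/matrixP => i j; rewrite !mxE. Qed.

Lemma partial_mxC m n (v : R * R) (F : C -> 'M[R]_(m.+1, n.+1)) z :
  derivable (F \o @cx R) (pt z) v ->
  pdiff v (fun w => mxC (F w)) z /\
  partial v (fun w => mxC (F w)) z = mxC ('D_v (F \o @cx R) (pt z)).
Proof.
move=> dF.
have E1 : (fun p => mxRe (mxC (F (cx p)))) = F \o @cx R by apply/funext => p; rewrite mxRe_C.
have E2 : (fun p => mxIm (mxC (F (cx p)))) = cst 0 by apply/funext => p; rewrite mxIm_mxC.
split; first by split; [rewrite E1; exact: dF|rewrite E2; exact: derivable_cst].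
by rewrite /partial E1 E2 derive_cst mxC0 scaler0 addr0.
Qed.

Lemma mxReM m n p (A : 'M[C]_(m, n)) (B : 'M[C]_(n, p)) :
  mxRe (A *m B) = mxRe A *m mxRe B - mxIm A *m mxIm B.
Proof.
apply/matrixP => i j; rewrite !mxE (big_morph (@complex.Re R) (id1 := 0) (op1 := +%R)) //; last by move=> [? ?] [? ?].
by rewrite -sumrB; apply: eq_bigr => k _; rewrite !mxE; case: (A i k) => ? ?; case: (B k j).
Qed.

Lemma mxImM m n p (A : 'M[C]_(m, n)) (B : 'M[C]_(n, p)) :
  mxIm (A *m B) = mxRe A *m mxIm B + mxIm A *m mxRe B.
Proof.
apply/matrixP => i j; rewrite !mxE (big_morph (@complex.Im R) (id1 := 0) (op1 := +%R)) //; last by move=> [? ?] [? ?].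
by rewrite -big_split; apply: eq_bigr => k _; rewrite !mxE; case: (A i k) => ? ?; case: (B k j).
Qed.

Lemma partial_mulmx m n p (v : R * R) (f : C -> 'M[C]_(m.+1, n.+1)) (g : C -> 'M[C]_(n.+1, p.+1)) z :
  pdiff v f z -> pdiff v g z -> pdiff v (fun w => f w *m g w) z /\
  partial v (fun w => f w *m g w) z = partial v f z *m g z + f z *m partial v g z.
Proof.
move=> [fr fi] [gr gi].
have [rr rrE] := derive_mulmx fr gr; have [ii iiE] := derive_mulmx fi gi.
have [ri riE] := derive_mulmx fr gi; have [ir irE] := derive_mulmx fi gr.
rewrite /partial /pdiff.
have -> : (fun p0 => mxRe (f (cx p0) *m g (cx p0))) =
  (fun q => mxRe (f (cx q)) *m mxRe (g (cx q))) - (fun q => mxIm (f (cx q)) *m mxIm (g (cx q))).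
  by apply/funext => q; rewrite mxReM.
have -> : (fun p0 => mxIm (f (cx p0) *m g (cx p0))) =
  (fun q => mxRe (f (cx q)) *m mxIm (g (cx q))) + (fun q => mxIm (f (cx q)) *m mxRe (g (cx q))).
  by apply/funext => q; rewrite mxImM.
split; first exact: (conj (derivableB rr ii) (derivableD ri ir)).
rewrite (deriveB rr ii) (deriveD ri ir) rrE iiE riE irE ptK.
set D1 := 'D_v _ _; set D2 := 'D_v _ _; set D3 := 'D_v _ _; set D4 := 'D_v _ _.
have -> : (mxC D1 + 'i%C *: mxC D3) *m g z + f z *m (mxC D2 + 'i%C *: mxC D4) =
  (mxC D1 + 'i%C *: mxC D3) *m (mxC (mxRe (g z)) + 'i%C *: mxC (mxIm (g z)))
  + (mxC (mxRe (f z)) + 'i%C *: mxC (mxIm (f z))) *m (mxC D2 + 'i%C *: mxC D4).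
  by rewrite -!mxReIm.
move: (mxRe (f z)) (mxIm (f z)) (mxRe (g z)) (mxIm (g z)) D1 D2 D3 D4 => a b c d D1 D2 D3 D4.
rewrite mxCB !(mxCD, mxCM) !mulmxDl !mulmxDr -!scalemxAl -!scalemxAr !scalerA -expr2 sqr_i.
rewrite !scaleN1r !scalerDr opprD.
move: (mxC D1 *m mxC c) (mxC a *m mxC D2) (mxC D3 *m mxC d) (mxC b *m mxC D4) => m1 m2 m3 m4.
move: (mxC D1 *m mxC d) (mxC a *m mxC D4) (mxC D3 *m mxC c) (mxC b *m mxC D2) => m5 m6 m7 m8.
by apply/matrixP => i j; rewrite !mxE; ring.
Qed.

Lemma partial_cst m n (v : R * R) (M : 'M[C]_(m.+1, n.+1)) z :
  pdiff v (fun=> M) z /\ partial v (fun=> M) z = 0.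
Proof.
split; first by split; exact: derivable_cst.
by rewrite /partial !derive_cst mxC0 scaler0 addr0.
Qed.

Lemma mxReD m n (A B : 'M[C]_(m, n)) : mxRe (A + B) = mxRe A + mxRe B.
Proof. by apply/matrixP => i j; rewrite !mxE; case: (A i j) => ? ?; case: (B i j). Qed.

Lemma mxImD m n (A B : 'M[C]_(m, n)) : mxIm (A + B) = mxIm A + mxIm B.
Proof. by apply/matrixP => i j; rewrite !mxE; case: (A i j) => ? ?; case: (B i j). Qed.

Lemma derive_addmx (V : normedModType R) (m n : nat) (f g : V -> 'M[R]_(m.+1, n.+1)) x v :
  derivable f x v -> derivable g x v -> derivable (fun y => f y + g y) x v /\
  'D_v (fun y => f y + g y) x = 'D_v f x + 'D_v g x.
Proof. by move=> df dg; split; [exact: derivableD|exact: deriveD]. Qed.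

Lemma partialD m n (v : R * R) (f g : C -> 'M[C]_(m.+1, n.+1)) z :
  pdiff v f z -> pdiff v g z -> pdiff v (fun w => f w + g w) z /\
  partial v (fun w => f w + g w) z = partial v f z + partial v g z.
Proof.
move=> [fr fi] [gr gi]; rewrite /partial /pdiff.
have -> : (fun p => mxRe (f (cx p) + g (cx p))) =
  (fun q => mxRe (f (cx q)) + mxRe (g (cx q))).
  by apply/funext => q; rewrite mxReD.
have -> : (fun p => mxIm (f (cx p) + g (cx p))) =
  (fun q => mxIm (f (cx q)) + mxIm (g (cx q))).
  by apply/funext => q; rewrite mxImD.
have [d1 ->] := derive_addmx fr gr; have [d2 ->] := derive_addmx fi gi.
split; first exact: (conj d1 d2).
set D1 : 'M[R]_(m.+1, n.+1) := 'D_v (fun q => mxRe (f (cx q))) (pt z).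
set D2 : 'M[R]_(m.+1, n.+1) := 'D_v (fun q => mxRe (g (cx q))) (pt z).
set D3 : 'M[R]_(m.+1, n.+1) := 'D_v (fun q => mxIm (f (cx q))) (pt z).
set D4 : 'M[R]_(m.+1, n.+1) := 'D_v (fun q => mxIm (g (cx q))) (pt z).
move: D1 D2 D3 D4 => D1 D2 D3 D4; rewrite !mxCD scalerDr.
by move: (mxC D1) (mxC D2) (_ *: mxC D3) (_ *: mxC D4) => a b c d; rewrite addrACA.
Qed.

(** The condition under which the Wirtinger derivatives [d_z] and [d_zbar] obey the rules
of calculus. *)
Definition pdiff2 (m n : nat) (f : C -> 'M[C]_(m.+1, n.+1)) (z : C) :=
  pdiff (e_x R) f z /\ pdiff (e_y R) f z.

Lemma pdiff2_mulmx m n p (f : C -> 'M[C]_(m.+1, n.+1)) (g : C -> 'M[C]_(n.+1, p.+1)) z :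
  pdiff2 f z -> pdiff2 g z -> [/\ pdiff2 (fun w => f w *m g w) z,
    d_z (fun w => f w *m g w) z = d_z f z *m g z + f z *m d_z g z &
    d_zbar (fun w => f w *m g w) z = d_zbar f z *m g z + f z *m d_zbar g z].
Proof.
move=> [fx fy] [gx gy].
have [dx Ex] := partial_mulmx fx gx; have [dy Ey] := partial_mulmx fy gy.
split; first exact: (conj dx dy).
all: rewrite /d_z /d_zbar Ex Ey; clear Ex Ey dx dy fx fy gx gy.
all: move: (partial (e_x R) f z) (partial (e_x R) g z) (partial (e_y R) f z) (partial (e_y R) g z).
all: move: (f z) (g z) => A B a b c d; rewrite -scalemxAl -scalemxAr -scalerDr; congr (_ *: _).
  rewrite mulmxBl mulmxBr -scalemxAl -scalemxAr scalerDr opprD.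
  by move: (a *m B) (A *m b) (c *m B) (A *m d) => m1 m2 m3 m4; rewrite addrACA.
rewrite mulmxDl mulmxDr -scalemxAl -scalemxAr scalerDr.
by move: (a *m B) (A *m b) (c *m B) (A *m d) => m1 m2 m3 m4; rewrite addrACA.
Qed.

Lemma pdiff2_cst m n (M : 'M[C]_(m.+1, n.+1)) z :
  [/\ pdiff2 (fun=> M) z, d_z (fun=> M) z = 0 & d_zbar (fun=> M) z = 0].
Proof.
have [dx Ex] := @partial_cst _ _ (e_x R) M z; have [dy Ey] := @partial_cst _ _ (e_y R) M z.
split; first exact: (conj dx dy).
  by rewrite /d_z Ex Ey scaler0 subr0 scaler0.
by rewrite /d_zbar Ex Ey scaler0 addr0 scaler0.
Qed.

Lemma pdiff2D m n (f g : C -> 'M[C]_(m.+1, n.+1)) z :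
  pdiff2 f z -> pdiff2 g z -> [/\ pdiff2 (fun w => f w + g w) z,
    d_z (fun w => f w + g w) z = d_z f z + d_z g z &
    d_zbar (fun w => f w + g w) z = d_zbar f z + d_zbar g z].
Proof.
move=> [fx fy] [gx gy].
have [dx Ex] := partialD fx gx; have [dy Ey] := partialD fy gy.
split; first exact: (conj dx dy).
all: rewrite /d_z /d_zbar Ex Ey; clear Ex Ey dx dy fx fy gx gy.
all: move: (partial (e_x R) f z) (partial (e_x R) g z) (partial (e_y R) f z) (partial (e_y R) g z).
all: move=> a b c d; rewrite -scalerDr; congr (_ *: _); rewrite scalerDr ?opprD.
all: by rewrite addrACA.
Qed.

Lemma pdiff2Z m n (a : C) (f : C -> 'M[C]_(m.+1, n.+1)) z :
  pdiff2 f z -> [/\ pdiff2 (fun w => a *: f w) z,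
    d_z (fun w => a *: f w) z = a *: d_z f z &
    d_zbar (fun w => a *: f w) z = a *: d_zbar f z].
Proof.
move=> df; have [d0 E1 E2] := pdiff2_cst (@scalar_mx C m.+1 a) z.
have -> : (fun w => a *: f w) = (fun w => a%:M *m f w) by apply/funext => w; rewrite mul_scalar_mx.
have [d1 -> ->] := pdiff2_mulmx d0 df.
by rewrite E1 E2 !mul0mx !add0r !mul_scalar_mx.
Qed.

Lemma pdiff2_sum m n (I : Type) (r : seq I) (f : I -> C -> 'M[C]_(m.+1, n.+1)) z :
  (forall i, pdiff2 (f i) z) -> [/\ pdiff2 (fun w => \sum_(i <- r) f i w) z,
    d_z (fun w => \sum_(i <- r) f i w) z = \sum_(i <- r) d_z (f i) z &
    d_zbar (fun w => \sum_(i <- r) f i w) z = \sum_(i <- r) d_zbar (f i) z].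
Proof.
move=> df; elim: r => [|i r [d E1 E2]].
  have -> : (fun w => \sum_(i <- [::]) f i w) = (fun=> 0) by apply/funext => w; rewrite big_nil.
  by rewrite !big_nil; exact: pdiff2_cst.
have -> : (fun w => \sum_(j <- i :: r) f j w) = (fun w => f i w + \sum_(j <- r) f j w).
  by apply/funext => w; rewrite big_cons.
have [d' -> ->] := pdiff2D (df i) d.
by rewrite !big_cons E1 E2.
Qed.

Lemma cvg_pt (z : C^o) : @pt R x @[x --> z] --> pt z.
Proof.
move=> A /nbhs_ballP[e /= e0 eA].
apply/(@nbhs_normcP _ z (fun w => A (pt w))); exists e => // w wz.
apply: eA; split; rewrite /ball /= distrC.
  by rewrite -ReB; exact: (le_lt_trans (normRe_le _)).
by rewrite -ImB; exact: (le_lt_trans (normIm_le _)).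
Qed.

Lemma cvg_cx (p : R * R) : (@cx R q : C^o) @[q --> p] --> (cx p : C^o).
Proof.
move=> A /(@nbhs_normcP _ (cx p) A)[d d0 dA].
apply/nbhs_ballP; exists (d / 2); first by rewrite /= divr_gt0.
move=> q [b1 b2]; apply: dA.
have -> : cx q - cx p = (q.1 - p.1) +i* (q.2 - p.2) by [].
apply: (le_lt_trans (normc_le _ _)).
by move: b1 b2; rewrite /ball /= distrC [X in _ -> X < _ -> _]distrC; lra.
Qed.

Lemma near_d_z m n (f g : C -> 'M[C]_(m.+1, n.+1)) (z : C^o) :
  (\forall w \near z, f w = g w) -> d_z f z = d_z g z.
Proof.
move=> fg.
have E (v : R * R) : partial v f z = partial v g z.
  rewrite /partial.
  have H : \forall q \near pt z, f (cx q) = g (cx q).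
    by have := @cvg_cx (pt z) [set w | f w = g w]; rewrite ptK; apply.
  have H1 : \forall q \near pt z, mxRe (f (cx q)) = mxRe (g (cx q)) by apply: filterS H => q ->.
  have H2 : \forall q \near pt z, mxIm (f (cx q)) = mxIm (g (cx q)) by apply: filterS H => q ->.
  by rewrite (near_eq_derive v H1) (near_eq_derive v H2).
by rewrite /d_z !E.
Qed.

End ComplexPartial.

(** * Conjugating extended solutions by a constant *)

Section LoopTranslation.
Variable R : realType.
Local Notation C := R[i].

Lemma smooth_affine (V : normedModType R) (m n p q : nat) (f : V -> 'M[R]_(m.+1, n.+1))
    (b : 'M[R]_(p.+1, q.+1)) (c : 'M[R]_(p.+1, m.+1)) (c' : 'M[R]_(n.+1, q.+1)) :
  smooth setT f -> smooth setT (fun y => b + c *m f y *m c').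
Proof. by move=> sf k; exact: Ck_affine. Qed.

Lemma smooth_sandwich (V : normedModType R) (m n p q : nat) (f : V -> 'M[R]_(m.+1, n.+1))
    (c : 'M[R]_(p.+1, m.+1)) (c' : 'M[R]_(n.+1, q.+1)) :
  smooth setT f -> smooth setT (fun y => c *m f y *m c').
Proof.
move=> /(smooth_affine 0 c c'); congr smooth.
by apply/funext => y; rewrite add0r.
Qed.

Lemma cdiffD (f g : C -> C) (z a b : C) :
  cdiff f z a -> cdiff g z b -> cdiff (fun w => f w + g w) z (a + b).
Proof.
move=> df dg e e0; have e2 : 0 < e / 2 by rewrite divr_gt0.
have [d1 d10 H1] := df _ e2; have [d2 d20 H2] := dg _ e2.
exists (Num.min d1 d2); first by rewrite lt_min d10.
move=> w; rewrite le_min => /andP[/H1 h1 /H2 h2].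
have -> : f w + g w - (f z + g z) - (a + b) * (w - z) =
  (f w - f z - a * (w - z)) + (g w - g z - b * (w - z)) by ring.
by apply: (le_trans (le_normcD _ _)); lra.
Qed.

Lemma cdiff_cst (c z : C) : cdiff (fun=> c) z 0.
Proof.
move=> e e0; exists 1 => // w _; rewrite subrr mul0r subrr normc0.
by rewrite mulr_ge0 ?normc_ge0// ltW.
Qed.

Lemma cdiff_sum (I : Type) (r : seq I) (f : I -> C -> C) z :
  (forall i, exists a, cdiff (f i) z a) -> exists a, cdiff (fun w => \sum_(i <- r) f i w) z a.
Proof.
move=> H; elim: r => [|i r [a da]].
  exists 0; have -> : (fun w => \sum_(i <- [::]) f i w) = (fun=> 0).
    by apply/funext => w; rewrite big_nil.
  exact: cdiff_cst.
have [b db] := H i; exists (b + a).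
have -> : (fun w => \sum_(j <- i :: r) f j w) = (fun w => f i w + \sum_(j <- r) f j w).
  by apply/funext => w; rewrite big_cons.
exact: cdiffD.
Qed.

Lemma extends_to_disc_mul (K : 'M[R]_6) (h : C -> 'M[C]_6) : SO6 K ->
  extends_to_disc h -> extends_to_disc (fun l => mxC K *m h l).
Proof.
move=> [KK dK] [H [Hh dH cH SH]]; exists (fun l => mxC K *m H l); split.
- by move=> l lc; rewrite Hh.
- move=> i j z z1; apply/(@derivable_cdiff _ (fun w : C^o => (mxC K *m H w) i j : C^o)).
  have -> : (fun w : C => (mxC K *m H w) i j) = (fun w => \sum_k mxC K i k * H w k j).
    by apply/funext => w; rewrite mxE.
  apply: cdiff_sum => k; have := dH k j z z1.
  move=> /(@derivable_cdiff _ (fun w : C^o => H w k j : C^o))[a da].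
  by eexists; apply: cdiff_mul da; exact: cdiff_cst.
- move=> i j.
  have -> : (fun w : C^o => (mxC K *m H w) i j : C^o) = (fun w : C^o => \sum_k (mxC K i k * H w k j : C^o) : C^o).
    by apply/funext => w; rewrite mxE.
  move=> x; apply: cvg_big => [|k _]; first exact: add_continuous.
  by apply: cvgMl_tmp; exact: cH.
- move=> l l1; have [HH dHl] := SH l l1; split; last by rewrite det_mulmx det_map_mx dK rmorph1 mul1r.
  by rewrite trmx_mul -mulmxA (mulmxA (mxC K)^T) -mxC_tr -mxCM KK mxC1 mul1mx.
Qed.

Lemma csmooth_mul (V : normedModType R) m n p (K : 'M[R]_(p.+1, m.+1)) (h : V -> 'M[C]_(m.+1, n.+1)) :
  csmooth setT h -> csmooth setT (fun x => mxC K *m h x).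
Proof.
move=> [hr hi]; split.
  have -> : (fun x => mxRe (mxC K *m h x)) = (fun x => K *m mxRe (h x) *m 1%:M).
    by apply/funext => x; rewrite mxReM_real mulmx1.
  exact: smooth_sandwich.
have -> : (fun x => mxIm (mxC K *m h x)) = (fun x => K *m mxIm (h x) *m 1%:M).
  by apply/funext => x; rewrite mxIm_real mulmx1.
exact: smooth_sandwich.
Qed.

Lemma laurent_mul (K : 'M[R]_6) (h : C -> 'M[C]_6) (K' : 'M[R]_6) :
  laurent h -> laurent (fun l => mxC K *m h l *m mxC K').
Proof.
move=> [r [n [A hA]]]; exists r, n, (fun k => mxC K *m A k *m mxC K') => l lc.
rewrite hA// mulmx_sumr mulmx_suml; apply: eq_bigr => k _.
by rewrite -scalemxAr -scalemxAl.
Qed.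

Lemma OmegaG_conj (K : 'M[R]_6) g : SO6 K -> OmegaG g -> OmegaG (fun l => K *m g l *m K^T).
Proof.
move=> KS [gS g1 gs]; have KO := KS.1; split.
- by move=> l /gS gl; apply: SO6M; [exact: SO6M|exact: SO6_tr].
- by rewrite g1 mulmx1; exact: (mulmx1C KO).
- exact: smooth_sandwich.
Qed.

Lemma Omega_alg_conj (K : 'M[R]_6) g : SO6 K -> Omega_alg g -> Omega_alg (fun l => K *m g l *m K^T).
Proof.
move=> KS [gO gl]; split; first exact: OmegaG_conj.
have -> : (fun l => mxC (K *m g l *m K^T)) = (fun l => mxC K *m mxC (g l) *m mxC K^T).
  by apply/funext => l; rewrite !mxCM.
exact: laurent_mul.
Qed.

(** If h gamma = g f is the Iwasawa factorisation of h gamma, then that of (K h) gamma is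
(K g K^T) (K f). *)
Lemma U_conj (K z : 'M[R]_6) g : SO6 K -> U_ z g -> U_ z (fun l => K *m g l *m K^T).
Proof.
move=> KS [h [hl he] [gO [f [fs fe] hg]]]; have KO := KS.1.
have KK : K^T *m K = 1%:M := KO.
exists (fun l => mxC K *m h l).
  split; last exact: extends_to_disc_mul.
  have := laurent_mul K 1%:M hl; congr laurent.
  by apply/funext => l; rewrite mxC1 mulmx1.
split; first exact: OmegaG_conj.
exists (fun l => mxC K *m f l).
  by split; [exact: csmooth_mul|exact: extends_to_disc_mul].
move=> l lc; rewrite -mulmxA hg// !mxCM !mulmxA -(mulmxA _ (mxC K^T) (mxC K)).
by rewrite -(mxCM K^T K) KK mxC1 mulmx1.
Qed.

Lemma partial_sandwich m n p q (v : R * R) (c : 'M[R]_(p.+1, m.+1)) (F : C -> 'M[R]_(m.+1, n.+1))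
    (c' : 'M[R]_(n.+1, q.+1)) z :
  derivable (F \o @cx R) (pt z) v ->
  partial v (fun w => mxC (c *m F w *m c')) z = mxC c *m partial v (fun w => mxC (F w)) z *m mxC c'.
Proof.
move=> dF; have [_ ->] := partial_mxC dF.
have [d0 E] := derive_affine 0 c c' dF.
have E0 : (fun w => c *m F w *m c') \o @cx R = (fun y => 0 + c *m (F \o @cx R) y *m c').
  by apply/funext => y; rewrite add0r.
have [|_ ->] := @partial_mxC R _ _ v (fun w => c *m F w *m c') z; first by rewrite E0.
by rewrite E0 E !mxCM.
Qed.

Lemma extended_solution_slice (Phi : sphere R -> C -> 'M[R]_6) : extended_solution Phi ->
  forall b l, circle l -> smooth setT (fun q => Phi (chart b (cx q)) l).
Proof.
move=> [_ Ps] b l lc k; have [t tl] := circle_expi lc; have [sP _] := Ps b.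
rewrite -tl.
exact: (@Ck_slice R _ _ _ (fun q : R * R * R => Phi (chart b (cx q.1)) (expi q.2)) t k (sP k)).
Qed.

Lemma extended_solution_conj (K : 'M[R]_6) (Phi : sphere R -> C -> 'M[R]_6) : SO6 K ->
  extended_solution Phi -> extended_solution (fun p l => K *m Phi p l *m K^T).
Proof.
move=> KS [PO Ps]; have KO := KS.1; have KK : K^T *m K = 1%:M := KO.
split; first by move=> p; exact: OmegaG_conj.
move=> b; have [sP [ax [ay [so [sx sy] eqs]]]] := Ps b.
split; first exact: (smooth_sandwich K K^T sP).
exists (fun z => K *m ax z *m K^T), (fun z => K *m ay z *m K^T); split.
- move=> z; have [s1 s2] := so z.
  by rewrite /so6 !trmx_mul trmxK s1 s2 !mulNmx !mulmxN !mulmxA; split.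
- by split; exact: smooth_sandwich.
move=> z l lc /=; have [E1 E2] := eqs z l lc.
have dP v : derivable ((fun w => Phi (chart b w) l) \o @cx R) (pt z) v.
  have [d _] := extended_solution_slice (conj PO Ps) b lc 1.
  exact: d.
have PlO : O6 (Phi (chart b z) l) by have [S _ _] := PO (chart b z); have [] := S l lc.
have inv : invmx (mxC (K *m Phi (chart b z) l *m K^T)) =
   mxC K *m invmx (mxC (Phi (chart b z) l)) *m mxC K^T.
  rewrite -!mxC_invmx; have [_ ->] := O6_unit PlO.
  have [_ ->] := O6_unit (O6M (O6M KO PlO) (O6_tr KO)).
  by rewrite !trmx_mul trmxK -!mxCM mulmxA.
have D v : partial v (fun w => mxC (K *m Phi (chart b w) l *m K^T)) z =
  mxC K *m partial v (fun w => mxC (Phi (chart b w) l)) z *m mxC K^T.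
  exact: (@partial_sandwich _ _ _ _ v K (fun w => Phi (chart b w) l)).
have mid (X Y : 'M[C]_6) : mxC K *m X *m mxC K^T *m (mxC K *m Y *m mxC K^T) = mxC K *m (X *m Y) *m mxC K^T.
  by rewrite !mulmxA -(mulmxA _ (mxC K^T) (mxC K)) -(mxCM K^T K) KK mxC1 mulmx1.
have DL (a : C) (X Y : 'M[C]_6) : a *: (mxC K *m X *m mxC K^T - 'i%C *: (mxC K *m Y *m mxC K^T)) =
   mxC K *m (a *: (X - 'i%C *: Y)) *m mxC K^T.
  by rewrite -scalemxAr -scalemxAl mulmxBr mulmxBl -scalemxAr -scalemxAl.
have DR (a : C) (X Y : 'M[C]_6) : a *: (mxC K *m X *m mxC K^T + 'i%C *: (mxC K *m Y *m mxC K^T)) =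
   mxC K *m (a *: (X + 'i%C *: Y)) *m mxC K^T.
  by rewrite -scalemxAr -scalemxAl mulmxDr mulmxDl -scalemxAr -scalemxAl.
split.
  rewrite inv /d_z !D DL mid -/(d_z _ z) E1 !mxCM DL.
  by rewrite -scalemxAr -scalemxAl.
rewrite inv /d_zbar !D DR mid -/(d_zbar _ z) E2 !mxCM DR.
by rewrite -scalemxAr -scalemxAl.
Qed.

End LoopTranslation.

(** * Orthogonal complements *)

Section Complement.
Variable R : realType.
Local Notation C := R[i].
Variable u : 'I_3 -> 'cV[C]_6.
Hypothesis hu : isotropic_frame u.
Local Notation K := (quarter u).
Local Notation T a b := (mexp (pi *: zeta u a b)).

Lemma T_tr a b : (T a b)^T = T a b.
Proof.
by rewrite (mexp_pi_zeta hu) (tdiag_tr u); apply: tdiag_eq => j; rewrite rmorphXn rmorphN1.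
Qed.

Lemma T_O6 a b : O6 (T a b).
Proof. by have [] := SO6_mexp_pi_zeta hu a b. Qed.

Lemma T_sqr a b : T a b *m T a b = 1%:M.
Proof. by have := T_O6 a b; rewrite /O6 T_tr. Qed.

Lemma T_comm a b a' b' : T a b *m T a' b' = T a' b' *m T a b.
Proof. by rewrite !(mexp_pi_zetaD hu) (addnC a) (addnC b). Qed.

Lemma T_s0 a b : T a b *m s0 u = s0 u *m T a b.
Proof.
rewrite (mexp_pi_zeta hu); apply: (frame_extR hu) => l.
rewrite !mxCM -!mulmxA (tdiagE hu) -scalemxAr (s0_frame hu); move: l; apply: ord3_ind => /=.
- by rewrite mulmxN (tdiagE hu) scalerN.
- by rewrite mulmxN (tdiagE hu) scalerN.
- by rewrite (tdiag_cj hu) -[_ ^+ weight a b 2]/1 conjc1.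
Qed.

Lemma K_T a b : K *m T a b = T a b *m K.
Proof.
rewrite (mexp_pi_zeta hu) /quarter !(tdiagM hu); apply: tdiag_eq => j; exact: mulrC.
Qed.

Lemma K_O6 : O6 K. Proof. by have [] := SO6_quarter hu. Qed.

Lemma K_T_s0 a b : T 1 1 *m T a b *m s0 u *m K = - (K *m T a b *m s0 u).
Proof. by rewrite -(zeta2E hu) (mexp_pi_zeta hu) (quarter_s0 hu). Qed.

Lemma s1_T : s1 u = T 1 0 *m s0 u.
Proof. by rewrite /s1 (zeta1E hu). Qed.

Lemma sigma1E g : sigma1 u g = s1 u *m g *m s1 u.
Proof.
rewrite /sigma1 (sigmaE hu) Ad_O6; last by rewrite (zeta1E hu); exact: T_O6.
by rewrite (zeta1E hu) T_tr s1_T !mulmxA -(mulmxA _ (s0 u)) -T_s0 !mulmxA.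
Qed.

(** The embedding of the Grassmannian in terms of the reflection g s_1 g^T in W. *)
Lemma identifiedE z z' W q a b : mexp (pi *: (z' - z)) = T a b ->
  identified u z z' W q <->
  exists2 g, SO6 g & W = act g (x0 u) /\
    q = T a b *m T 1 0 *m (g *m s1 u *m g^T) *m s1 u.
Proof.
move=> ET; rewrite /identified; split=> -[g gS [-> ->]]; exists g => //; split => //;
by rewrite sigma1E ET (zeta1E hu); have [_ ->] := O6_unit gS.1; rewrite !mulmxA.
Qed.

(** The complement of W has the opposite reflection. The same sign appears when [quarter]
is moved across e_2 and s_1, by [quarter_s0]; [swap] provides the element of SO(6)
that carries x_0 to the complement. *)
Lemma identified_complement z z' z'' W q a b :
  mexp (pi *: (z' - z)) = T a b -> mexp (pi *: (z'' - z)) = T (1 + a) (1 + b) ->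
  identified u z z' W q ->
  identified u z z'' (act (T 1 1 *m K) (annih W)) (K *m q *m K^T).
Proof.
move=> ET ET' /(identifiedE _ _ ET)[g gS [-> ->]].
apply/(identifiedE _ _ ET').
have E2 : SO6 (T 1 1) by exact: SO6_mexp_pi_zeta.
exists (T 1 1 *m K *m g *m swap u).
  apply: (SO6M _ (SO6_swap hu)); apply: (SO6M _ gS); apply: (SO6M E2).
  exact: SO6_quarter.
split; first by rewrite -(act_annih _ gS.1) -(act_swap_x0 hu) !act_mul !mulmxA.
have sw : swap u *m s1 u *m (swap u)^T = - s1 u.
  by rewrite (swap_s1 hu) mulNmx -mulmxA (mulmx1C (SO6_swap hu).1) mulmx1.
have -> : T 1 1 *m K *m g *m swap u *m s1 u *m (T 1 1 *m K *m g *m swap u)^T =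
  - (T 1 1 *m K *m (g *m s1 u *m g^T) *m K^T *m T 1 1).
  have := T_tr 1 1; move: (swap u) (s1 u) sw K (T 1 1) => r s rs k e eT.
  rewrite !trmx_mul eT !mulmxA -(mulmxA _ r s) -(mulmxA _ (r *m s) r^T) rs.
  by rewrite mulmxN !mulNmx.
have -> : T (1 + a) (1 + b) = T 1 1 *m T a b by rewrite (mexp_pi_zetaD hu).
have KS : K^T *m T 1 1 *m s1 u = - (s1 u *m K^T).
  have e : T 1 1 *m s1 u = s1 u *m T 1 1.
    by rewrite s1_T mulmxA T_comm -!mulmxA T_s0.
  have H : T 1 1 *m s1 u *m K = - (K *m s1 u) by rewrite s1_T !mulmxA K_T_s0.
  have := T_tr 1 1; have := s1_tr hu.
  move: (s1 u) (T 1 1) K e H => s E k e /(congr1 trmx).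
  have trN (M : 'M[R]_6) : (- M)^T = - M^T by apply/matrixP => i j; rewrite !mxE.
  rewrite trN !trmx_mul => + sT ET2; rewrite sT ET2 => <-.
  by rewrite -mulmxA e.
have := K_T a b; have := K_T 1 0; have := T_comm 1 1 a b; have := T_comm 1 1 1 0; have := T_sqr 1 1.
move: (T a b) (T 1 0) (T 1 1) K (s1 u) (g *m s1 u *m g^T) KS => A B E k s X f1 f5 f4 f4' f3 f2.
rewrite mulmxN mulNmx -!mulmxA (mulmxA k^T E) f1 !mulmxN opprK !mulmxA.
rewrite f2 -(mulmxA A k B) f3 f4' -(mulmxA A E B) f4 !mulmxA.
by rewrite -(mulmxA (A *m B) E E) f5 mulmx1.
Qed.

(** By [quarter_s0], conjugation by K intertwines Ad t o sigma with Ad (e_2 t) o sigma for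
t in the torus, the sign being lost in Ad. *)
Lemma corresponding_complement z tau tau' phi (Phi : sphere R -> C -> 'M[R]_6) a b :
  (forall g, SO6 g -> tau g = Ad (T a b) (sigma u g)) ->
  (forall g, SO6 g -> tau' g = Ad (T (1 + a) (1 + b)) (sigma u g)) ->
  (exists2 z'', admissible u z z'' tau' & mexp (pi *: (z'' - z)) = T (1 + a) (1 + b)) ->
  corresponding u z tau phi Phi ->
  corresponding u z tau' (fun p => annih (phi p)) (fun p l => K *m Phi p l *m K^T).
Proof.
move=> tauE tauE' [z'' ad'' ET''] [ext alg [D dD PU] [z' ad' [c cO ident]]].
have KS := SO6_quarter hu; have KO := K_O6; have KK : K^T *m K = 1%:M := KO.
split.
- exact: extended_solution_conj.
- by move=> p; exact: Omega_alg_conj.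
- exists D => // p /PU[Pz [PO Ptau]]; split; first exact: U_conj.
  split; first exact: OmegaG_conj.
  move=> l lc; have [PS _ _] := PO.
  have lN : circle (- l) by rewrite /circle normrN.
  have N1 : circle (-1 : C) by rewrite /circle normrN normr1.
  have O1 := (PS _ N1).1; have Ol := (PS _ lN).1.
  have [_ i1] := O6_unit O1.
  have [_ i2] := O6_unit (O6M (O6M KO O1) (O6_tr KO)).
  have Sx : SO6 (Phi p (- l) *m (Phi p (-1))^T) by apply: SO6M; [exact: PS|exact/SO6_tr/PS].
  rewrite i2 !trmx_mul trmxK.
  have -> : K *m Phi p (- l) *m K^T *m (K *m ((Phi p (-1))^T *m K^T)) =
     K *m (Phi p (- l) *m (Phi p (-1))^T) *m K^T.
    by rewrite !mulmxA -(mulmxA _ K^T K) KK mulmx1.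
  have := Ptau _ lc; rewrite i1; move: Sx; move: (Phi p (- l) *m _) => x Sx.
  have SKx : SO6 (K *m x *m K^T) by apply: SO6M; [exact: SO6M|exact: SO6_tr].
  rewrite tauE// tauE'// !(Ad_O6 _ (T_O6 _ _)) !T_tr !(sigmaE hu) => <-.
  have e1 : T (1 + a) (1 + b) *m s0 u *m K = - (K *m (T a b *m s0 u)).
    by rewrite -(mexp_pi_zetaD hu) K_T_s0 mulmxA.
  have e2 : K^T *m s0 u *m T (1 + a) (1 + b) = - (s0 u *m T a b *m K^T).
    have := congr1 trmx e1.
    have trN (M : 'M[R]_6) : (- M)^T = - M^T by apply/matrixP => i j; rewrite !mxE.
    by rewrite trN !trmx_mul !T_tr (s0_tr hu) !mulmxA.
  move: (T (1 + a) (1 + b)) (T a b) K (s0 u) e1 e2 => A B k s e1 e2.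
  rewrite !mulmxA e1 -!mulmxA (mulmxA k^T) e2 !mulmxN mulNmx opprK !mulmxA.
  by [].
- exists z'' => //; exists (T 1 1 *m K *m c).
    by apply: O6M => //; apply: O6M => //; exact: T_O6.
  move=> p; have := identified_complement (admissible_mexp hu ad' tauE) ET'' (ident p).
  by rewrite -(act_annih _ cO) act_mul.
Qed.

End Complement.
Section ComplementHarmonic.
Variable R : realType.
Local Notation C := R[i].
Variable u : 'I_3 -> 'cV[C]_6.
Hypothesis hu : isotropic_frame u.

Lemma corresponding_x0 z tau phi (Phi : sphere R -> C -> 'M[R]_6) : corresponding u z tau phi Phi ->
  exists h, forall p, O6 (h p) /\ phi p = act (h p) (x0 u).
Proof.
move=> [_ _ _ [z' _ [c cO ident]]].
have : forall p, exists h, O6 h /\ phi p = act h (x0 u).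
  move=> p; have [g gS [W _]] := ident p; exists (c^T *m g); split.
    by apply: O6M; [exact: O6_tr|have [] := gS].
  by rewrite -act_mul -W act_mul; have -> : c^T *m c = 1%:M := cO; rewrite act1.
by move=> /choice[h hP]; exists h.
Qed.

Lemma annih_act_x0 h : O6 h ->
  [/\ act h (x0 u) = colspace (h *m px u *m h^T),
      annih (act h (x0 u)) = colspace (1%:M - h *m px u *m h^T),
      annih (annih (act h (x0 u))) = act h (x0 u),
      oproj (annih (act h (x0 u))) = 1%:M - oproj (act h (x0 u)) &
      \dim (annih (act h (x0 u))) = \dim (act h (x0 u))].
Proof.
move=> hO; have hh : h^T *m h = 1%:M := hO.
have PT : (h *m px u *m h^T)^T = h *m px u *m h^T.
  by rewrite !trmx_mul trmxK (px_tr u) mulmxA.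
have PP : h *m px u *m h^T *m (h *m px u *m h^T) = h *m px u *m h^T.
  have := px_idem hu; move: (px u) => p pp.
  by rewrite !mulmxA -(mulmxA _ h^T h) hh mulmx1 -(mulmxA h p p) pp.
have E : act h (x0 u) = colspace (h *m px u *m h^T).
  have [hTu _] := O6_unit (O6_tr hO).
  by rewrite (x0E hu) act_colspace (colspace_mulr (h *m px u) hTu).
have QQ : (1%:M - h *m px u *m h^T) *m (1%:M - h *m px u *m h^T) = 1%:M - h *m px u *m h^T.
  by move: (h *m px u *m h^T) PP => P PP; rewrite mulmxBl !mulmxBr !mul1mx mulmx1 PP subrr subr0.
have QT : (1%:M - h *m px u *m h^T)^T = 1%:M - h *m px u *m h^T by rewrite trmxB trmx1 PT.
split => //.
- by rewrite E (annih_colspace PP) PT.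
- by rewrite E (annih_colspace PP) PT (annih_colspace QQ) QT opprB addrC subrK.
- by rewrite E (annih_colspace PP) PT (oproj_colspace QT QQ) (oproj_colspace PT PP).
- rewrite -(act_annih _ hO) -(act_swap_x0 hu) act_mul.
  by rewrite (dim_act _ (O6M hO (SO6_swap hu).1)) (dim_act _ hO).
Qed.

(** 1 - P is written in the affine form to which [smooth_affine] applies. *)
Lemma laplacian_opp (P : R * R -> 'M[R]_6) q : smooth setT P ->
  laplacian (fun q => 1%:M + (- 1%:M) *m P q *m 1%:M) q = - laplacian P q.
Proof.
move=> sP; rewrite /laplacian.
have D1 v : (fun q => 'D_v (fun q => 1%:M + (- 1%:M) *m P q *m 1%:M) q) =
            (fun q => 0 + (- 1%:M) *m 'D_v P q *m 1%:M).
  apply/funext => p; have [d _] := sP 1%N.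
  by have [_ ->] := derive_affine 1%:M (- 1%:M) 1%:M (d p v I); rewrite add0r.
have D2 v : 'D_v (fun q => 0 + (- 1%:M) *m 'D_v P q *m 1%:M) q = - 'D_v (fun q => 'D_v P q) q.
  have [_ /(_ v)[d _]] := sP 2%N.
  have [_ ->] := derive_affine 0 (- 1%:M) 1%:M (d q v I).
  by rewrite mulmx1 mulNmx mul1mx.
have D3 v : 'D_v (fun q => 'D_v (fun q => 1%:M + (- 1%:M) *m P q *m 1%:M) q) q =
            - 'D_v (fun q => 'D_v P q) q by rewrite (D1 v) (D2 v).
have := congr2 +%R (D3 (e_x R)) (D3 (e_y R)); rewrite -opprD; exact.
Qed.

(** The harmonic map equation for the projection P is invariant under P -> 1 - P. *)
Lemma harmonic_complement z tau phi (Phi : sphere R -> C -> 'M[R]_6) :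
  corresponding u z tau phi Phi -> harmonic_map phi ->
  harmonic_map (fun p => annih (phi p)) /\ forall p, phi p = annih (annih (phi p)).
Proof.
move=> /corresponding_x0[h hP] [dims harm]; split; last first.
  by move=> p; have [hO ->] := hP p; have [_ _ -> _ _] := annih_act_x0 hO.
split; first by move=> p; have [hO E] := hP p; have [_ _ _ _] := annih_act_x0 hO; rewrite -E dims.
move=> b P'; have [sP tP] := harm b.
pose P := fun q : R * R => oproj (phi (chart b (cx q))).
have P'E : P' = (fun q => 1%:M + (- 1%:M) *m P q *m 1%:M).
  apply/funext => q; rewrite /P' /P; have [hO E] := hP (chart b (cx q)).
  have [_ _ _ + _] := annih_act_x0 hO; rewrite -E => ->.
  by rewrite mulmx1 mulNmx mul1mx.
split; first by rewrite P'E; exact: smooth_affine.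
move=> q X XT; rewrite P'E (laplacian_opp _ sP) mulmx1 mulNmx mul1mx mulmxBr mulmxBl mulmx1 mul1mx => tX.
have tX' : X *m P q + P q *m X = X.
  move: (X *m P q) (P q *m X) tX => A B tX; apply: (addrI (X - A - B)).
  transitivity X; last rewrite -{1}tX; apply/matrixP => i j; rewrite !mxE; ring.
have t0 := tP q X XT tX'; rewrite mulNmx.
by rewrite -[X in \tr X]scaleN1r mxtraceZ t0 mulr0.
Qed.

End ComplementHarmonic.

(** * The loops of a class as Laurent polynomials *)

Section LaurentPolynomials.
Variable R : realType.
Local Notation C := R[i].

(** The angles j / n are at most 1, so that the cosine separates these points. *)
Definition circle_point (n j : nat) : C := expi (j%:R / n%:R : R).

Lemma circle_point_circle n j : circle (circle_point n j).
Proof. exact: expi_circle. Qed.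

Lemma circle_point_uniq n : uniq [seq circle_point n.+1 j | j <- iota 0 n.+1].
Proof.
rewrite map_inj_in_uniq ?iota_uniq// => i j; rewrite !mem_iota add0n => /= hi hj.
have bd k : (k < n.+1)%N -> k%:R / n.+1%:R \in `[0, (pi : R)].
  move=> kn; rewrite in_itv /= divr_ge0//=; apply: (@le_trans _ _ 1).
    by rewrite ler_pdivrMr ?ltr0Sn// mul1r ler_nat ltnW.
  by apply: le_trans (pi_ge2 R); rewrite ler1n.
rewrite /circle_point /expi => -[/(cos_inj (bd _ hi) (bd _ hj)) + _].
have n0 : n.+1%:R != 0 :> R by rewrite pnatr_eq0.
by move=> /(mulIf (invr_neq0 n0))/eqP; rewrite eqr_nat => /eqP.
Qed.

Lemma circle_poly_eq (p q : {poly C}) : (forall l, circle l -> p.[l] = q.[l]) -> p = q.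
Proof.
move=> pq; apply/eqP; rewrite -subr_eq0; apply/eqP.
apply: (@roots_geq_poly_eq0 _ _ [seq circle_point (size (p - q)).+1 j | j <- iota 0 (size (p - q)).+1]).
- apply/allP => _ /mapP[j _ ->]; rewrite /root !hornerE pq ?subrr//.
  exact: circle_point_circle.
- exact: circle_point_uniq.
- by rewrite size_map size_iota.
Qed.

Definition mxeval m n (l : C) (P : 'M[{poly C}]_(m, n)) : 'M[C]_(m, n) := map_mx (horner_eval l) P.

Lemma mxevalM m n p l (P : 'M[{poly C}]_(m, n)) (Q : 'M[{poly C}]_(n, p)) :
  mxeval l (P *m Q) = mxeval l P *m mxeval l Q.
Proof. exact: map_mxM. Qed.

Lemma mxeval_tr m n l (P : 'M[{poly C}]_(m, n)) : mxeval l P^T = (mxeval l P)^T.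
Proof. by apply/matrixP => i j; rewrite !mxE. Qed.

Lemma mxeval1 n l : mxeval l (1%:M : 'M[{poly C}]_n) = 1%:M.
Proof. by rewrite /mxeval map_mx1. Qed.

Lemma mxeval_monomials m n (N : nat) (A : nat -> 'M[C]_(m, n)) (e : nat -> nat) l :
  mxeval l (\sum_(k < N) \matrix_(i, j) (A k i j *: 'X^(e k))) = \sum_(k < N) l ^+ e k *: A k.
Proof.
apply/matrixP => i j; rewrite mxE !summxE /horner_eval horner_sum; apply: eq_bigr => k _.
by rewrite !mxE hornerZ hornerXn mulrC.
Qed.

Lemma mxeval_eq m n (P Q : 'M[{poly C}]_(m, n)) :
  (forall l, circle l -> mxeval l P = mxeval l Q) -> P = Q.
Proof.
move=> PQ; apply/matrixP => i j; apply: circle_poly_eq => l /PQ/matrixP/(_ i j).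
by rewrite !mxE.
Qed.

Definition mxcoef m n (k : nat) (P : 'M[{poly C}]_(m, n)) : 'M[C]_(m, n) := map_mx (coefp k) P.

Lemma mxeval_sum m n N (P : 'M[{poly C}]_(m, n)) l : (forall i j, size (P i j) <= N)%N ->
  mxeval l P = \sum_(k < N) l ^+ k *: mxcoef k P.
Proof.
move=> sP; apply/matrixP => i j; rewrite summxE !mxE /horner_eval (horner_coef_wide _ (sP i j)).
by apply: eq_bigr => k _; rewrite !mxE mulrC.
Qed.

Lemma size_bound m n (P : 'M[{poly C}]_(m, n)) : exists N, forall i j, (size (P i j) <= N)%N.
Proof.
exists (\max_i \max_j size (P i j)) => i j.
apply: leq_trans (leq_bigmax i); exact: (leq_bigmax j).
Qed.

Lemma circle_neq0 (l : C) : circle l -> l != 0.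
Proof. by rewrite /circle; apply: contra_eq_neq => ->; rewrite normr0 eq_sym oner_eq0. Qed.

Lemma laurentP (h : C -> 'M[C]_6) : laurent h <->
  exists N P, forall l, circle l -> l ^+ N *: h l = mxeval l P.
Proof.
split=> [[r [n [A hA]]]|[N [P hP]]].
  exists (absz r), (\sum_(k < n) \matrix_(i, j) ((A k i j) *: 'X^(absz ((absz r)%:Z + r + k%:Z)))) => l lc.
  rewrite hA// scaler_sumr (mxeval_monomials n A (fun k => absz ((absz r)%:Z + r + k%:Z))).
  apply: eq_bigr => k _; rewrite scalerA; congr (_ *: _).
  by rewrite !exprnP -expfzDr ?circle_neq0//; congr (_ ^ _); lia.
have [n sP] := size_bound P.
exists (- N%:Z), n, (fun k => mxcoef k P) => l lc.
have lN : l ^+ N != 0 by rewrite expf_neq0// circle_neq0.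
apply: (scalerI lN); rewrite hP// (mxeval_sum _ sP) scaler_sumr.
apply: eq_bigr => k _; rewrite scalerA; congr (_ *: _).
by rewrite !exprnP -expfzDr ?circle_neq0//; congr (_ ^ _); lia.
Qed.

Lemma laurent_prod (h g : C -> 'M[C]_6) : laurent h -> laurent g -> laurent (fun l => h l *m g l).
Proof.
move=> /laurentP[N [P hP]] /laurentP[M [Q gQ]]; apply/laurentP; exists (N + M)%N, (P *m Q) => l lc.
by rewrite mxevalM -hP// -gQ// -scalemxAl -scalemxAr scalerA exprD.
Qed.

Lemma laurent_tr (h : C -> 'M[C]_6) : laurent h -> laurent (fun l => (h l)^T).
Proof.
move=> /laurentP[N [P hP]]; apply/laurentP; exists N, P^T => l lc.
by rewrite mxeval_tr -hP// trmxZ.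
Qed.

Lemma laurent_eq (h g : C -> 'M[C]_6) : (forall l, circle l -> h l = g l) -> laurent h -> laurent g.
Proof. by move=> hg [r [n [A hA]]]; exists r, n, A => l lc; rewrite -hg// hA. Qed.

(** [disc_laurent_nonneg] applies to each entry. Orthogonality on the circle is an
identity between polynomials, hence holds at 0 as well. *)
Lemma laurent_disc_poly (h : C -> 'M[C]_6) : laurent h -> extends_to_disc h ->
  exists P, [/\ forall l, circle l -> h l = mxeval l P,
    P^T *m P = 1%:M & (mxeval 0 P)^T *m mxeval 0 P = 1%:M].
Proof.
move=> [r [n [A hA]]] [H [Hh dH cH SH]].
have A0 i j (k : 'I_n) : r + k%:Z < 0 -> A k i j = 0.
  move=> rk; apply: (@disc_laurent_nonneg _ (fun w => H w i j) r n (fun k => A k i j)) => //.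
  - move=> z z1; apply/(@derivable_cdiff _ (fun w : C^o => H w i j : C^o)); apply: dH.
    by rewrite /= normC_normc ltcR.
  - move=> z z1 e e0; have := cH i j.
    have z1' : [set l : C^o | `|l| <= 1] z by rewrite /= normC_normc lecR.
    move=> /subspace_continuousP/(_ z z1')/cvgrPdist_lt/(_ e%:C).
    rewrite ltcR => /(_ e0) /= nz.
    have [d d0 Hd] := (@nbhs_normcP _ z (fun w => [set l : C^o | `|l| <= 1] w -> `|(H z i j : C^o) - H w i j| < e%:C)).1 nz.
    exists d => // w w1 /Hd; rewrite /= normC_normc lecR => /(_ w1).
    by rewrite normC_normc ltcR normcB => /ltW.
  - move=> t; rewrite Hh ?hA; [|exact: expi_circle..].
    by rewrite summxE; apply: eq_bigr => l _; rewrite mxE.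
pose P : 'M[{poly C}]_6 := \sum_(k < n) \matrix_(i, j) ((A k i j) *: 'X^(absz (r + k%:Z))).
have hP l : circle l -> h l = mxeval l P.
  move=> lc; rewrite hA// (mxeval_monomials n A (fun k => absz (r + k%:Z))); apply: eq_bigr => k _.
  case: (ltP (r + k%:Z) 0) => rk.
    by apply/matrixP => i j; rewrite !mxE A0// !mulr0.
  by congr (_ *: _); rewrite exprnP; congr (_ ^ _); lia.
have PP : P^T *m P = 1%:M.
  apply: mxeval_eq => l lc; rewrite mxevalM mxeval_tr -hP// mxeval1 -Hh//.
  by have [] := SH l; first by rewrite lc.
exists P; split => //.
by rewrite -mxeval_tr -mxevalM PP mxeval1.
Qed.

End LaurentPolynomials.
Section LoopCoefficients.
Variable R : realType.
Local Notation C := R[i].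

Lemma conjc_circle (l : C) : circle l -> conjc l = l^-1.
Proof.
move=> lc; have [t <-] := circle_expi lc; rewrite -expiN.
by rewrite /expi cosN sinN.
Qed.

Lemma real_laurent_scalar a (q : {poly C}) :
  (forall l, circle l -> l ^+ a * conjc q.[l] = l ^- a * q.[l]) ->
  forall k, q`_k = if (k <= a.*2)%N then conjc q`_(a.*2 - k) else 0.
Proof.
move=> qR k; pose N := maxn (size q) a.*2.
pose p := \poly_(k < N.+1) conjc q`_(N - k).
have pq : 'X^N * q = 'X^(a.*2) * p.
  apply: circle_poly_eq => l lc; have l0 := circle_neq0 lc.
  rewrite !hornerM !hornerXn horner_poly -addnn exprD -mulrA.
  have -> : \sum_(i < N.+1) conjc q`_(N - i) * l ^+ i = l ^+ N * conjc q.[l].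
    rewrite (@horner_coef_wide _ N.+1); last by rewrite leqW// leq_maxl.
    rewrite (reindex_inj rev_ord_inj) rmorph_sum mulr_sumr; apply: eq_bigr => i _ /=.
    rewrite subSS subKn; last by rewrite -ltnS.
    rewrite [RHS]mulrC rmorphM rmorphXn /= (conjc_circle lc) -mulrA; congr (_ * _).
    have iN : (i <= N)%N by rewrite -ltnS.
    by apply: (mulfI (expf_neq0 i l0)); rewrite -exprD subnKC// exprVn mulVKf// expf_neq0.
  rewrite (mulrCA (l ^+ a) (l ^+ N)) qR// (mulrCA (l ^+ a) (l ^+ N)) mulVKf//.
  exact: expf_neq0.
have /(congr1 (fun r : {poly C} => r`_(N + k))) := pq.
rewrite !coefXnM coef_poly addKn ltnNge leq_addr /=.
have aN : (a.*2 <= N)%N by exact: leq_maxr.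
rewrite ltnNge (leq_trans aN (leq_addr _ _)) /= => ->.
have -> : (N + k - a.*2 < N.+1)%N = (k <= a.*2)%N by clearbody N; lia.
case: leqP => // ka; have -> // : (N - (N + k - a.*2) = a.*2 - k)%N by clearbody N; lia.
Qed.

(** For a real loop the conjugate of Q(l) is l ^ (-2a) Q(l) on the circle. So the
coefficients are conjugate symmetric about the degree a, and the degree is at most 2a. *)
Lemma real_laurent a (g : C -> 'M[R]_6) (Q : 'M[{poly C}]_6) :
  (forall l, circle l -> l ^+ a *: mxC (g l) = mxeval l Q) ->
  forall k, mxcoef k Q = if (k <= a.*2)%N then mxconj (mxcoef (a.*2 - k) Q) else 0.
Proof.
move=> gQ k; apply/matrixP => i j.
have -> : (if (k <= a.*2)%N then mxconj (mxcoef (a.*2 - k) Q) else 0) i j =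
  (if (k <= a.*2)%N then conjc (Q i j)`_(a.*2 - k) else 0) by case: leqP; rewrite !mxE.
rewrite mxE; apply: real_laurent_scalar => l lc.
have l0 : l ^+ a != 0 by rewrite expf_neq0// circle_neq0.
have /matrixP/(_ i j) := gQ l lc; rewrite !mxE /horner_eval => <-.
rewrite mulKf// rmorphM rmorphXn /= (conjc_circle lc) exprVn mulVKf//.
exact: conjc_real.
Qed.

(** The index k stands for the power l ^ (k - 2): all the classes then share the same
range of five coefficients. *)
Lemma five_coef a (g : C -> 'M[R]_6) (Q : 'M[{poly C}]_6) : (a <= 2)%N ->
  (forall l, circle l -> l ^+ a *: mxC (g l) = mxeval l Q) ->
  exists B : nat -> 'M[C]_6,
  [/\ forall l, circle l -> mxC (g l) = l ^- 2 *: \sum_(k < 5) l ^+ k *: B k,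
      forall k, (k < 5)%N -> mxconj (B k) = B (4 - k)%N,
      forall k, (k < 2 - a)%N -> B k = 0 &
      B (2 - a)%N = mxcoef 0 Q].
Proof.
move=> a2 gQ; have cQ := real_laurent gQ.
pose B k := if (k < 2 - a)%N then 0 else mxcoef (k - (2 - a)) Q.
have sQ i j : (size (Q i j) <= a.*2.+1)%N.
  apply/leq_sizeP => k ak; have /matrixP/(_ i j) := cQ k.
  by rewrite leqNgt ak /= !mxE.
exists B; split.
- move=> l lc; have l0 := circle_neq0 lc.
  apply: (scalerI (expf_neq0 a l0)); rewrite gQ// (mxeval_sum _ sQ) !scaler_sumr.
  rewrite -(big_mkord xpredT (fun k => l ^+ k *: mxcoef k Q)).
  rewrite -(big_mkord xpredT (fun k => l ^+ a *: (l ^- 2 *: (l ^+ k *: B k)))).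
  rewrite [RHS](big_cat_nat (n := (2 - a) + a.*2.+1))//=; last by lia.
  rewrite [X in _ = X + _](big_cat_nat (n := 2 - a))//=; last by rewrite leq_addr.
  rewrite [X in _ = X + _ + _]big1_seq ?add0r; last first.
    by move=> k; rewrite mem_index_iota => /= ka; rewrite /B ka !scaler0.
  rewrite [X in _ = _ + X]big1_seq ?addr0; last first.
    move=> k; rewrite mem_index_iota => /= /andP[ka kc]; rewrite /B ltnNge (leq_trans _ ka) ?leq_addr//=.
    rewrite cQ leqNgt; have -> : (a.*2 < k - (2 - a))%N by lia.
    by rewrite !scaler0.
  rewrite -[X in index_iota X (_ + _)]add0n big_addn addKn; apply: eq_big_nat => k _.
  rewrite /B ltnNge leq_addl /= addnK !scalerA; congr (_ *: _).
  apply: (mulfI (expf_neq0 2 l0)); rewrite [RHS]mulrA [X in _ = X * _]mulrC divfK ?expf_neq0//.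
  by rewrite -!exprD; congr (_ ^+ _); lia.
- move=> k k5; rewrite /B; case: ltnP => [ka|ka].
    rewrite mxconj0; case: ltnP => // _.
    rewrite cQ; case: leqP => // k2; exfalso; lia.
  have := cQ (k - (2 - a))%N; case: (leqP (k - (2 - a)) a.*2) => k2 ->.
    2: by rewrite mxconj0; case: ltnP => // ?; exfalso; lia.
  rewrite mxconjK; case: ltnP => k3; first by exfalso; lia.
  by congr mxcoef; lia.
- by move=> k ka; rewrite /B ka.
- by rewrite /B ltnn subnn.
Qed.

End LoopCoefficients.
Section LoopsOfAClass.
Variable R : realType.
Local Notation C := R[i].
Variable u : 'I_3 -> 'cV[C]_6.
Hypothesis hu : isotropic_frame u.
Local Notation cj := (@mxconj R 6 1).

Lemma mxevalD m n (l : C) (P Q : 'M[{poly C}]_(m, n)) : mxeval l (P + Q) = mxeval l P + mxeval l Q.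
Proof. by apply/matrixP => i j; rewrite !mxE /horner_eval hornerD. Qed.

Lemma mxeval0 m n (l : C) : mxeval l (0 : 'M[{poly C}]_(m, n)) = 0.
Proof. by apply/matrixP => i j; rewrite !mxE /horner_eval horner0. Qed.

Lemma mxeval_monomial m n (l : C) (A : 'M[C]_(m, n)) (e : nat) :
  mxeval l (\matrix_(i, j) (A i j *: 'X^e)) = l ^+ e *: A.
Proof. by apply/matrixP => i j; rewrite !mxE /horner_eval hornerZ hornerXn mulrC. Qed.

Lemma mxeval_coef0 m n (P : 'M[{poly C}]_(m, n)) : mxcoef 0 P = mxeval 0 P.
Proof. by apply/matrixP => i j; rewrite !mxE /horner_eval horner_coef0. Qed.

Lemma mxC_tdiag (d : 'I_3 -> C) : mxC (tdiag u d) =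
  \sum_j (d j *: (u j *m (cj (u j))^T) + conjc (d j) *: (cj (u j) *m (u j)^T)).
Proof.
rewrite tdiag_sum (big_morph _ (@mxCD _ _ _) (@mxC0 _ _ _)); apply: eq_bigr => j _.
exact: mxC_unit_op.
Qed.

(** The coefficient of l ^ (-a), the lowest power in gamma. *)
Definition top_part a b : 'M[C]_6 :=
  \sum_j (weight a b j == a)%:R *: (cj (u j) *m (u j)^T).

Lemma gamma_poly a b : (b <= a)%N -> (0 < a)%N -> exists G : 'M[{poly C}]_6,
  (forall l, circle l -> l ^+ a *: mxC (gamma (zeta u a b) l) = mxeval l G) /\
  mxeval 0 G = top_part a b.
Proof.
move=> ba a0.
have wa j : (weight a b j <= a)%N by rewrite /weight; case: ifP => // _; case: ifP.
pose G : 'M[{poly C}]_6 := \sum_j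
  ((\matrix_(i, k) ((u j *m (cj (u j))^T) i k *: 'X^(a + weight a b j))) +
   (\matrix_(i, k) ((cj (u j) *m (u j)^T) i k *: 'X^(a - weight a b j)))).
have GE l : mxeval l G = \sum_j (l ^+ (a + weight a b j) *: (u j *m (cj (u j))^T) +
    l ^+ (a - weight a b j) *: (cj (u j) *m (u j)^T)).
  rewrite /G (big_morph _ (@mxevalD _ _ l) (@mxeval0 _ _ l)); apply: eq_bigr => j _.
  by rewrite mxevalD !mxeval_monomial.
exists G; split => [l lc|].
  rewrite GE (gamma_zeta hu)// mxC_tdiag scaler_sumr; apply: eq_bigr => j _.
  have l0 := circle_neq0 lc.
  rewrite scalerDr !scalerA -exprD rmorphXn /= conjc_circle//; congr (_ + _ *: _).
  apply: (mulIf (expf_neq0 (weight a b j) l0)).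
  by rewrite exprVn divfK ?expf_neq0// -exprD subnK.
rewrite GE; apply: eq_bigr => j _.
have -> : (weight a b j == a) = (a <= weight a b j)%N by have := wa j; lia.
rewrite !expr0n addn_eq0 subn_eq0.
by move: a0; rewrite lt0n => /negPf ->; rewrite scale0r add0r.
Qed.

(** The positive Iwasawa factor of an algebraic loop is the product g^T h gamma of
Laurent polynomials. *)
Lemma Lambda_plus_laurent (g : C -> 'M[R]_6) z (h f : C -> 'M[C]_6) : laurent h -> Omega_alg g ->
  laurent (fun l => mxC (gamma z l)) ->
  (forall l, circle l -> h l *m mxC (gamma z l) = mxC (g l) *m f l) -> laurent f.
Proof.
move=> lh [[gS _ _] lg] lz E.
apply: (laurent_eq _ (laurent_prod (laurent_tr lg) (laurent_prod lh lz))) => l lc.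
have [gg _] := gS l lc.
by rewrite E// mulmxA -mxC_tr -mxCM gg mxC1 mul1mx.
Qed.

(** In g = h gamma f^-1 the factors h and f are polynomials in l, still orthogonal at
l = 0; hence g has the same lowest power as gamma, with coefficient h(0) M f(0)^T
where M is that of gamma. *)
Lemma U_coef a b (g : C -> 'M[R]_6) : (b <= a <= 2)%N -> (0 < a)%N -> Omega_alg g -> U_ (zeta u a b) g ->
  exists B : nat -> 'M[C]_6,
  [/\ forall l, circle l -> mxC (g l) = l ^- 2 *: \sum_(k < 5) l ^+ k *: B k,
      forall k, (k < 5)%N -> mxconj (B k) = B (4 - k)%N,
      forall k, (k < 2 - a)%N -> B k = 0 &
      exists h f, [/\ h^T *m h = 1%:M, f^T *m f = 1%:M & B (2 - a)%N = h *m top_part a b *m f^T]].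
Proof.
move=> /andP[ba a2] a0 gA [h [lh dh] [gO [f [_ df] E]]].
have [G [GE G0]] := gamma_poly ba a0.
have lG : laurent (fun l => mxC (gamma (zeta u a b) l)) by apply/laurentP; exists a, G.
have lf := Lambda_plus_laurent lh gA lG E.
have [P [hP PP P0]] := laurent_disc_poly lh dh.
have [F [fF FF F0]] := laurent_disc_poly lf df.
have FF' := mulmx1C FF.
have QE l : circle l -> l ^+ a *: mxC (g l) = mxeval l (P *m G *m F^T).
  move=> lc; rewrite !mxevalM -hP// -GE// -scalemxAr -scalemxAl E// fF//.
  by rewrite -mulmxA -mxevalM FF' mxeval1 mulmx1.
have [B [B1 B2 B3 B4]] := five_coef a2 QE.
exists B; split => //.
exists (mxeval 0 P), (mxeval 0 F); split => //.
by rewrite B4 mxeval_coef0 !mxevalM mxeval_tr G0.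
Qed.

End LoopsOfAClass.

(** * Regularity of the coefficients on the sphere *)

Section SphereContinuity.
Variable R : realType.
Local Notation C := R[i].

Definition scont (f : sphere R -> C) : Prop :=
  forall b, continuous (fun w : C^o => f (chart b w) : C^o).

Definition mcont m n (F : sphere R -> 'M[C]_(m, n)) : Prop := forall i j, scont (fun p => F p i j).

Lemma cvg_normcP (f : C^o -> C^o) (z l : C^o) : f w @[w --> z] --> l <->
  forall e : R, 0 < e -> exists2 d : R, 0 < d & forall w : C, normc (w - z) < d -> normc (f w - l) < e.
Proof.
split=> [fl e e0|H A /nbhs_normcP[e e0 eA]].
  have := fl [set x | normc (x - l) < e] ((@nbhs_normcP _ _ _).2 (ex_intro2 _ _ e e0 (fun _ => id))).
  by move=> /(@nbhs_normcP _ z (fun w => normc (f w - l) < e)).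
have [d d0 dH] := H e e0; apply/(@nbhs_normcP _ z (fun w => A (f w))); exists d => // w /dH.
exact: eA.
Qed.

Lemma scont_cst (c : C) : scont (fun=> c).
Proof. by move=> b; exact: (@cst_continuous C^o C^o c). Qed.

Lemma scontD (f g : sphere R -> C) : scont f -> scont g -> scont (fun p => f p + g p).
Proof. by move=> cf cg b w; exact: (cvgD (cf b w) (cg b w)). Qed.

Lemma scontM (f g : sphere R -> C) : scont f -> scont g -> scont (fun p => f p * g p).
Proof. by move=> cf cg b w; exact: (cvgM (cf b w) (cg b w)). Qed.

Lemma scont_sum (I : Type) (r : seq I) (f : I -> sphere R -> C) :
  (forall i, scont (f i)) -> scont (fun p => \sum_(i <- r) f i p).
Proof.
move=> cf; elim: r => [|i r IH].
  have -> : (fun p => \sum_(i <- [::]) f i p) = (fun=> 0) by apply/funext => p; rewrite big_nil.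
  exact: scont_cst.
have -> : (fun p => \sum_(j <- i :: r) f j p) = (fun p => f i p + \sum_(j <- r) f j p).
  by apply/funext => p; rewrite big_cons.
exact: (scontD (cf i) IH).
Qed.

Lemma scont_conj (f : sphere R -> C) : scont f -> scont (fun p => conjc (f p)).
Proof.
move=> cf b z; apply/cvg_normcP => e e0.
have /cvg_normcP/(_ e e0)[d d0 H] := cf b z; exists d => // w /H; rewrite -rmorphB /=.
by case: (_ - _) => x y; rewrite /= sqrrN.
Qed.

Lemma mcont_cst m n (M : 'M[C]_(m, n)) : mcont (fun=> M).
Proof. by move=> i j; exact: scont_cst. Qed.

Lemma mcontM m n k (F : sphere R -> 'M[C]_(m, n)) (G : sphere R -> 'M[C]_(n, k)) :
  mcont F -> mcont G -> mcont (fun p => F p *m G p).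
Proof.
move=> cF cG i j; have -> : (fun p => (F p *m G p) i j) = (fun p => \sum_k F p i k * G p k j).
  by apply/funext => p; rewrite mxE.
apply: (@scont_sum _ _ (fun k p => F p i k * G p k j)) => l.
exact: (scontM (cF i l) (cG l j)).
Qed.

Lemma mcontZ m n (a : C) (F : sphere R -> 'M[C]_(m, n)) : mcont F -> mcont (fun p => a *: F p).
Proof.
move=> cF i j; have -> : (fun p => (a *: F p) i j) = (fun p => a * F p i j).
  by apply/funext => p; rewrite mxE.
exact: (scontM (@scont_cst a) (cF i j)).
Qed.

Lemma mcont_sum m n (I : Type) (r : seq I) (F : I -> sphere R -> 'M[C]_(m, n)) :
  (forall i, mcont (F i)) -> mcont (fun p => \sum_(i <- r) F i p).
Proof.
move=> cF i j; have -> : (fun p => (\sum_(i <- r) F i p) i j) = (fun p => \sum_(l <- r) F l p i j).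
  by apply/funext => p; rewrite summxE.
by apply: (@scont_sum _ _ (fun l p => F l p i j)) => l; exact: cF.
Qed.

Lemma mcont_conj m n (F : sphere R -> 'M[C]_(m, n)) : mcont F -> mcont (fun p => mxconj (F p)).
Proof.
move=> cF i j; have -> : (fun p => mxconj (F p) i j) = (fun p => conjc (F p i j)).
  by apply/funext => p; rewrite mxE.
exact: (scont_conj (cF i j)).
Qed.

Lemma mcont_tr m n (F : sphere R -> 'M[C]_(m, n)) : mcont F -> mcont (fun p => (F p)^T).
Proof.
move=> cF i j; have -> : (fun p => (F p)^T i j) = (fun p => F p j i).
  by apply/funext => p; rewrite mxE.
exact: cF.
Qed.

Lemma scont_trace n (F : sphere R -> 'M[C]_n) : mcont F -> scont (fun p => \tr (F p)).
Proof. by move=> cF; apply: (@scont_sum _ _ (fun i p => F p i i)) => i; exact: cF. Qed.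

Lemma sphere_chart (p : sphere R) : exists b z, p = chart b z.
Proof.
case: p => [z|]; first by exists false, z.
by exists true, 0; rewrite /chart eqxx.
Qed.

Lemma dnbhs_ex (z : C^o) (P : set C^o) : (\forall w \near z^', P w) -> exists w, P w.
Proof. by move=> /(@filter_ex _ _ _)[w]; exists w. Qed.

Lemma discrete_ex (D : set (sphere R)) : discrete_set D -> exists p, ~ D p.
Proof. by move=> /(_ false 0)/dnbhs_ex[w nD]; exists (chart false w). Qed.

(** The complement of a discrete set is dense. *)
Lemma scont_ext (D : set (sphere R)) (f g : sphere R -> C) : discrete_set D -> scont f -> scont g ->
  (forall p, ~ D p -> f p = g p) -> forall p, f p = g p.
Proof.
move=> dD cf cg fg p; have [b [z ->]] := sphere_chart p.
have cf' : (f (chart b w) : C^o) @[w --> (z : C^o)^'] --> (f (chart b z) : C^o).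
  by apply: cvg_within_filter; exact: cf.
have cg' : (g (chart b w) : C^o) @[w --> (z : C^o)^'] --> (g (chart b z) : C^o).
  by apply: cvg_within_filter; exact: cg.
apply: (cvg_unique (@norm_hausdorff _ _) cf').
apply: cvg_trans cg'; apply: near_eq_cvg.
by apply: filterS (dD b z) => w nD; rewrite fg.
Qed.

Lemma mcont_ext m n (D : set (sphere R)) (F G : sphere R -> 'M[C]_(m, n)) :
  discrete_set D -> mcont F -> mcont G ->
  (forall p, ~ D p -> F p = G p) -> forall p, F p = G p.
Proof.
move=> dD cF cG FG p; apply/matrixP => i j.
by apply: (scont_ext dD (cF i j) (cG i j)) => q nD; rewrite FG.
Qed.

Definition bsmooth m n (F : sphere R -> 'M[C]_(m.+1, n.+1)) : Prop :=
  forall b, csmooth setT (fun q : R * R => F (chart b (cx q))).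

Lemma bsmooth_mcont m n (F : sphere R -> 'M[C]_(m.+1, n.+1)) : bsmooth F -> mcont F.
Proof.
move=> sF i j b z; have [/(_ 0%N)/(_ (pt z) I) cR /(_ 0%N)/(_ (pt z) I) cI] := sF b.
have cR' : (mxRe (F (chart b w)) i j) @[w --> (z : C^o)] --> mxRe (F (chart b z)) i j.
  have := cvg_comp _ _ (@cvg_pt R z) (cvg_comp _ _ cR (@coord_continuous R _ _ i j _)).
  rewrite ptK => H.
  have -> : (fun w : C^o => mxRe (F (chart b w)) i j) = (fun w => mxRe (F (chart b (cx (pt w)))) i j).
    by apply/funext => w; rewrite ptK.
  exact: H.
have cI' : (mxIm (F (chart b w)) i j) @[w --> (z : C^o)] --> mxIm (F (chart b z)) i j.
  have := cvg_comp _ _ (@cvg_pt R z) (cvg_comp _ _ cI (@coord_continuous R _ _ i j _)).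
  rewrite ptK => H.
  have -> : (fun w : C^o => mxIm (F (chart b w)) i j) = (fun w => mxIm (F (chart b (cx (pt w)))) i j).
    by apply/funext => w; rewrite ptK.
  exact: H.
apply/cvg_normcP => e e0.
have r0 : 0 < e / 2 by rewrite divr_gt0.
have /cvgrPdist_lt/(_ _ r0) H1 := cR'; have /cvgrPdist_lt/(_ _ r0) H2 := cI'.
apply/(@nbhs_normcP _ z (fun w => normc (F (chart b w) i j - F (chart b z) i j) < e)).
apply: filterS2 H1 H2 => w; rewrite !mxE.
move: (F (chart b z) i j) (F (chart b w) i j) => [x y] [x' y'] /= h1 h2.
have := normc_le (x' - x) (y' - y); rewrite distrC in h1; rewrite distrC in h2.
by move=> /= /le_lt_trans; apply; lra.
Qed.

End SphereContinuity.
Section SmoothCoefficients.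
Variable R : realType.
Local Notation C := R[i].

Lemma CkD (V : normedModType R) (m n : nat) k (f g : V -> 'M[R]_(m.+1, n.+1)) :
  Ck k setT f -> Ck k setT g -> Ck k setT (fun x => f x + g x).
Proof.
elim: k f g => [|k IH] f g /=; first by move=> cf cg x _; exact: (cvgD (cf x I) (cg x I)).
move=> [df Df] [dg Dg]; split=> [x v _|v].
  by have [] := derive_addmx (df x v I) (dg x v I).
have -> : (fun x => 'D_v (fun x => f x + g x) x) = (fun x => 'D_v f x + 'D_v g x).
  by apply/funext => x; have [_ ->] := derive_addmx (df x v I) (dg x v I).
exact: (IH _ _ (Df v) (Dg v)).
Qed.

Lemma bsmoothD m n (F G : sphere R -> 'M[C]_(m.+1, n.+1)) :
  bsmooth F -> bsmooth G -> bsmooth (fun p => F p + G p).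
Proof.
move=> sF sG b; have [sR sI] := sF b; have [tR tI] := sG b; split => k.
  have -> : (fun q => mxRe (F (chart b (cx q)) + G (chart b (cx q)))) =
      (fun q => mxRe (F (chart b (cx q))) + mxRe (G (chart b (cx q)))).
    by apply/funext => q; rewrite mxReD.
  exact: (CkD (sR k) (tR k)).
have -> : (fun q => mxIm (F (chart b (cx q)) + G (chart b (cx q)))) =
    (fun q => mxIm (F (chart b (cx q))) + mxIm (G (chart b (cx q)))).
  by apply/funext => q; rewrite mxImD.
exact: (CkD (sI k) (tI k)).
Qed.

Lemma bsmooth_mulr m n p (F : sphere R -> 'M[C]_(m.+1, n.+1)) (K : 'M[C]_(n.+1, p.+1)) :
  bsmooth F -> bsmooth (fun q => F q *m K).
Proof.
move=> sF b; have [sR sI] := sF b; split => k.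
  have -> : (fun q => mxRe (F (chart b (cx q)) *m K)) =
      (fun q => (1%:M *m mxRe (F (chart b (cx q))) *m mxRe K) +
        ((- 1%:M) *m mxIm (F (chart b (cx q))) *m mxIm K)).
    by apply/funext => q; rewrite mxReM mul1mx !mulNmx mul1mx.
  exact: (CkD (smooth_sandwich _ _ sR k) (smooth_sandwich _ _ sI k)).
have -> : (fun q => mxIm (F (chart b (cx q)) *m K)) =
    (fun q => (1%:M *m mxRe (F (chart b (cx q))) *m mxIm K) +
      (1%:M *m mxIm (F (chart b (cx q))) *m mxRe K)).
  by apply/funext => q; rewrite mxImM !mul1mx.
exact: (CkD (smooth_sandwich _ _ sR k) (smooth_sandwich _ _ sI k)).
Qed.

Lemma bsmoothZ m n (a : C) (F : sphere R -> 'M[C]_(m.+1, n.+1)) :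
  bsmooth F -> bsmooth (fun q => a *: F q).
Proof.
move=> sF; have -> : (fun q => a *: F q) = (fun q => F q *m a%:M).
  by apply/funext => q; rewrite mul_mx_scalar.
exact: bsmooth_mulr.
Qed.

Lemma bsmooth_cst m n (M : 'M[C]_(m.+1, n.+1)) : bsmooth (fun=> M).
Proof.
by move=> b; split => k; elim: k (mxRe M) (mxIm M) => [|k IH] A B /=;
  [move=> x _; exact: cst_continuous| |move=> x _; exact: cst_continuous|];
  split=> [x v _|v]; first [exact: derivable_cst |
    (under [fun x => _]funext do rewrite derive_cst); exact: (IH 0 0)].
Qed.

Lemma bsmooth_sum m n (I : Type) (r : seq I) (F : I -> sphere R -> 'M[C]_(m.+1, n.+1)) :
  (forall i, bsmooth (F i)) -> bsmooth (fun q => \sum_(i <- r) F i q).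
Proof.
move=> sF; elim: r => [|i r IH].
  have -> : (fun p => \sum_(i <- [::]) F i p) = (fun=> 0) by apply/funext => p; rewrite big_nil.
  exact: bsmooth_cst.
have -> : (fun p => \sum_(j <- i :: r) F j p) = (fun p => F i p + \sum_(j <- r) F j p).
  by apply/funext => p; rewrite big_cons.
exact: (bsmoothD (sF i) IH).
Qed.

Lemma bsmooth_pdiff2 m n (F : sphere R -> 'M[C]_(m.+1, n.+1)) : bsmooth F ->
  forall b z, pdiff2 (fun w => F (chart b w)) z.
Proof.
move=> sF b z; have [/(_ 1%N)[dR _] /(_ 1%N)[dI _]] := sF b.
by split; split; [exact: dR|exact: dI|exact: dR|exact: dI].
Qed.

Lemma bsmooth_slice (Phi : sphere R -> C -> 'M[R]_6) : extended_solution Phi ->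
  forall l, circle l -> bsmooth (fun p => mxC (Phi p l)).
Proof.
move=> Pe l lc b; split.
  have -> : (fun q : R * R => mxRe (mxC (Phi (chart b (cx q)) l))) = (fun q => Phi (chart b (cx q)) l).
    by apply/funext => q; rewrite mxRe_C.
  exact: extended_solution_slice.
have -> : (fun q : R * R => mxIm (mxC (Phi (chart b (cx q)) l))) = (fun=> 0).
  by apply/funext => q; rewrite mxIm_mxC.
by have [] := @bsmooth_cst 5 5 (mxC 0) b; rewrite mxRe_C.
Qed.

Definition node (j : nat) : C := circle_point R 5 j.

Definition vand : 'M[C]_5 := Vandermonde 5 (\row_j node j).

Lemma vand_unit : vand \in unitmx.
Proof.
rewrite unitmxE unitfE det_Vandermonde; apply/prodf_neq0 => i _; apply/prodf_neq0 => j ij.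
rewrite !mxE subr_eq0; apply/eqP => eij.
have /(uniqP 0)/(_ i j) := circle_point_uniq R 4.
rewrite !inE size_map size_iota !(nth_map 0%N) ?size_iota// !nth_iota// !add0n => /(_ (ltn_ord i) (ltn_ord j)).
by move=> H; move: ij; rewrite (H (esym eij)) ltnn.
Qed.

(** The coefficient of l ^ (k - 2), by interpolation at five points of the circle. Being a
fixed linear combination of values of the loop, it is as regular as they are. *)
Definition cf (g : C -> 'M[R]_6) (k : nat) : 'M[C]_6 :=
  \sum_(j < 5) (node j ^+ 2 * invmx vand j (inord k)) *: mxC (g (node j)).

Lemma cfE g (B : nat -> 'M[C]_6) :
  (forall l, circle l -> mxC (g l) = l ^- 2 *: \sum_(k < 5) l ^+ k *: B k) ->
  forall k, (k < 5)%N -> cf g k = B k.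
Proof.
move=> gB k k5; rewrite /cf.
transitivity (\sum_(j < 5) \sum_(i < 5) (vand i j * invmx vand j (inord k)) *: B i).
  apply: eq_bigr => j _; have nc : circle (node j) by exact: circle_point_circle.
  rewrite gB// !scalerA scaler_sumr; apply: eq_bigr => i _.
  rewrite scalerA !mxE mulrC; congr (_ *: _).
  congr (_ * _); rewrite mulrC mulKf// expf_neq0//; exact: circle_neq0.
rewrite exchange_big /= (bigD1 (inord k)) //= [X in _ + X]big1 ?addr0.
  rewrite -scaler_suml.
  have := congr1 (fun M : 'M[C]_5 => M (inord k) (inord k)) (mulmxV vand_unit).
  by rewrite !mxE eqxx => ->; rewrite scale1r inordK.
move=> i ik; rewrite -scaler_suml.
have := congr1 (fun M : 'M[C]_5 => M i (inord k)) (mulmxV vand_unit).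
by rewrite !mxE (negPf ik) => ->; rewrite scale0r.
Qed.

Lemma bsmooth_cf (Phi : sphere R -> C -> 'M[R]_6) : extended_solution Phi ->
  forall k, bsmooth (fun p => cf (Phi p) k).
Proof.
move=> Pe k; apply: (@bsmooth_sum _ _ _ _ (fun (j : 'I_5) p =>
  (node j ^+ 2 * invmx vand j (inord k)) *: mxC (Phi p (node j)))) => j.
apply: (@bsmoothZ _ _ _ (fun p => mxC (Phi p (node j)))).
by apply: bsmooth_slice => //; exact: circle_point_circle.
Qed.

End SmoothCoefficients.

(** * The equations for the coefficients *)

Section CircleCoefficients.
Variable R : realType.
Local Notation C := R[i].

Lemma mxcoef_monomials m n (N : nat) (A : nat -> 'M[C]_(m, n)) k :
  mxcoef k (\sum_(i < N) \matrix_(r, s) (A i r s *: 'X^i)) = if (k < N)%N then A k else 0.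
Proof.
apply/matrixP => r s; rewrite mxE summxE /= coef_sum.
under eq_bigr do rewrite mxE coefZ coefXn.
case: ltnP => kN; last first.
  rewrite mxE big1// => i _; case: eqP => [ki|_]; last by rewrite mulr0.
  by have := ltn_ord i; rewrite -ki ltnNge kN.
rewrite (bigD1 (Ordinal kN)) //= eqxx mulr1 big1 ?addr0// => i ik.
by rewrite eq_sym -(inj_eq val_inj) /= in ik; rewrite (negPf ik) mulr0.
Qed.

Lemma circle_coef m n (N : nat) (A B : nat -> 'M[C]_(m, n)) :
  (forall l, circle l -> \sum_(k < N) l ^+ k *: A k = \sum_(k < N) l ^+ k *: B k) ->
  forall k, (k < N)%N -> A k = B k.
Proof.
move=> AB k kN; have := mxcoef_monomials N A k; rewrite kN => <-.
have := mxcoef_monomials N B k; rewrite kN => <-.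
congr mxcoef; apply: mxeval_eq => l lc.
by rewrite (mxeval_monomials N A id) (mxeval_monomials N B id) AB.
Qed.

(** The coefficients of l p(l) and of p(l), for p of degree at most 4, in a common range
of six indices: the equations multiply the expansion by 1 - l. *)
Definition up_shift (B : nat -> 'M[C]_6) k := if k is k'.+1 then B k' else 0.
Definition low_shift (B : nat -> 'M[C]_6) k := if (k < 5)%N then B k else 0.

Lemma up_shift_sum B l : \sum_(k < 6) l ^+ k *: up_shift B k = l *: \sum_(k < 5) l ^+ k *: B k.
Proof.
rewrite big_ord_recl scaler0 add0r scaler_sumr; apply: eq_bigr => k _.
by rewrite scalerA -exprS.
Qed.

Lemma low_shift_sum B l : \sum_(k < 6) l ^+ k *: low_shift B k = \sum_(k < 5) l ^+ k *: B k.
Proof.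
rewrite big_ord_recr /= scaler0 addr0; apply: eq_bigr => k _.
by rewrite /low_shift (ltn_ord k).
Qed.

Lemma half_diff_sum (E F : nat -> 'M[C]_6) (al : 'M[C]_6) (l : C) :
  \sum_(k < 6) l ^+ k *: (2^-1 *: ((E k - F k) *m al)) =
  2^-1 *: ((\sum_(k < 6) l ^+ k *: E k - \sum_(k < 6) l ^+ k *: F k) *m al).
Proof.
rewrite -sumrB mulmx_suml scaler_sumr; apply: eq_bigr => k _.
by rewrite -scalerBr -scalemxAl !scalerA mulrC.
Qed.

End CircleCoefficients.
Section ClassSolutions.
Variable R : realType.
Local Notation C := R[i].
Variable u : 'I_3 -> 'cV[C]_6.
Hypothesis hu : isotropic_frame u.
Local Notation cj := (@mxconj R 6 1).
Variables (a b : nat) (Phi : sphere R -> C -> 'M[R]_6) (D : set (sphere R)).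
Hypotheses (ba : (b <= a <= 2)%N) (a0 : (0 < a)%N).
Hypothesis Psol : extended_solution Phi.
Hypothesis Palg : forall p, Omega_alg (Phi p).
Hypothesis dD : discrete_set D.
Hypothesis PU : forall p, ~ D p -> U_ (zeta u a b) (Phi p).

Local Notation A k p := (cf (Phi p) k).

(** [U_coef] gives the expansion off the exceptional set, and continuity everywhere. *)
Lemma coef_five p l : circle l -> mxC (Phi p l) = l ^- 2 *: \sum_(k < 5) l ^+ k *: A k p.
Proof.
move=> lc; move: p; apply: (mcont_ext dD).
- by apply: bsmooth_mcont; exact: bsmooth_slice.
- apply: (@mcontZ _ _ _ _ (fun p => \sum_(k < 5) l ^+ k *: A k p)).
  apply: (@mcont_sum _ _ _ _ _ (fun (k : 'I_5) p => l ^+ k *: A k p)) => k.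
  by apply: (@mcontZ _ _ _ _ (fun p => A k p)); apply: bsmooth_mcont; exact: bsmooth_cf.
- move=> p nD; have [B [B1 _ _ _]] := U_coef hu ba a0 (Palg p) (PU nD).
  rewrite (B1 l lc); congr (_ *: _); apply: eq_bigr => k _.
  by rewrite (cfE B1).
Qed.

Lemma coef_conj p k : (k < 5)%N -> mxconj (A k p) = A (4 - k) p.
Proof.
move=> k5; move: p; apply: (mcont_ext dD).
- by apply: mcont_conj; apply: bsmooth_mcont; exact: bsmooth_cf.
- by apply: bsmooth_mcont; exact: bsmooth_cf.
- move=> p nD; have [B [B1 B2 _ _]] := U_coef hu ba a0 (Palg p) (PU nD).
  by rewrite !(cfE B1) ?B2// ltnS leq_subr.
Qed.

Lemma coef_low p k : (k < 2 - a)%N -> A k p = 0.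
Proof.
move=> ka; move: p; apply: (mcont_ext dD).
- by apply: bsmooth_mcont; exact: bsmooth_cf.
- exact: mcont_cst.
- move=> p nD; have [B [B1 _ B3 _]] := U_coef hu ba a0 (Palg p) (PU nD).
  rewrite (cfE B1) ?B3//; lia.
Qed.

Lemma coef_lowest p : ~ D p ->
  exists h f, [/\ h^T *m h = 1%:M, f^T *m f = 1%:M & A (2 - a) p = h *m top_part u a b *m f^T].
Proof.
move=> nD; have [B [B1 _ _ [h [f [hh ff E]]]]] := U_coef hu ba a0 (Palg p) (PU nD).
exists h, f; split => //; rewrite (cfE B1) ?E//; lia.
Qed.

Lemma top_partE i : top_part u a b *m cj (u i) = (weight a b i == a)%:R *: cj (u i).
Proof.
rewrite /top_part mulmx_suml (bigD1 i) //= big1 ?addr0 => [|j ji].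
  by rewrite -scalemxAl -mulmxA (frame_uc hu) eqxx mul_mx_scalar scale1r.
by rewrite -scalemxAl -mulmxA (frame_uc hu) (negPf ji) mul_mx_scalar scale0r scaler0.
Qed.

Lemma top_part_neq0 : top_part u a b <> 0.
Proof.
move=> t0; have := top_partE 0; rewrite t0 mul0mx /weight eqxx eqxx scale1r.
move=> /(congr1 (mulmx (u 0)^T)); rewrite mulmx0 (frame_uc hu) eqxx.
by move=> /(congr1 (fun M : 'M[C]_1 => M 0 0)); rewrite !mxE /= => /eqP; rewrite eq_sym oner_eq0.
Qed.

(** The lowest coefficient does not vanish off the exceptional set, by [coef_lowest], and
the highest is its conjugate. *)
Lemma class_uniton_number : uniton_number Phi a.*2.
Proof.
have [p nD] := discrete_ex dD.
have Ap : A (2 - a) p <> 0.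
  have [h [f [hh ff ->]]] := coef_lowest nD => E; apply: top_part_neq0.
  have := congr1 (fun M => h^T *m M *m f) E.
  by rewrite mulmx0 mul0mx !mulmxA hh mul1mx -mulmxA ff mulmx1.
have Ap' : A (2 + a) p <> 0.
  have a2 : (a <= 2)%N by case/andP: ba.
  rewrite (_ : 2 + a = 4 - (2 - a))%N; last by lia.
  rewrite -coef_conj; last by lia.
  by move=> /(congr1 (@mxconj R 6 6)); rewrite mxconjK mxconj0.
exists (- a%:Z), (fun k p => A (2 - a + k)%N p); split.
- by exists p; rewrite addn0.
- by exists p; rewrite -addnn addnA subnK//; case/andP: ba.
- move=> q l lc; rewrite coef_five//; have l0 := circle_neq0 lc.
  have : a = 1%N \/ a = 2%N by move: a0 ba; case: (a) => [|[|[|n]]] //=; auto; rewrite andbC.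
  move=> [aE|aE].
    rewrite [in LHS]big_ord_recl [in LHS]big_ord_recr /= coef_low ?aE// scaler0 add0r.
    have -> : A (bump 0 3) q = 0.
      by rewrite (_ : bump 0 3 = 4 - 0)%N// -coef_conj// coef_low ?aE// mxconj0.
    rewrite scaler0 addr0 scaler_sumr; apply: eq_bigr => k _.
    rewrite /bump /= (_ : (2 - 1 + k = 1 + k)%N)// scalerA; congr (_ *: _).
    by rewrite exprnN (exprnP l (1 + k)) -expfzDr//; congr (_ ^ _); lia.
  rewrite aE scaler_sumr; apply: eq_bigr => k _; rewrite add0n scalerA; congr (_ *: _).
  by rewrite expfzDr// exprnN.
Qed.
(** Multiplied by Phi, the equation of an extended solution is an identity between Laurent
polynomials in l, whose coefficients are compared. *)
Lemma coef_equations c : exists al be : C -> 'M[C]_6, forall z,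
  let B k := A k (chart c z) in
  (forall k, (k < 4)%N -> d_z (fun w => A k (chart c w)) z = 2^-1 *: ((B k - B k.+1) *m al z)) /\
  (forall k, (k < 5)%N -> d_zbar (fun w => A k (chart c w)) z =
     2^-1 *: ((B k - (if k is k'.+1 then B k' else 0)) *m be z)).
Proof.
have [_ /(_ c)[_ [ax [ay [_ _ eqn]]]]] := Psol.
exists (fun z => 2^-1 *: (mxC (ax z) - 'i%C *: mxC (ay z))).
exists (fun z => 2^-1 *: (mxC (ax z) + 'i%C *: mxC (ay z))) => z B.
move: (2^-1 *: (mxC (ax z) - 'i%C *: mxC (ay z))) (2^-1 *: (mxC (ax z) + 'i%C *: mxC (ay z)))
  (eqn z) => al be {}eqn.
pose dA k := d_z (fun w => A k (chart c w)) z.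
pose dB k := d_zbar (fun w => A k (chart c w)) z.
have dk k : pdiff2 (fun w => A k (chart c w)) z by apply: (@bsmooth_pdiff2 _ _ _ (fun p => A k p)); exact: bsmooth_cf.
have dPhi l : circle l ->
    d_z (fun w => mxC (Phi (chart c w) l)) z = l ^- 2 *: \sum_(k < 5) l ^+ k *: dA k /\
    d_zbar (fun w => mxC (Phi (chart c w) l)) z = l ^- 2 *: \sum_(k < 5) l ^+ k *: dB k.
  move=> lc.
  have -> : (fun w => mxC (Phi (chart c w) l)) =
      (fun w => l ^- 2 *: \sum_(k < 5) l ^+ k *: A k (chart c w)).
    by apply/funext => w; rewrite coef_five.
  have dlk (k : 'I_5) := pdiff2Z (l ^+ k) (dk k).
  have [|ds Es1 Es2] := @pdiff2_sum R 5 5 'I_5 (index_enum 'I_5) (fun k w => l ^+ k *: A k (chart c w)) z.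
    by move=> k; have [] := dlk k.
  have [_ -> ->] := pdiff2Z (l ^- 2) ds; rewrite Es1 Es2.
  by split; congr (_ *: _); apply: eq_bigr => k _; have [] := dlk k.
have inv l : circle l -> mxC (Phi (chart c z) l) \in unitmx.
  move=> lc; have [[+ _ _] _] := Palg (chart c z) => /(_ l lc)[/O6_unit[uP _] _].
  by rewrite map_unitmx.
have eq1 l : circle l -> \sum_(k < 5) l ^+ k *: dA k =
    (2^-1 * (1 - l^-1)) *: ((\sum_(k < 5) l ^+ k *: B k) *m al).
  move=> lc; have [E1 _] := eqn l lc; have [D1 _] := dPhi l lc.
  have l2 : l ^- 2 != 0 by rewrite invr_eq0 expf_neq0// circle_neq0.
  apply: (scalerI l2); rewrite -D1 -[LHS](mulKVmx (inv l lc)) E1 -scalemxAr.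
  by rewrite coef_five// -scalemxAl !scalerA [_ * l ^- 2]mulrC.
have eq2 l : circle l -> \sum_(k < 5) l ^+ k *: dB k =
    (2^-1 * (1 - l)) *: ((\sum_(k < 5) l ^+ k *: B k) *m be).
  move=> lc; have [_ E1] := eqn l lc; have [_ D1] := dPhi l lc.
  have l2 : l ^- 2 != 0 by rewrite invr_eq0 expf_neq0// circle_neq0.
  apply: (scalerI l2); rewrite -D1 -[LHS](mulKVmx (inv l lc)) E1 -scalemxAr.
  by rewrite coef_five// -scalemxAl !scalerA [_ * l ^- 2]mulrC.
split=> k k5.
  pose d k := if k is k'.+1 then dA k' else 0.
  suff H : forall m, (m < 6)%N -> d m = 2^-1 *: ((up_shift B m - low_shift B m) *m al).
    have k6 : (k.+1 < 6)%N by rewrite ltnS ltnW// ltnS.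
    by have := H k.+1 k6; rewrite /d /up_shift /low_shift ltnS k5; exact.
  apply: circle_coef => l lc.
  have -> : \sum_(m < 6) l ^+ m *: d m = l *: \sum_(k < 5) l ^+ k *: dA k.
    exact: (up_shift_sum dA).
  rewrite eq1// scalerA mulrCA mulrBr mulr1 mulfV ?circle_neq0//.
  rewrite half_diff_sum up_shift_sum low_shift_sum -scalerA; congr (_ *: _).
  by rewrite scalemxAl scalerBl scale1r.
suff H : forall m, (m < 6)%N -> low_shift dB m = 2^-1 *: ((low_shift B m - up_shift B m) *m be).
  by have := H k (ltnW k5); rewrite /up_shift /low_shift k5; exact.
apply: circle_coef => l lc.
rewrite low_shift_sum eq2// half_diff_sum up_shift_sum low_shift_sum -scalerA; congr (_ *: _).
by rewrite scalemxAl scalerBl scale1r.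
Qed.

End ClassSolutions.

(** * Holomorphic bundles from smooth projections *)

Section Wirtinger.
Variable R : realType.
Local Notation C := R[i].

Lemma increment_affine (f df : R -> R) (x0 x c e : R) : 0 <= e ->
  (forall s, `|s - x0| <= `|x - x0| -> is_derive s 1 f (df s) /\ `|df s - c| <= e) ->
  `|f x - f x0 - c * (x - x0)| <= e * `|x - x0|.
Proof.
move=> e0 H.
have D s : `|s - x0| <= `|x - x0| -> is_derive s 1 (fun t => f t - c * t) (df s - c).
  by move=> /H[d _]; apply: is_derive_eq; rewrite /GRing.scale /= mulr1.
have [xx|xx] := leP x0 x.
  have := @increment_bound R (fun t => f t - c * t) (fun s => df s - c) x0 x e xx.
  rewrite (ger0_norm (x := x - x0)) ?subr_ge0//.
  have -> : f x - f x0 - c * (x - x0) = f x - c * x - (f x0 - c * x0) by ring.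
  by apply => s /andP[s1 s2]; [apply: D|apply: (H _ _).2]; rewrite !ger0_norm; lra.
have {}xx := ltW xx; have := @increment_bound R (fun t => f t - c * t) (fun s => df s - c) x x0 e xx.
have -> : `|f x - f x0 - c * (x - x0)| = `|f x0 - c * x0 - (f x - c * x)|.
  by rewrite -normrN; congr `|_|; ring.
have -> : `|x - x0| = x0 - x by rewrite ler0_norm ?subr_le0// opprB.
by apply => s /andP[s1 s2]; [apply: D|apply: (H _ _).2]; rewrite !ler0_norm; lra.
Qed.

Lemma increment_split (p q r a b e s t : R) :
  `|p - q - a| <= e * s -> `|q - r - b| <= e * t -> `|p - r - a - b| <= e * (s + t).
Proof.
move=> hA hB; have -> : p - r - a - b = (p - q - a) + (q - r - b) by ring.
by rewrite mulrDr; exact: le_trans (ler_normD _ _) (lerD hA hB).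
Qed.

(** The increment is taken along a horizontal and then a vertical segment, and the mean
value inequality applied to each. *)
Lemma C1_differential2 m n (u : R * R -> 'M[R]_(m.+1, n.+1)) i j x0 y0 : Ck 1 setT u ->
  differential2 (fun x y => u (x, y) i j) x0 y0 ('D_(e_x R) u (x0, y0) i j) ('D_(e_y R) u (x0, y0) i j).
Proof.
move=> [du cu] e e0.
have dv (v : R * R) q : is_derive q v (fun p => u p i j) ('D_v u q i j).
  have d : derivable u q v by exact: du.
  apply: DeriveDef; first exact: (derivable_mxP u q v).1 d i j.
  by rewrite (derive_mx d) mxE.
have dx (x y : R) : is_derive x (1 : R) (fun s : R => u (s, y) i j) ('D_(e_x R) u (x, y) i j).
  have [d E] := dv (e_x R) (x, y).
  have [d' E'] : derivable (fun s : R => u (s, y) i j) x 1 /\ 'D_1 (fun s => u (s, y) i j) x = 'D_(e_x R) u (x, y) i j.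
    apply: derive_of_cvg; rewrite -E; have := quotient_cvg d.
    rewrite [X in X @ _ --> _ -> _](_ : _ = fun h : R => h^-1 *: (u (h *: 1 + x, y) i j - u (x, y) i j))//.
    apply/funext => h; congr (_ *: (u _ i j - _)).
    by rewrite -[LHS]/(h *: 1 + x, h *: 0 + y) scaler0 add0r.
  exact: DeriveDef.
have dy (x y : R) : is_derive y (1 : R) (fun s : R => u (x, s) i j) ('D_(e_y R) u (x, y) i j).
  have [d E] := dv (e_y R) (x, y).
  have [d' E'] : derivable (fun s : R => u (x, s) i j) y 1 /\ 'D_1 (fun s => u (x, s) i j) y = 'D_(e_y R) u (x, y) i j.
    apply: derive_of_cvg; rewrite -E; have := quotient_cvg d.
    rewrite [X in X @ _ --> _ -> _](_ : _ = fun h : R => h^-1 *: (u (x, h *: 1 + y) i j - u (x, y) i j))//.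
    apply/funext => h; congr (_ *: (u _ i j - _)).
    by rewrite -[LHS]/(h *: 0 + x, h *: 1 + y) scaler0 add0r.
  exact: DeriveDef.
have cv (v : R * R) : \forall q \near (x0, y0), `|'D_v u q i j - 'D_v u (x0, y0) i j| <= e.
  have c : ('D_v u q i j : R) @[q --> (x0, y0)] --> 'D_v u (x0, y0) i j.
    exact: (cvg_comp (fun q => 'D_v u q) (fun M : 'M[R]_(m.+1, n.+1) => M i j) (cu v (x0, y0) I) (@coord_continuous R _ _ i j _)).
  have /cvgrPdist_le/(_ e e0) := c.
  by apply: filterS => q; rewrite distrC.
have /nbhs_ballP[d1 /= d10 H1] := cv (e_x R).
have /nbhs_ballP[d2 /= d20 H2] := cv (e_y R).
exists (Num.min d1 d2 / 2); first by rewrite divr_gt0// lt_min d10.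
move=> x y hx hy.
have dm : Num.min d1 d2 / 2 < d1 /\ Num.min d1 d2 / 2 < d2.
  have [h1 h2] : Num.min d1 d2 <= d1 /\ Num.min d1 d2 <= d2 by rewrite !ge_min !lexx orbT.
  have h0 : 0 < Num.min d1 d2 by rewrite lt_min d10.
  lra.
have hA : `|u (x, y) i j - u (x0, y) i j - 'D_(e_x R) u (x0, y0) i j * (x - x0)| <= e * `|x - x0|.
  apply: (@increment_affine (fun s => u (s, y) i j) (fun s => 'D_(e_x R) u (s, y) i j)); first exact: ltW.
  move=> s sx; split; first exact: dx.
  by apply: H1; split; rewrite /ball /= distrC; lra.
have hB : `|u (x0, y) i j - u (x0, y0) i j - 'D_(e_y R) u (x0, y0) i j * (y - y0)| <= e * `|y - y0|.
  apply: (@increment_affine (fun s => u (x0, s) i j) (fun s => 'D_(e_y R) u (x0, s) i j)); first exact: ltW.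
  move=> s sx; split; first exact: dy.
  by apply: H2; split; rewrite /ball /= distrC ?subrr ?normr0//; lra.
exact: (increment_split hA hB).
Qed.

Lemma wirtinger_bound (G h : C) (rx ry ix iy e : R) : 0 < e ->
  `|complex.Re G - rx * complex.Re h - ry * complex.Im h| <=
    e / 4 * (`|complex.Re h| + `|complex.Im h|) ->
  `|complex.Im G - ix * complex.Re h - iy * complex.Im h| <=
    e / 4 * (`|complex.Re h| + `|complex.Im h|) ->
  normc (G - (2^-1 * (rx%:C + 'i%C * ix%:C - 'i%C * (ry%:C + 'i%C * iy%:C)) * h +
      2^-1 * (rx%:C + 'i%C * ix%:C + 'i%C * (ry%:C + 'i%C * iy%:C)) * conjc h)) <= e * normc h.
Proof.
move=> e0 H1 H2; have nR := normRe_le h; have nI := normIm_le h.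
set s := complex.Re h in H1 H2 nR *; set t := complex.Im h in H1 H2 nI *.
have hE : h = s%:C + 'i%C * t%:C by rewrite /s /t; case: (h) => x y; apply/eqP; rewrite eq_complex /=; apply/andP; split; apply/eqP; ring.
have cE : conjc h = s%:C - 'i%C * t%:C by rewrite /s /t; case: (h) => x y; apply/eqP; rewrite eq_complex /=; apply/andP; split; apply/eqP; ring.
have ii : 'i%C * 'i%C = - 1 :> C by rewrite -expr2 sqr_i.
set E := (X in normc X <= _).
have -> : E = (complex.Re G - rx * s - ry * t) +i* (complex.Im G - ix * s - iy * t).
  rewrite /E cE [X in _ * X + _]hE.
  transitivity (G - ((rx%:C + 'i%C * ix%:C) * s%:C - 'i%C * 'i%C * (ry%:C + 'i%C * iy%:C) * t%:C)).
    by congr (_ - _); field.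
  by rewrite ii; case: (G) => x y; apply/eqP; rewrite eq_complex /=; apply/andP; split; apply/eqP; ring.
apply: le_trans (normc_le _ _) _.
have : e / 4 * (`|s| + `|t|) <= e / 2 * normc h by move: (normc h) nR nI => N nR nI; nra.
move: (normc h) => N; lra.
Qed.

(** The Wirtinger form of the differential: a is the derivative in z and b that in the
conjugate of z. *)
Definition rdiff (f : C -> C) (z a b : C) :=
  forall e : R, 0 < e -> exists2 d : R, 0 < d & forall w : C, normc (w - z) <= d ->
    normc (f w - f z - (a * (w - z) + b * conjc (w - z))) <= e * normc (w - z).

Lemma rdiff_bsmooth m n (F : sphere R -> 'M[C]_(m.+1, n.+1)) : bsmooth F -> forall c z i j,
  rdiff (fun w => F (chart c w) i j) z (d_z (fun w => F (chart c w)) z i j)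
    (d_zbar (fun w => F (chart c w)) z i j).
Proof.
move=> sF c z i j e e0; have [/(_ 1%N) cR /(_ 1%N) cI] := sF c.
have e4 : 0 < e / 4 by rewrite divr_gt0.
have [d1 d10 H1] := @C1_differential2 _ _ _ i j (pt z).1 (pt z).2 cR _ e4.
have [d2 d20 H2] := @C1_differential2 _ _ _ i j (pt z).1 (pt z).2 cI _ e4.
exists (Num.min d1 d2); first by rewrite lt_min d10.
move=> w; rewrite le_min => /andP[w1 w2].
have nR := normRe_le (w - z); have nI := normIm_le (w - z).
have := H1 (pt w).1 (pt w).2; have := H2 (pt w).1 (pt w).2.
rewrite -!surjective_pairing !ptK /d_z /d_zbar /partial.
have -> : (pt w).1 - (pt z).1 = complex.Re (w - z) by rewrite ReB.
have -> : (pt w).2 - (pt z).2 = complex.Im (w - z) by rewrite ImB.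
rewrite !mxE -ReB -ImB => {}H2 {}H1.
exact: (wirtinger_bound e0 (H1 (le_trans nR w1) (le_trans nI w1)) (H2 (le_trans nR w2) (le_trans nI w2))).
Qed.

Lemma rdiff_cdiff f z a : rdiff f z a 0 -> cdiff f z a.
Proof.
move=> H e e0; have [d d0 Hd] := H e e0; exists d => // w /Hd.
by rewrite mul0r addr0.
Qed.

Lemma rdiffD f g z a b a' b' : rdiff f z a b -> rdiff g z a' b' ->
  rdiff (fun w => f w + g w) z (a + a') (b + b').
Proof.
move=> df dg e e0; have e2 : 0 < e / 2 by rewrite divr_gt0.
have [d1 d10 H1] := df _ e2; have [d2 d20 H2] := dg _ e2.
exists (Num.min d1 d2); first by rewrite lt_min d10.
move=> w; rewrite le_min => /andP[/H1 h1 /H2 h2].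
set x := (X in normc X <= _) in h1; set y := (X in normc X <= _) in h2.
rewrite (_ : _ - _ = x + y); last by rewrite /x /y; ring.
by apply: le_trans (le_normcD _ _) _; lra.
Qed.

Lemma rdiff_cst (c z : C) : rdiff (fun=> c) z 0 0.
Proof.
move=> e e0; exists 1 => // w _; rewrite subrr !mul0r addr0 subr0 normc0.
by rewrite mulr_ge0 ?normc_ge0// ltW.
Qed.

Lemma rdiff_sum (I : Type) (r : seq I) (f : I -> C -> C) z (a b : I -> C) :
  (forall i, rdiff (f i) z (a i) (b i)) ->
  rdiff (fun w => \sum_(i <- r) f i w) z (\sum_(i <- r) a i) (\sum_(i <- r) b i).
Proof.
move=> df; elim: r => [|i r IH].
  rewrite !big_nil; have -> : (fun w => \sum_(i <- [::]) f i w) = (fun=> 0).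
    by apply/funext => w; rewrite big_nil.
  exact: rdiff_cst.
rewrite !big_cons; have -> : (fun w => \sum_(j <- i :: r) f j w) = (fun w => f i w + \sum_(j <- r) f j w).
  by apply/funext => w; rewrite big_cons.
exact: (rdiffD (df i) IH).
Qed.

(** At a common zero the product is of smaller order as soon as one factor is
differentiable and the other continuous. This is what makes [frame_rdiff] work for
frames known only to be continuous. *)
Lemma rdiff_mul0 (f g : C -> C) z a b : f z = 0 -> g z = 0 -> rdiff g z a b ->
  (forall e : R, 0 < e -> exists2 d : R, 0 < d & forall w, normc (w - z) <= d -> normc (f w) <= e) ->
  rdiff (fun w => f w * g w) z 0 0.
Proof.
move=> fz gz dg cf e e0.
pose K := normc a + normc b + 1.
have K0 : 0 < K by rewrite /K; have := normc_ge0 a; have := normc_ge0 b; lra.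
have [d d0 H] := dg 1 ltr01.
have [d1 d10 H1] := cf (e / K) (divr_gt0 e0 K0).
exists (Num.min d d1); first by rewrite lt_min d0.
move=> w; rewrite le_min => /andP[/H h /H1 h1].
rewrite fz !mul0r addr0 !subr0 normcM.
have h4 : normc (conjc (w - z)) = normc (w - z) by case: (w - z) => x y /=; rewrite sqrrN.
have hg : normc (g w) <= K * normc (w - z).
  rewrite gz subr0 in h.
  have := le_normcD (g w - (a * (w - z) + b * conjc (w - z))) (a * (w - z) + b * conjc (w - z)).
  rewrite subrK; have := le_normcD (a * (w - z)) (b * conjc (w - z)); rewrite !normcM h4 /K; nra.
have -> : e * normc (w - z) = (e / K) * (K * normc (w - z)) by field; rewrite gt_eqF.
by apply: ler_pM; rewrite ?normc_ge0.
Qed.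

End Wirtinger.
Section IdempotentRank.
Variable F : fieldType.

Lemma idem_factor n r (P : 'M[F]_n) : P *m P = P -> \rank P = r ->
  exists (S : 'M[F]_(n, r)) (G : 'M[F]_(r, n)), P = S *m G /\ G *m S = 1%:M.
Proof.
move=> PP <-; exists (col_base P), (row_base P); rewrite mulmx_base; split => //.
apply: (row_full_inj (col_base_full P)); apply: (row_free_inj (row_base_free P)) => /=.
move: (mulmx_base P); move: (col_base P) (row_base P) => S G B.
by rewrite mulmx1 B mulmxA -(mulmxA (S *m G)) B PP.
Qed.

Lemma idem_trace n (P : 'M[F]_n) : P *m P = P -> \tr P = (\rank P)%:R.
Proof.
move=> PP; move rE : (\rank P) => r; have [S [G [-> GS]]] := idem_factor PP rE.
by rewrite mxtrace_mulC GS mxtrace1.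
Qed.

(** The image of S lies in that of P and has the same dimension, so S G is the identity
on the image of P. *)
Lemma frame_span n r (P : 'M[F]_n) (S : 'M[F]_(n, r)) (G : 'M[F]_(r, n)) :
  \rank P = r -> P *m S = S -> G *m S = 1%:M -> S *m (G *m P) = P.
Proof.
move=> rP PS GS.
have sub : (S^T <= P^T)%MS by apply/submxP; exists S^T; rewrite -trmx_mul PS.
have rS : \rank S^T = r.
  by apply/eqP; apply/row_freeP; exists G^T; rewrite -trmx_mul GS trmx1.
have : (P^T <= S^T)%MS by rewrite -(mxrank_leqif_sup sub) rS mxrank_tr rP.
move=> /submxP[Z /(congr1 trmx)]; rewrite trmx_mul !trmxK => ->.
by rewrite (mulmxA G) GS mul1mx.
Qed.

Lemma frame_basis r (P : 'M[F]_6) (S : 'M[F]_(6, r)) (G : 'M[F]_(r, 6)) :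
  \rank P = r -> P *m S = S -> G *m S = 1%:M ->
  basis_of (colspace P) [seq col i S | i <- enum 'I_r].
Proof.
move=> rP PS GS; have SGP := frame_span rP PS GS.
have colE (x : 'cV[F]_r) : S *m x = \sum_i x i 0 *: col i S.
  apply/matrixP => i j; rewrite !mxE summxE; apply: eq_bigr => k _.
  by rewrite !mxE (ord1 j) mulrC.
have sz : size [seq col i S | i <- enum 'I_r] == r by rewrite size_map size_enum_ord.
rewrite /basis_of; apply/andP; split.
  rewrite eqEsubv; apply/andP; split.
    apply/span_subvP => v /mapP[i _ ->]; apply/memv_colspace; exists (col i S).
    by apply/matrixP => k l; rewrite -{1}PS !mxE; apply: eq_bigr => m _; rewrite mxE.
  apply/subvP => v /memv_colspace[w ->].
  rewrite -SGP -!mulmxA colE; apply: memv_suml => i _; apply: memvZ; apply: memv_span.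
  by apply/mapP; exists i; rewrite ?mem_enum.
apply/(@freeP _ _ _ (Tuple sz)) => k k0 i.
pose x : 'cV[F]_r := \col_j k j.
have x0 : x = 0.
  rewrite -[x]mul1mx -GS -mulmxA colE.
  rewrite (_ : \sum_i _ = 0) ?mulmx0// -[RHS]k0; apply: eq_bigr => j _.
  by rewrite mxE (nth_map j) ?size_enum_ord// nth_ord_enum.
by have := congr1 (fun M : 'cV[F]_r => M i 0) x0; rewrite !mxE.
Qed.

End IdempotentRank.

Section HolomorphicFrames.
Variable R : realType.
Local Notation C := R[i].

Lemma scont_prod (I : Type) (r : seq I) (f : I -> sphere R -> C) :
  (forall i, scont (f i)) -> scont (fun p => \prod_(i <- r) f i p).
Proof.
move=> cf; elim: r => [|i r IH].
  have -> : (fun p => \prod_(i <- [::]) f i p) = (fun=> 1) by apply/funext => p; rewrite big_nil.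
  exact: scont_cst.
have -> : (fun p => \prod_(j <- i :: r) f j p) = (fun p => f i p * \prod_(j <- r) f j p).
  by apply/funext => p; rewrite big_cons.
exact: (scontM (cf i) IH).
Qed.

Lemma scont_det n (M : sphere R -> 'M[C]_n) : mcont M -> scont (fun p => \det (M p)).
Proof.
move=> cM; apply: (@scont_sum _ _ _ (fun (s : 'S_n) p => (-1) ^+ s * \prod_i M p i (s i))) => s.
apply: (@scontM _ (fun=> (-1) ^+ s) (fun p => \prod_i M p i (s i))); first exact: scont_cst.
by apply: (@scont_prod _ _ (fun i p => M p i (s i))) => i; exact: cM.
Qed.

Lemma mcont_adj n (M : sphere R -> 'M[C]_n) : mcont M -> mcont (fun p => \adj (M p)).
Proof.
move=> cM i j; have -> : (fun p => \adj (M p) i j) =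
    (fun p => (-1) ^+ (j + i) * \det (row' j (col' i (M p)))).
  by apply/funext => p; rewrite mxE.
apply: (@scontM _ (fun=> (-1) ^+ (j + i)) (fun p => \det (row' j (col' i (M p))))); first exact: scont_cst.
apply: scont_det => k l; have -> : (fun p => row' j (col' i (M p)) k l) = (fun p => M p (lift j k) (lift i l)).
  by apply/funext => p; rewrite !mxE.
exact: cM.
Qed.

Definition mrdiff m n (F : C -> 'M[C]_(m, n)) z (A B : 'M[C]_(m, n)) :=
  forall i j, rdiff (fun w => F w i j) z (A i j) (B i j).

Lemma rdiff_mulr (f : C -> C) z a b c : rdiff f z a b -> rdiff (fun w => f w * c) z (a * c) (b * c).
Proof.
move=> df e e0.
have c1 : 0 < normc c + 1 by rewrite ltr_wpDl ?normc_ge0.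
have [d d0 H] := df (e / (normc c + 1)) (divr_gt0 e0 c1); exists d => // w /H h.
have -> : f w * c - f z * c - (a * c * (w - z) + b * c * conjc (w - z)) =
  (f w - f z - (a * (w - z) + b * conjc (w - z))) * c by ring.
rewrite normcM; set N := normc (f w - _ - _) in h *.
apply: (@le_trans _ _ (N * (normc c + 1))).
  by apply: ler_wpM2l; [exact: normc_ge0|lra].
apply: le_trans (ler_wpM2r (ltW c1) h) _.
by rewrite mulrAC divfK// gt_eqF.
Qed.

Lemma mrdiff_mulr m n p (F : C -> 'M[C]_(m, n)) z A B (K : 'M[C]_(n, p)) : mrdiff F z A B ->
  mrdiff (fun w => F w *m K) z (A *m K) (B *m K).
Proof.
move=> dF i j; rewrite !mxE.
have -> : (fun w => (F w *m K) i j) = (fun w => \sum_k F w i k * K k j).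
  by apply/funext => w; rewrite mxE.
by apply: (@rdiff_sum _ _ _ (fun k w => F w i k * K k j)) => k; exact: rdiff_mulr.
Qed.

Lemma mrdiff_mull m n p (F : C -> 'M[C]_(m, n)) z A B (K : 'M[C]_(p, m)) : mrdiff F z A B ->
  mrdiff (fun w => K *m F w) z (K *m A) (K *m B).
Proof.
move=> dF i j; rewrite !mxE.
have -> : (fun w => (K *m F w) i j) = (fun w => \sum_k F w k j * K i k).
  by apply/funext => w; rewrite mxE; apply: eq_bigr => k _; rewrite mulrC.
have E (X : 'M[C]_(m, n)) : \sum_k K i k * X k j = \sum_k X k j * K i k.
  by apply: eq_bigr => k _; rewrite mulrC.
rewrite !E.
by apply: (@rdiff_sum _ _ _ (fun k w => F w k j * K i k)) => k; exact: rdiff_mulr.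
Qed.

Lemma mrdiffD m n (F G : C -> 'M[C]_(m, n)) z A B A' B' : mrdiff F z A B -> mrdiff G z A' B' ->
  mrdiff (fun w => F w + G w) z (A + A') (B + B').
Proof.
move=> dF dG i j; rewrite !mxE.
have -> : (fun w => (F w + G w) i j) = (fun w => F w i j + G w i j).
  by apply/funext => w; rewrite mxE.
exact: rdiffD.
Qed.

Lemma mrdiff_cst m n (K : 'M[C]_(m, n)) z : mrdiff (fun=> K) z 0 0.
Proof. by move=> i j; rewrite !mxE; exact: rdiff_cst. Qed.

Definition mc_at m n (F : C -> 'M[C]_(m, n)) (z : C) := forall i j (e : R), 0 < e ->
  exists2 d : R, 0 < d & forall w, normc (w - z) <= d -> normc (F w i j - F z i j) <= e.

Lemma mrdiff_mul0 m n p (F : C -> 'M[C]_(m, n)) (G : C -> 'M[C]_(n, p)) z A B :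
  F z = 0 -> G z = 0 -> mrdiff G z A B -> mc_at F z -> mrdiff (fun w => F w *m G w) z 0 0.
Proof.
move=> Fz Gz dG cF i j; rewrite !mxE.
have -> : (fun w => (F w *m G w) i j) = (fun w => \sum_k F w i k * G w k j).
  by apply/funext => w; rewrite mxE.
have := @rdiff_sum R 'I_n (index_enum 'I_n) (fun k w => F w i k * G w k j) z (fun=> 0) (fun=> 0).
rewrite !big1//; apply => k; apply: (rdiff_mul0 _ _ (dG k j)); rewrite ?Fz ?Gz ?mxE//.
move=> e e0; have [d d0 H] := cF i k e e0; exists d => // w /H.
by rewrite Fz mxE subr0.
Qed.

Lemma rdiff_near (f g : C -> C) z a b : rdiff f z a b -> f z = g z ->
  (\forall w \near (z : C^o), f w = g w) -> rdiff g z a b.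
Proof.
move=> df fg /(@nbhs_normcP _ z (fun w => f w = g w))[d0 d00 nfg] e e0.
have [d d_gt0 H] := df e e0; exists (Num.min d (d0 / 2)); first by rewrite lt_min d_gt0 divr_gt0.
move=> w; rewrite le_min => /andP[/H h hw]; rewrite -fg -nfg//; lra.
Qed.

End HolomorphicFrames.
Section FrameDerivative.
Variable R : realType.
Local Notation C := R[i].

Lemma mrdiff_opp_cont m n (F : C -> 'M[C]_(m, n)) z : mc_at F z -> mc_at (fun w => F z - F w) z.
Proof.
move=> cF i j e e0; have [d d0 H] := cF i j e e0; exists d; first exact: d0.
by move=> w /H; rewrite subrr !mxE subr0 normcB.
Qed.

(** For a frame normalised by G S = 1, S(w) equals
S(z) + (1 - S(z) G) (P(w) - P(z)) S(z) up to smaller order. The derivative of P in the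
conjugate variable has its image in that of P, where 1 - S(z) G vanishes. *)
Lemma frame_rdiff r (P : C -> 'M[C]_6) (S : C -> 'M[C]_(6, r)) (G : 'M[C]_(r, 6)) z A B :
  mrdiff P z A B -> mc_at S z -> G *m S z = 1%:M -> P z *m S z = S z -> S z *m (G *m P z) = P z ->
  (\forall w \near (z : C^o), [/\ G *m S w = 1%:M, P w *m S w = S w & S w *m (G *m P w) = P w]) ->
  (1%:M - P z) *m B = 0 -> exists A', mrdiff S z A' 0.
Proof.
move=> dP cS GS PS SGP nS dB.
pose T w := (P w - P z) *m S z.
have dT : mrdiff T z (A *m S z) (B *m S z).
  rewrite -[A]addr0 -[B]addr0; apply: mrdiff_mulr.
  exact: (mrdiffD dP (mrdiff_cst _ _)).
have Tz : T z = 0 by rewrite /T subrr mul0mx.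
have NB : (1%:M - S z *m G) *m (B *m S z) = 0.
  move: dB; rewrite mulmxBl mul1mx => /eqP; rewrite subr_eq0 => /eqP ->.
  have SGP' : S z *m G *m P z = P z by rewrite -mulmxA.
  by rewrite mulmxBl mul1mx !mulmxA SGP' subrr.
pose f w := S z + (1%:M - S z *m G) *m T w + (S z - S w) *m (G *m T w).
exists (0 + (1%:M - S z *m G) *m (A *m S z) + 0) => i j.
have df : mrdiff f z (0 + (1%:M - S z *m G) *m (A *m S z) + 0) 0.
  have d1 := mrdiffD (mrdiff_cst (S z) z) (mrdiff_mull (1%:M - S z *m G) dT).
  have d2 : mrdiff (fun w => (S z - S w) *m (G *m T w)) z 0 0.
    apply: (mrdiff_mul0 _ _ (mrdiff_mull G dT)).
    - by rewrite subrr.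
    - by rewrite Tz mulmx0.
    - exact: mrdiff_opp_cont.
  by have := mrdiffD d1 d2; rewrite NB !addr0.
apply: (rdiff_near (df i j)).
  by rewrite /f Tz !mulmx0 !addr0.
apply: filterS nS => w [GSw PSw SGPw]; rewrite /f.
have PwSz : P w *m S z = S z + T w by rewrite /T mulmxBl PS addrC subrK.
have key : S z + T w = S w + S w *m (G *m T w).
  have -> : S w + S w *m (G *m T w) = S w *m (G *m (S z + T w)).
    by rewrite (mulmxDr G) GS mulmxDr mulmx1.
  by rewrite -PwSz !(mulmxA G) (mulmxA (S w)) SGPw.
rewrite mulmxBl mul1mx mulmxBl -!mulmxA.
move: (T w) (S w *m _) (S z *m _) key => t a b key.
have -> : S w = S z + t - a by rewrite key addrK.
by rewrite !mxE; ring.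
Qed.

End FrameDerivative.

Section HolomorphicSubbundles.
Variable R : realType.
Local Notation C := R[i].
Variables (P : sphere R -> 'M[C]_6) (r : nat).
Hypotheses (sP : bsmooth P) (PP : forall p, P p *m P p = P p) (rP : forall p, \rank (P p) = r).
Hypothesis dP : forall c z, (1%:M - P (chart c z)) *m d_zbar (fun w => P (chart c w)) z = 0.

Section LocalFrame.
Variables (S0 : 'M[C]_(6, r)) (G : 'M[C]_(r, 6)) (c : bool).

(** The frame P S0 of the image of P is normalised to G S = 1 by the inverse of this
matrix, written with the adjugate to make its continuity plain. *)
Definition gram p : 'M[C]_r := G *m P p *m S0.
Definition lframe p : 'M[C]_(6, r) := P p *m S0 *m ((\det (gram p))^-1 *: \adj (gram p)).
Definition ldomain : set C^o := [set z | \det (gram (chart c z)) != 0].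

Lemma gram_mcont : mcont gram.
Proof.
apply: mcontM; last exact: mcont_cst.
by apply: mcontM; [exact: mcont_cst|exact: bsmooth_mcont].
Qed.

Lemma lframe_spec p : \det (gram p) != 0 -> G *m lframe p = 1%:M /\ P p *m lframe p = lframe p.
Proof.
move=> dn; split; last by rewrite /lframe !mulmxA PP.
by rewrite /lframe !mulmxA -/(gram p) -scalemxAr mul_mx_adj scale_scalar_mx mulVf.
Qed.

Lemma ldomain_near z : ldomain z -> \forall w \near (z : C^o), ldomain w.
Proof.
move=> dz; have := (cvg_normcP _ _ _).1 (@scont_det R _ _ gram_mcont c z).
have n0 : 0 < normc (\det (gram (chart c z))).
  by rewrite lt_neqAle normc_ge0 andbT eq_sym; apply: contra dz => /eqP/eq0_normc ->.
move=> H0; have [d d0 H] := H0 _ n0.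
apply: ((@nbhs_normcP R z ldomain).2 _); exists d; first exact: d0.
move=> w wz; have := H w wz.
by rewrite /ldomain /=; apply: contraTneq => ->; rewrite sub0r normcN ltxx.
Qed.

Lemma lframe_cont z : ldomain z -> mc_at (fun w => lframe (chart c w)) z.
Proof.
move=> dz i j e e0.

have cN : mcont (fun p => P p *m S0 *m \adj (gram p)).
  apply: mcontM; last exact: mcont_adj gram_mcont.
  by apply: mcontM; [exact: bsmooth_mcont|exact: mcont_cst].
pose f (w : C) : C := (P (chart c w) *m S0 *m \adj (gram (chart c w))) i j * (\det (gram (chart c w)))^-1.
have E w : lframe (chart c w) i j = f w by rewrite /lframe -scalemxAr mxE mulrC.
have cv : (f w : C^o) @[w --> (z : C^o)] --> (f z : C^o).
  exact: (cvgM (cN i j c z) (cvgV dz (@scont_det R _ _ gram_mcont c z))).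
have [d d0 H] := (cvg_normcP f z (f z)).1 cv e e0.
have d2 : d / 2 < d by rewrite ltr_pdivrMr// ltr_pMr// ltr1n.
exists (d / 2); first exact: divr_gt0.
clearbody f; move=> w wz; have h := H w (le_lt_trans wz d2).
by move: (ltW h); rewrite -(E w) -(E z).
Qed.

Lemma lframe_holo z : ldomain z -> exists A : 'M[C]_(6, r),
  mrdiff (fun w => lframe (chart c w)) z A 0.
Proof.
move=> dz; have [GS PS] := lframe_spec dz.
apply: (@frame_rdiff _ _ (fun w => P (chart c w)) _ G z (d_z (fun w => P (chart c w)) z)
  (d_zbar (fun w => P (chart c w)) z) _ (lframe_cont dz)) => //.
- by move=> i j; exact: rdiff_bsmooth.
- exact: frame_span.
- apply: filterS (ldomain_near dz) => w dw; have [GSw PSw] := lframe_spec dw; split => //.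
  exact: frame_span.
Qed.

End LocalFrame.

(** The hypothesis on d_zbar P says that the image of P is stable under d_zbar; its
normalised local frames are then holomorphic by [frame_rdiff]. *)
Lemma holo_subbundle_of_projection : holo_subbundle r (fun p => colspace (P p)).
Proof.
move=> c z0; have [S0 [G [E GS]]] := idem_factor (PP (chart c z0)) (rP (chart c z0)).
exists (ldomain S0 G c), (fun i z => col i (lframe S0 G (chart c z))); split.
- rewrite openE => z; exact: ldomain_near.
- by rewrite /ldomain /= /gram E !mulmxA GS mul1mx GS det1 oner_neq0.
- move=> i k l z dz; have [A dA] := lframe_holo dz.
  apply/(@derivable_cdiff _ (fun w : C^o => col i (lframe S0 G (chart c w)) k l : C^o)).
  exists (A k i); apply: rdiff_cdiff; have := dA k i; rewrite !mxE.
  have -> // : (fun w => col i (lframe S0 G (chart c w)) k l) = (fun w => lframe S0 G (chart c w) k i).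
  by apply/funext => w; rewrite mxE.
- move=> z dz; have [GSz PSz] := lframe_spec dz.
  exact: frame_basis (rP _) PSz GSz.
Qed.

End HolomorphicSubbundles.

(** * Coefficients of circle-invariant solutions *)

Section CircleSubgroupCoefficients.
Variable R : realType.
Local Notation C := R[i].
Variable u : 'I_3 -> 'cV[C]_6.
Hypothesis hu : isotropic_frame u.
Local Notation cj := (@mxconj R 6 1).
Variables (a b : nat).
Hypothesis ba : (b <= a <= 2)%N.

(** The coefficient of l ^ (k - 2) in gamma: the spectral projection for this weight, u_j
having weight w_j and its conjugate -w_j. *)
Definition gcoef (k : nat) : 'M[C]_6 :=
  \sum_j ((2 + weight a b j == k)%N%:R *: (u j *m (cj (u j))^T) +
          (2 - weight a b j == k)%N%:R *: (cj (u j) *m (u j)^T)).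

Lemma weight_le2 j : (weight a b j <= 2)%N.
Proof. by case/andP: ba => ba' a2; rewrite /weight; case: ifP => // _; case: ifP => // _; lia. Qed.

Lemma gcoef_u k i : gcoef k *m u i = (2 + weight a b i == k)%N%:R *: u i.
Proof.
rewrite /gcoef mulmx_suml (bigD1 i) //= big1 ?addr0 => [|j ji].
  rewrite mulmxDl -!scalemxAl -!mulmxA (frame_uu hu) (frame_cu hu) eqxx mulmx0 scaler0 addr0.
  by rewrite mul_mx_scalar scale1r.
rewrite mulmxDl -!scalemxAl -!mulmxA (frame_uu hu) (frame_cu hu) (negPf ji) mulmx0 scaler0 addr0.
by rewrite mul_mx_scalar scale0r scaler0.
Qed.

Lemma gcoef_c k i : gcoef k *m cj (u i) = (2 - weight a b i == k)%N%:R *: cj (u i).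
Proof.
rewrite /gcoef mulmx_suml (bigD1 i) //= big1 ?addr0 => [|j ji].
  rewrite mulmxDl -!scalemxAl -!mulmxA (frame_uc hu) (frame_cc hu) eqxx mulmx0 scaler0 add0r.
  by rewrite mul_mx_scalar scale1r.
rewrite mulmxDl -!scalemxAl -!mulmxA (frame_uc hu) (frame_cc hu) (negPf ji) mulmx0 scaler0 add0r.
by rewrite mul_mx_scalar scale0r scaler0.
Qed.

Lemma gcoefM j k : gcoef j *m gcoef k = if j == k then gcoef k else 0.
Proof.
by apply: (frame_ext hu) => i; rewrite -mulmxA ?gcoef_u ?gcoef_c -scalemxAr ?gcoef_u ?gcoef_c scalerA;
  (case: (j =P k) => [->|jk]; rewrite ?gcoef_u ?gcoef_c ?mul0mx;
  [by case: (_ == k); rewrite ?mulr1 ?mulr0|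
   case: eqP => [->|_]; rewrite ?mul0r ?scale0r// mul1r; case: eqP => [E|_]; rewrite ?scale0r//;
   by case: jk]).
Qed.

Lemma gcoef_tr k : (k < 5)%N -> (gcoef k)^T = gcoef (4 - k).
Proof.
move=> k5; rewrite /gcoef (big_morph _ (@trmxD _ _ _) (trmx0 _ _ _)); apply: eq_bigr => j _.
rewrite trmxD !trmxZ !trmx_mul !trmxK addrC; have := weight_le2 j => wj.
by congr (_%:R *: _ + _%:R *: _); lia.
Qed.

Lemma gamma_gcoef l : circle l -> mxC (gamma (zeta u a b) l) = l ^- 2 *: \sum_(k < 5) l ^+ k *: gcoef k.
Proof.
move=> lc; have l0 := circle_neq0 lc; rewrite (gamma_zeta hu)//; apply: (frame_ext hu) => i.
  rewrite (tdiagE hu) -scalemxAl mulmx_suml.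
  have wi := weight_le2 i; have k5 : (2 + weight a b i < 5)%N by lia.
  rewrite (bigD1 (Ordinal k5)) //= big1 ?addr0 => [|j ji].
    by rewrite -scalemxAl gcoef_u eqxx scale1r scalerA exprD mulKf// expf_neq0.
  rewrite -scalemxAl gcoef_u; case: eqP => [E|_]; last by rewrite scale0r scaler0.
  by case/eqP: ji; apply/val_inj.
rewrite -scalemxAl mulmx_suml.
have -> : mxC (tdiag u (fun j => l ^+ weight a b j)) *m cj (u i) = l ^- weight a b i *: cj (u i).
  by rewrite mulmx_cj (tdiagE hu) mxconjZ rmorphXn /= conjc_circle// exprVn.
have wi := weight_le2 i; have k5 : (2 - weight a b i < 5)%N by lia.
rewrite (bigD1 (Ordinal k5)) //= big1 ?addr0 => [|j ji].
  rewrite -scalemxAl gcoef_c eqxx scale1r scalerA; congr (_ *: _).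
  by rewrite !exprnN exprnP -expfzDr//; congr (_ ^ _); lia.
rewrite -scalemxAl gcoef_c; case: eqP => [E|_]; last by rewrite scale0r scaler0.
by case/eqP: ji; apply/val_inj.
Qed.

Lemma gcoef_trace k : \tr (gcoef k) =
  \sum_j ((2 + weight a b j == k)%N%:R + (2 - weight a b j == k)%N%:R).
Proof.
rewrite /gcoef raddf_sum; apply: eq_bigr => j _ /=.
rewrite mxtraceD !mxtraceZ !(mxtrace_mulC (u j)) (mxtrace_mulC (cj (u j))).
by rewrite (frame_cu hu) (frame_uc hu) eqxx mxtrace1 !mulr1.
Qed.

Lemma Omega_cf g : Omega_ (zeta u a b) g ->
  exists2 c, SO6 c & forall k, (k < 5)%N -> cf g k = mxC c *m gcoef k *m mxC c^T.
Proof.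
move=> [c cS gE]; exists c => // k k5; have [cO _] := cS; have [_ ci] := O6_unit cO.
apply: (@cfE _ _ (fun k => mxC c *m gcoef k *m mxC c^T)) => // l lc.
rewrite gE// /Ad ci !mxCM gamma_gcoef// -scalemxAr -scalemxAl; congr (_ *: _).
rewrite mulmx_sumr mulmx_suml; apply: eq_bigr => i _.
by rewrite -scalemxAr -scalemxAl.
Qed.

Variables (Phi : sphere R -> C -> 'M[R]_6) (D : set (sphere R)).
Hypothesis Psol : extended_solution Phi.
Hypothesis dD : discrete_set D.
Hypothesis PO : forall p, ~ D p -> Omega_ (zeta u a b) (Phi p).

Local Notation A k p := (cf (Phi p) k).

Lemma cf_mcont k : mcont (fun p => A k p).
Proof. by apply: bsmooth_mcont; exact: bsmooth_cf. Qed.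

(** The coefficients of gamma are its spectral projections; a conjugation preserves their
relations, and continuity extends them over the exceptional set. *)
Lemma S1_coefM p j k : (j < 5)%N -> (k < 5)%N -> A j p *m A k p = if j == k then A k p else 0.
Proof.
move=> j5 k5; move: p; apply: (mcont_ext dD).
- by apply: mcontM; exact: cf_mcont.
- by case: eqP => _; [exact: cf_mcont|exact: mcont_cst].
- move=> p nD; have [c [cO _] E] := Omega_cf (PO nD); rewrite !E//.
  have cc : mxC c^T *m mxC c = 1%:M by rewrite -mxCM (cO : c^T *m c = 1%:M) mxC1.
  rewrite !mulmxA -(mulmxA _ (mxC c^T)) cc mulmx1 -(mulmxA (mxC c)) gcoefM.
  by case: eqP; rewrite ?mulmx0 ?mul0mx.
Qed.

Lemma S1_coef_tr p k : (k < 5)%N -> (A k p)^T = A (4 - k)%N p.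
Proof.
move=> k5; move: p; apply: (mcont_ext dD); [by apply: mcont_tr; exact: cf_mcont|exact: cf_mcont|].
move=> p nD; have [c _ E] := Omega_cf (PO nD).
have k5' : (4 - k < 5)%N by lia.
by rewrite !E// !trmx_mul gcoef_tr// -!mxC_tr trmxK mulmxA.
Qed.

Lemma S1_coef_trace p k : (k < 5)%N -> \tr (A k p) =
  \sum_j ((2 + weight a b j == k)%N%:R + (2 - weight a b j == k)%N%:R).
Proof.
move=> k5; move: p; apply: (scont_ext dD); [by apply: scont_trace; exact: cf_mcont|exact: scont_cst|].
move=> p nD; have [c [cO _] E] := Omega_cf (PO nD).
by rewrite E// mxtrace_mulC mulmxA -mxCM (cO : c^T *m c = 1%:M) mxC1 mul1mx gcoef_trace.
Qed.

Lemma S1_coef_sum p : Omega_alg (Phi p) ->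
  (forall l, circle l -> mxC (Phi p l) = l ^- 2 *: \sum_(k < 5) l ^+ k *: A k p) ->
  \sum_(k < 5) A k p = 1%:M.
Proof.
move=> [[_ P1 _] _] /(_ 1); rewrite P1 mxC1 expr1n invr1 scale1r => ->; last by rewrite /circle normr1.
by apply: eq_bigr => k _; rewrite expr1n scale1r.
Qed.

End CircleSubgroupCoefficients.

(** * Symmetry under an involution *)

Section OrthogonalIdempotents.
Variable R : realType.
Local Notation C := R[i].

(** Since s A_k is a multiple of A_k N, s preserves the image of A_k, that is
s A_k = A_k s A_k. The same for A_(4-k), transposed, is A_k s = A_k s A_k. *)
Lemma idem_commute (A : nat -> 'M[C]_6) (s N : 'M[C]_6) :
  (forall j k, (j < 5)%N -> (k < 5)%N -> A j *m A k = if j == k then A k else 0) ->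
  (forall k, (k < 5)%N -> (A k)^T = A (4 - k)%N) -> \sum_(k < 5) A k = 1%:M ->
  s^T = s -> (forall k, (k < 5)%N -> s *m A k = (-1) ^+ k *: (A k *m N)) ->
  forall k, (k < 5)%N -> s *m A k = A k *m s.
Proof.
move=> AM AT A1 sT sA.
have sAA k : (k < 5)%N -> s *m A k = A k *m s *m A k.
  move=> k5; rewrite -[LHS]mul1mx -A1 mulmx_suml (bigD1 (Ordinal k5)) //= big1 ?addr0 ?mulmxA// => j jk.
  rewrite sA// -scalemxAr mulmxA AM//; case: eqP => [E|_]; last by rewrite mul0mx scaler0.
  by case/eqP: jk; apply/val_inj.
move=> k k5; rewrite sAA//; have k5' : (4 - k < 5)%N by lia.
have := congr1 trmx (sAA _ k5'); rewrite !trmx_mul !AT// sT (_ : 4 - (4 - k) = k)%N; last by lia.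
by rewrite mulmxA.
Qed.

Lemma colspace_sub (P Q : 'M[C]_6) : Q *m P = P -> (colspace P <= colspace Q)%VS.
Proof. by move=> <-; exact: colspace_mul. Qed.

Lemma isotropic_colspace (P : 'M[C]_6) : P^T *m P = 0 -> isotropic (colspace P).
Proof.
move=> PP v w /memv_colspace[x ->] /memv_colspace[y ->].
by rewrite trmx_mul mulmxA -(mulmxA x^T) PP mulmx0 mul0mx.
Qed.

(** A section satisfies s = Q s, so its derivative is (d Q) s + Q (d s), and N annihilates
both terms. *)
Lemma d_sub_colspace (Q N : sphere R -> 'M[C]_6) (B : bundle R) : bsmooth Q ->
  (forall p, Q p *m Q p = Q p) -> (forall p, N p *m Q p = 0) ->
  (forall c z, N (chart c z) *m d_z (fun w => Q (chart c w)) z = 0) ->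
  (forall p v, N p *m v = 0 -> v \in B p) -> d_sub (fun p => colspace (Q p)) B.
Proof.
move=> sQ QQ NQ NdQ NB c U s oU [sR sI] sV z Uz; apply: NB.
have ds : pdiff2 s z.
  have zU : [set q | U (cx q)] (pt z) by rewrite /= ptK.
  have [/(_ 1%N)[dR _] /(_ 1%N)[dI _]] := (sR, sI).
  by split; split; [exact: dR|exact: dI|exact: dR|exact: dI].
have E : d_z s z = d_z (fun w => Q (chart c w) *m s w) z.
  apply: near_d_z; have := oU; rewrite openE => /(_ z Uz); apply: filterS => w Uw.
  by apply/eqP; rewrite eq_sym -mem_colspace_idem//; exact: sV.
have [_ E' _] := pdiff2_mulmx (bsmooth_pdiff2 sQ c z) ds.
by rewrite E E' mulmxDr !mulmxA NdQ NQ !mul0mx addr0.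
Qed.

Lemma decomposes_colspace (P Q : 'M[C]_6) : P *m P = P -> Q *m Q = Q -> mxconj Q *m Q = 0 ->
  Q *m mxconj Q = 0 -> P *m Q = 0 -> Q *m P = 0 -> mxconj P = P ->
  decomposes (colspace (P + Q + mxconj Q)) (colspace P) (colspace Q).
Proof.
move=> PP QQ cQQ QcQ PQ QP cP.
have cQ2 : mxconj Q *m mxconj Q = mxconj Q by rewrite -mxconjM QQ.
have PcQ : P *m mxconj Q = 0 by rewrite -cP -mxconjM PQ mxconj0.
have cQP : mxconj Q *m P = 0 by rewrite -cP -mxconjM QP mxconj0.
have PQ2 : (P + Q) *m (P + Q) = P + Q by rewrite mulmxDl !mulmxDr PP QQ PQ QP addr0 add0r.
rewrite /decomposes conjv_colspace; split; last first.
  by rewrite (colspaceD PP QQ PQ QP) (colspaceD PQ2 cQ2)// ?mulmxDl ?mulmxDr ?PcQ ?QcQ ?cQP ?cQQ ?addr0.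
apply: directv3; first by rewrite colspace0I.
by rewrite (colspaceD PP QQ PQ QP) colspace0I// mulmxDl PcQ QcQ addr0.
Qed.

End OrthogonalIdempotents.

Section InvolutiveSymmetry.
Variable R : realType.
Local Notation C := R[i].
Variables (Phi : sphere R -> C -> 'M[R]_6) (D : set (sphere R)) (s : 'M[R]_6).
Hypothesis Psol : extended_solution Phi.
Hypothesis Palg : forall p, Omega_alg (Phi p).
Hypothesis dD : discrete_set D.
Local Notation A k p := (cf (Phi p) k).
Hypothesis five : forall p l, circle l -> mxC (Phi p l) = l ^- 2 *: \sum_(k < 5) l ^+ k *: A k p.
Hypothesis AM : forall p j k, (j < 5)%N -> (k < 5)%N -> A j p *m A k p = if j == k then A k p else 0.
Hypothesis AT : forall p k, (k < 5)%N -> (A k p)^T = A (4 - k)%N p.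
Hypotheses (sT : s^T = s) (ss : s *m s = 1%:M).
Hypothesis sPhi : forall p, ~ D p -> forall l, circle l ->
  s *m (Phi p (- l) *m (Phi p (-1))^T) *m s = Phi p l.

Lemma circleN (l : C) : circle l -> circle (- l).
Proof. by rewrite /circle normrN. Qed.

Lemma cf_sum1 p : \sum_(k < 5) A k p = 1%:M.
Proof. by apply: S1_coef_sum (Palg p) _ => l; exact: five. Qed.

Lemma coef_at_minus1 p : mxC (Phi p (-1)) = \sum_(k < 5) (-1) ^+ k *: A k p.
Proof.
rewrite five; last by rewrite /circle normrN normr1.
by rewrite sqrrN expr1n invr1 scale1r.
Qed.

(** The symmetry reads s Phi(-l) Phi(-1)^-1 s = Phi(l). Comparing the powers of l gives
the hypothesis of [idem_commute] with N = Phi(-1)^T s. *)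
Lemma coef_commute p k : (k < 5)%N -> mxC s *m A k p = A k p *m mxC s.
Proof.
move=> k5; move: p; apply: (mcont_ext dD).
- by apply: mcontM; [exact: mcont_cst|apply: bsmooth_mcont; exact: bsmooth_cf].
- by apply: mcontM; [apply: bsmooth_mcont; exact: bsmooth_cf|exact: mcont_cst].
move=> p nD; move: k k5.
apply: (@idem_commute _ (fun k => A k p) (mxC s) (mxC ((Phi p (-1))^T *m s)) (AM p) (AT p) (cf_sum1 p)).
  by rewrite -mxC_tr sT.
apply: circle_coef => l lc.
have l2 : l ^- 2 != 0 by rewrite invr_eq0 expf_neq0// circle_neq0.
have := congr1 (fun M => s *m M) (sPhi nD lc); rewrite !mulmxA ss mul1mx => E.
apply: (scalerI l2); transitivity (mxC (s *m Phi p l)).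
  rewrite mxCM five// -scalemxAr mulmx_sumr; congr (_ *: _).
  by apply: eq_bigr => k _; rewrite scalemxAr.
rewrite -E !mxCM -mulmxA -mxCM five; last exact: circleN.
rewrite sqrrN -scalemxAl mulmx_suml; congr (_ *: _); apply: eq_bigr => k _.
by rewrite scalerA -scalemxAl [(- l) ^+ k]exprNn [X in _ = X *: _]mulrC.
Qed.

End InvolutiveSymmetry.

(** * Transitivity of the orthogonal group *)

Section RealTransitivity.
Variable R : realType.
Local Notation C := R[i].

(** Two block factorisations of one bordered matrix. *)
Lemma det_reflection n (v : 'cV[R]_n) : v^T *m v = 1%:M -> \det (1%:M - 2 *: (v *m v^T)) = -1.
Proof.
move=> vv.
pose M : 'M[R]_(n + 1) := block_mx 1%:M v (2 *: v^T) 1%:M.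
have E1 : M = block_mx 1%:M 0 (2 *: v^T) 1%:M *m block_mx 1%:M v 0 (- 1%:M).
  rewrite mulmx_block !mul1mx !mul0mx ?mulmx0 !addr0 !mulmx1 -scalemxAl vv.
  by congr block_mx; apply/matrixP => i j; rewrite !mxE; ring.
have E2 : M = block_mx (1%:M - 2 *: (v *m v^T)) v 0 1%:M *m block_mx 1%:M 0 (2 *: v^T) 1%:M.
  rewrite mulmx_block !mul1mx !mul0mx !mulmx0 ?addr0 ?add0r !mulmx1 -scalemxAr.
  by rewrite subrK.
have := congr1 determinant E2; rewrite {1}E1 !det_mulmx !det_lblock !det_ublock !det1 !mul1r !mulr1.
by rewrite det_mx11 !mxE => <-.
Qed.

(** The reflection in the hyperplane orthogonal to v - w. *)
Lemma refl_exists (v w : 'cV[R]_6) : v^T *m v = w^T *m w ->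
  exists h : 'M[R]_6, [/\ O6 h, h *m v = w & forall z : 'cV[R]_6, z^T *m v = z^T *m w -> h *m z = z].
Proof.
move=> vw; have [->|nvw] := eqVneq v w.
  by exists 1%:M; split; rewrite /O6 ?trmx1 ?mul1mx// => z _; rewrite mul1mx.
pose d := v - w.
have d0 : (d^T *m d) 0 0 != 0.
  apply: contra nvw => /eqP d00; rewrite -subr_eq0; apply/eqP/real_norm_eq0.
  by apply/matrixP => i j; rewrite (ord1 i) (ord1 j) -/d d00 mxE.
pose c := 2 / (d^T *m d) 0 0.
have dd : d^T *m d = ((d^T *m d) 0 0)%:M.
  by apply/matrixP => i j; rewrite (ord1 i) (ord1 j) [RHS]mxE.
have hE (z : 'cV[R]_6) : (1%:M - c *: (d *m d^T)) *m z = z - (c * (d^T *m z) 0 0) *: d.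
  rewrite mulmxBl mul1mx -scalemxAl -mulmxA.
  have -> : d^T *m z = ((d^T *m z) 0 0)%:M.
    by apply/matrixP => i j; rewrite (ord1 i) (ord1 j) [RHS]mxE.
  by rewrite mul_mx_scalar scalerA !mxE.
exists (1%:M - c *: (d *m d^T)); split.
- rewrite /O6 trmxB trmx1 trmxZ trmx_mul trmxK mulmxBl !mulmxBr !mul1mx mulmx1.
  rewrite -scalemxAl -scalemxAr mulmxA -(mulmxA d) dd mul_mx_scalar -scalemxAl !scalerA.
  have -> : c * (c * (d^T *m d) 0 0) = c + c by rewrite /c; field.
  by rewrite scalerDl; move: (c *: _) => X; apply/matrixP => i j; rewrite !mxE; ring.
- rewrite hE.
  have -> : c * (d^T *m v) 0 0 = 1.
    have : 2 * (d^T *m v) 0 0 = (d^T *m d) 0 0.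
      have vw0 : v^T *m w = w^T *m v.
        by rewrite -{1}[v^T *m w]trmxK trmx_mul trmxK; apply/matrixP => i j; rewrite mxE (ord1 i) (ord1 j).
      rewrite /d trmxB !mulmxBl !mulmxBr vw0 -vw.
      by move: (v^T *m v) (w^T *m v) => a b; rewrite !mxE; ring.
    by move=> E; rewrite /c mulrAC E divff.
  by rewrite scale1r /d subKr.
- move=> z zvw; rewrite hE.
  have -> : d^T *m z = 0.
    by apply: trmx_inj; rewrite trmx_mul trmxK trmx0 /d mulmxBr zvw subrr.
  by rewrite mxE mulr0 scale0r subr0.
Qed.

(** After a reflection from p1 to q1, the reflection from the image of p2 to q2 fixes q1. *)
Lemma pair_transitive (p1 p2 q1 q2 : 'cV[R]_6) :
  p1^T *m p1 = q1^T *m q1 -> p2^T *m p2 = q2^T *m q2 -> p1^T *m p2 = q1^T *m q2 ->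
  exists h : 'M[R]_6, [/\ O6 h, h *m p1 = q1 & h *m p2 = q2].
Proof.
move=> E11 E22 E12; have [h [hO h1 _]] := refl_exists E11.
have hp (x y : 'cV[R]_6) : (h *m x)^T *m (h *m y) = x^T *m y.
  by rewrite trmx_mul mulmxA -(mulmxA x^T) (hO : h^T *m h = 1%:M) mulmx1.
have [|k [kO k2 kfix]] := @refl_exists (h *m p2) q2; first by rewrite hp.
exists (k *m h); split; first exact: O6M.
- by rewrite -mulmxA h1 kfix// -h1 hp E12 h1.
- by rewrite -mulmxA k2.
Qed.

End RealTransitivity.
(** * The loops of the class of zeta_1 *)

Section LoopsOfZeta1.
Variable R : realType.
Local Notation C := R[i].
Variable u : 'I_3 -> 'cV[C]_6.
Hypothesis hu : isotropic_frame u.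
Local Notation cj := (@mxconj R 6 1).

Lemma isotropic_parts (f : 'cV[C]_6) : f^T *m f = 0 -> (cj f)^T *m f = 1%:M ->
  [/\ (mxRe f)^T *m mxRe f = 2^-1%:M, (mxIm f)^T *m mxIm f = 2^-1%:M &
      (mxRe f)^T *m mxIm f = 0].
Proof.
move=> ff cf.
have RT : mxRe f^T = (mxRe f)^T by apply/matrixP => i j; rewrite !mxE.
have IT : mxIm f^T = (mxIm f)^T by apply/matrixP => i j; rewrite !mxE.
have cRT : mxRe (cj f)^T = (mxRe f)^T by apply/matrixP => i j; rewrite !mxE; case: (f j i).
have cIT : mxIm (cj f)^T = - (mxIm f)^T by apply/matrixP => i j; rewrite !mxE; case: (f j i).
have := congr1 (@mxRe R _ _) ff; have := congr1 (@mxIm R _ _) ff; have := congr1 (@mxRe R _ _) cf.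
rewrite !mxReM mxImM RT IT cRT cIT -mxC1 mxRe_C -mxC0 mxRe_C mxIm_mxC mulNmx opprK => E1 E2 E3.
have RI : (mxIm f)^T *m mxRe f = (mxRe f)^T *m mxIm f.
  rewrite -[LHS]trmxK trmx_mul trmxK; apply/matrixP => i j.
  by rewrite mxE (ord1 i) (ord1 j).
rewrite RI in E2; move: (_^T *m mxRe f) (_^T *m mxIm f) (_^T *m mxIm f) E1 E2 E3 => a c b E1 E2 E3.
split; apply/matrixP => i j; have := congr1 (fun M : 'M[R]_1 => M i j) E1;
  have := congr1 (fun M : 'M[R]_1 => M i j) E2; have := congr1 (fun M : 'M[R]_1 => M i j) E3;
  rewrite !mxE (ord1 i) (ord1 j) /=; lra.
Qed.

(** The real and imaginary parts of normalised isotropic vectors have the same Gram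
matrix, see [isotropic_parts]. The reflection along xi fixes the first frame vector and
corrects the sign of the determinant. *)
Lemma isotropic_transitive (e : 'cV[C]_6) : e^T *m e = 0 -> (cj e)^T *m e = 1%:M ->
  exists2 c, SO6 c & mxC c *m cj (u 0) = e.
Proof.
move=> ee ce.
have [||p1 p2 p3] := @isotropic_parts (cj (u 0)).
- exact: frame_cc.
- by rewrite mxconjK (frame_uc hu) eqxx.
have [q1 q2 q3] := isotropic_parts ee ce.
have [h [hO h1 h2]] : exists h, [/\ O6 h, h *m mxRe (cj (u 0)) = mxRe e & h *m mxIm (cj (u 0)) = mxIm e].
  by apply: pair_transitive; rewrite ?p1 ?p2 ?p3 ?q1 ?q2 ?q3.
have hE : mxC h *m cj (u 0) = e.
  by rewrite [cj (u 0)]mxReIm mulmxDr -scalemxAr -!mxCM h1 h2 -mxReIm.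
have [dh|dh] : \det h = 1 \/ \det h = -1.
  have := det_O6_sqr hO; rewrite -expr2 => /eqP; rewrite sqrf_eq1 => /orP[] /eqP; auto.
  by exists h.
have xx := xi_norm hu; have pO : O6 (1%:M - 2 *: pxi u).
  have -> : 1%:M - 2 *: pxi u = - s0 u by rewrite (s0E hu) opprB.
  by rewrite /O6 [(- _)^T]raddfN /= (s0_tr hu) mulNmx mulmxN opprK (s0_sqr hu).
exists (h *m (1%:M - 2 *: pxi u)).
  split; first exact: O6M.
  by rewrite det_mulmx dh (det_reflection xx) mulrNN mulr1.
rewrite mxCM -mulmxA mxCB mxC1 mxCZ mulmxBl mul1mx -scalemxAl (mulmx_cj u) (pxiE hu) /=.
by rewrite mxconj0 scaler0 subr0.
Qed.

Lemma mxcoefM m n p k (P : 'M[{poly C}]_(m, n)) (Q : 'M[{poly C}]_(n, p)) :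
  mxcoef k (P *m Q) = \sum_(i < k.+1) mxcoef i P *m mxcoef (k - i) Q.
Proof.
apply/matrixP => r s; rewrite !mxE summxE /= poly.coef_sum.
transitivity (\sum_j \sum_(i < k.+1) (P r j)`_i * (Q j s)`_(k - i)).
  by apply: eq_bigr => j _; rewrite coefM.
rewrite exchange_big /=; apply: eq_bigr => i _; rewrite mxE; apply: eq_bigr => j _.
by rewrite !mxE.
Qed.

(** The coefficient of l ^ (-1) in g g^T = 1. *)
Lemma orthogonal_loop_coef (g : C -> 'M[R]_6) (B : nat -> 'M[C]_6) :
  (forall l, circle l -> O6 (g l)) ->
  (forall l, circle l -> mxC (g l) = l ^- 2 *: \sum_(k < 5) l ^+ k *: B k) ->
  B 0%N = 0 -> B 1%N *m (B 2)^T + B 2 *m (B 1%N)^T = 0.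
Proof.
move=> gO gB B0.
pose P : 'M[{poly C}]_6 := \sum_(k < 5) \matrix_(i, j) (B k i j *: 'X^k).
have cP k : mxcoef k P = if (k < 5)%N then B k else 0 by exact: mxcoef_monomials.
have PP : P *m P^T = ('X^4)%:M.
  apply: mxeval_eq => l lc; rewrite mxevalM mxeval_tr (mxeval_monomials 5 B id).
  have l2 : l ^+ 2 != 0 by rewrite expf_neq0// circle_neq0.
  have -> : \sum_(k < 5) l ^+ k *: B k = l ^+ 2 *: mxC (g l) by rewrite gB// scalerA divff// scale1r.
  have gg : g l *m (g l)^T = 1%:M by exact: mulmx1C (gO l lc).
  rewrite trmxZ -scalemxAl -scalemxAr scalerA -mxC_tr -mxCM gg mxC1 -exprD.
  apply/matrixP => i j; rewrite !mxE /horner_eval hornerMn hornerXn.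
  by case: (i == j); rewrite ?mulr1n ?mulr0n ?mulr1 ?mulr0.
have := congr1 (mxcoef 3) PP; rewrite mxcoefM.
have -> : mxcoef 3 ('X^4%:M : 'M[{poly C}]_6) = 0.
  by apply/matrixP => i j; rewrite !mxE /coefp /= coefMn coefXn /= mul0rn.
have cPT k : mxcoef k P^T = (mxcoef k P)^T by apply/matrixP => i j; rewrite !mxE.
rewrite !big_ord_recl big_ord0 !cPT !cP /= /bump /= B0 mul0mx trmx0 mulmx0 add0r !addr0.
by [].
Qed.

Lemma gcoef10 k : gcoef u 1 0 k =
  (k == 3)%N%:R *: (u 0 *m (cj (u 0))^T) + (k == 1)%N%:R *: (cj (u 0) *m (u 0)^T) +
  (k == 2)%N%:R *: (1%:M - cj (u 0) *m (u 0)^T - u 0 *m (cj (u 0))^T).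
Proof.
rewrite /gcoef (bigD1 0)//= -(frame_complete hu) [X in X - _ - _](bigD1 0)//=.
rewrite (eq_bigr (fun j => (k == 2)%N%:R *: (u j *m (cj (u j))^T + cj (u j) *m (u j)^T))); last first.
  move=> j j0; have -> : weight 1 0 j = 0%N by rewrite /weight (negPf j0); case: ifP.
  by rewrite addn0 subn0 scalerDr eq_sym.
rewrite -scaler_sumr; move: (\sum_(i < 3 | _) _) => S; rewrite ![_ == k]eq_sym.
move: (u 0 *m _) (cj (u 0) *m _) (k == 3%N) (k == 1%N) (k == 2%N) => X Y [] [] [];
by apply/matrixP => i j; rewrite !mxE /=; ring.
Qed.

Lemma gcoef10_0 : gcoef u 1 0 0 = 0.
Proof. by rewrite gcoef10 /= !scale0r !addr0. Qed.

Lemma gcoef10_1 : gcoef u 1 0 1 = cj (u 0) *m (u 0)^T.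
Proof. by rewrite gcoef10 /= !scale0r addr0 add0r scale1r. Qed.

Lemma gcoef10_2 : gcoef u 1 0 2 = 1%:M - cj (u 0) *m (u 0)^T - u 0 *m (cj (u 0))^T.
Proof. by rewrite gcoef10 /= !scale0r !add0r scale1r. Qed.

Lemma gcoef10_3 : gcoef u 1 0 3 = u 0 *m (cj (u 0))^T.
Proof. by rewrite gcoef10 /= !scale0r !addr0 scale1r. Qed.

Lemma gcoef10_4 : gcoef u 1 0 4 = 0.
Proof. by rewrite gcoef10 /= !scale0r !addr0. Qed.

(** The lowest coefficient is x y^T with x and y isotropic. Orthogonality of the loop
gives B_2 y = 0, and g(1) = 1 applied to y then gives y = t conj x with t > 0. With
e = sqrt t x, the loop is the conjugate of gamma by an element of SO(6) that carries
the conjugate of u_1 to e. *)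
Lemma zeta1_loop g : Omega_alg g -> U_ (zeta u 1 0) g -> Omega_ (zeta u 1 0) g.
Proof.
move=> gA gU; have [[gS g1 _] _] := gA.
have [B [B1 B2 B3 [h [f [hh ff BE]]]]] := @U_coef R u hu 1 0 g isT isT gA gU.
have B0 : B 0%N = 0 by apply: B3.
have B4 : B 4 = 0 by rewrite -(B2 0%N)// B0 mxconj0.
have topE : top_part u 1 0 = cj (u 0) *m (u 0)^T.
  rewrite /top_part (bigD1 0)//= big1 ?addr0 => [|j j0]; first by rewrite scale1r.
  by rewrite /weight (negPf j0); case: ifP; rewrite scale0r.
pose x := h *m cj (u 0); pose y := f *m u 0.
have XE : B 1%N = x *m y^T by rewrite BE topE /x /y trmx_mul !mulmxA.
have xx : x^T *m x = 0 by rewrite /x trmx_mul mulmxA -(mulmxA _ h^T) hh mulmx1 (frame_cc hu).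
have yy : y^T *m y = 0 by rewrite /y trmx_mul mulmxA -(mulmxA _ f^T) ff mulmx1 (frame_uu hu).
pose v := h *m u 0.
have xv : x^T *m v = 1%:M.
  by rewrite /x /v trmx_mul mulmxA -(mulmxA _ h^T) hh mulmx1 (frame_cu hu) eqxx.
have vx : v^T *m x = 1%:M by rewrite -[v^T *m x]trmxK trmx_mul trmxK xv trmx1.
pose w := f *m cj (u 0).
have wy : w^T *m y = 1%:M.
  by rewrite /w /y trmx_mul mulmxA -(mulmxA _ f^T) ff mulmx1 (frame_cu hu) eqxx.
clearbody x y v w.
(* v is dual to x and turns the relation of coefficients into an equation for B_2 y alone *)
have By : B 2 *m y = 0.
  have gO l : circle l -> O6 (g l) by move=> /gS[].
  have := orthogonal_loop_coef gO B1 B0; rewrite XE trmx_mul trmxK -mulmxA -trmx_mul mulmxA.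
  move: (B 2 *m y) => be E.
  have E1 : x *m (be^T *m v) + be = 0.
    by have := congr1 (fun M => M *m v) E; rewrite mul0mx mulmxDl -!mulmxA xv mulmx1.
  have E2 : be^T *m v + v^T *m be = 0.
    by have := congr1 (fun M => v^T *m M) E1; rewrite mulmx0 mulmxDr mulmxA vx mul1mx.
  have E3 : be^T *m v = 0.
    move: E2; rewrite -[v^T *m be]trmxK trmx_mul trmxK => E2; apply/matrixP => i j.
    have := congr1 (fun M : 'M[C]_1 => M i j) E2; rewrite !mxE (ord1 i) (ord1 j).
    by rewrite -mulr2n => /eqP; rewrite mulrn_eq0 /= => /eqP.
  by move: E1; rewrite E3 mulmx0 add0r.
have sum1 : B 1%N + B 2 + B 3 = 1%:M.
  have c1 : circle (1 : C) by rewrite /circle normr1.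
  have := B1 1 c1; rewrite g1 mxC1 expr1n invr1 scale1r !big_ord_recl big_ord0 /=.
  by rewrite /bump /= !expr1n !scale1r B0 B4 add0r !addr0 addrA => ->.
have Z : B 3 = cj x *m (cj y)^T by rewrite -(B2 1%N)// XE mxconjM mxconj_tr.
pose t : C := ((cj y)^T *m y) 0 0.
have tE : (cj y)^T *m y = t%:M by apply/matrixP => i j; rewrite (ord1 i) (ord1 j) [RHS]mxE.
have yE : y = t *: cj x.
  have := congr1 (fun M => M *m y) sum1.
  by rewrite mul1mx !mulmxDl By XE Z -!mulmxA yy tE mulmx0 !add0r mul_mx_scalar => <-.
have [r r0 tr] : exists2 r : R, 0 <= r & t = r%:C.
  exists (\sum_i (complex.Re (y i 0) ^+ 2 + complex.Im (y i 0) ^+ 2)).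
    by apply: sumr_ge0 => i _; rewrite addr_ge0 ?sqr_ge0.
  rewrite /t mxE rmorph_sum; apply: eq_bigr => i _; rewrite !mxE; case: (y i 0) => p q.
  by apply/eqP; rewrite eq_complex /=; apply/andP; split; apply/eqP; ring.
have tx : t *: (x^T *m cj x) = 1%:M.
  have := congr1 (fun M => w^T *m M) yE; rewrite wy => E; have t0 : t != 0.
    apply/eqP => t0; move: E; rewrite t0 scale0r mulmx0 => /(congr1 (fun M : 'M[C]_1 => M 0 0)).
    by rewrite !mxE /= => /eqP; rewrite oner_eq0.
  apply: (scalerI t0); have := tE; rewrite yE mxconjZ mxconjK trmxZ -scalemxAl -scalemxAr.
  by rewrite {1 2}tr conjc_real -tr => ->; rewrite scale_scalar_mx mulr1.
pose s : C := (Num.sqrt r)%:C.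
have ss : s * s = t by rewrite /s -rmorphM /= -expr2 sqr_sqrtr// tr.
have cs : conjc s = s by exact: conjc_real.
pose e := s *: x.
have [||c cS ce] := @isotropic_transitive e.
- by rewrite /e trmxZ -scalemxAl -scalemxAr xx !scaler0.
- rewrite /e mxconjZ cs trmxZ -scalemxAl -scalemxAr scalerA ss.
  by rewrite -[LHS]trmxK trmxZ trmx_mul trmxK tx trmx1.
have [cO _] := cS; have [_ ci] := O6_unit cO.
have ce' : mxC c *m u 0 = cj e by rewrite -ce mxconjM mxconjC mxconjK.
have B1E : B 1%N = e *m (cj e)^T.
  by rewrite XE yE trmxZ -scalemxAr /e mxconjZ cs trmxZ -scalemxAl -scalemxAr scalerA ss.
have B3E : B 3 = cj e *m e^T by rewrite -(B2 1%N)// B1E mxconjM mxconj_tr mxconjK.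
exists c => // l lc; apply: mxC_inj; rewrite B1// /Ad ci !mxCM (gamma_gcoef hu)//.
rewrite -scalemxAr -scalemxAl mulmx_sumr mulmx_suml; congr (_ *: _); apply: eq_bigr => k _.
rewrite -scalemxAr -scalemxAl; congr (_ *: _).
have G1 : mxC c *m (cj (u 0) *m (u 0)^T) *m mxC c^T = B 1%N.
  by rewrite mulmxA ce -mulmxA mxC_tr -trmx_mul ce' B1E.
have G3 : mxC c *m (u 0 *m (cj (u 0))^T) *m mxC c^T = B 3.
  by rewrite mulmxA ce' -mulmxA mxC_tr -trmx_mul ce B3E.
have cc : mxC c *m mxC c^T = 1%:M by rewrite -mxCM (mulmx1C (cO : c^T *m c = 1%:M)) mxC1.
case: k => -[|[|[|[|[|//]]]]] /= _; rewrite ?B0 ?B4.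
- by rewrite gcoef10_0 mulmx0 mul0mx.
- by rewrite gcoef10_1 G1.
- rewrite gcoef10_2 !mulmxBr !mulmxBl mulmx1 cc G1 G3 -sum1.
  by move: (B 1%N) (B 2) (B 3) => X Y W; apply/matrixP => i j; rewrite !mxE; ring.
- by rewrite gcoef10_3 G3.
- by rewrite gcoef10_4 mulmx0 mul0mx.
Qed.

End LoopsOfZeta1.

(** * Bundles of an invariant solution *)

Section BundlesOfASolution.
Variable R : realType.
Local Notation C := R[i].
Variable u : 'I_3 -> 'cV[C]_6.
Hypothesis hu : isotropic_frame u.
Variables (a b : nat) (Phi : sphere R -> C -> 'M[R]_6) (D : set (sphere R)) (s P0 : 'M[R]_6).
Hypotheses (ba : (b <= a <= 2)%N) (a0 : (0 < a)%N).
Hypothesis Psol : extended_solution Phi.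
Hypothesis Palg : forall p, Omega_alg (Phi p).
Hypothesis dD : discrete_set D.
Hypothesis PU : forall p, ~ D p -> U_ (zeta u a b) (Phi p).
Hypothesis PO : forall p, ~ D p -> Omega_ (zeta u a b) (Phi p).
Hypothesis PT : forall p, ~ D p -> Omega_tau (fun g => s *m g *m s) (Phi p).
Hypotheses (sE : s = 2 *: P0 - 1%:M) (P0P0 : P0 *m P0 = P0) (P0T : P0^T = P0).

Local Notation A k p := (cf (Phi p) k).
Local Notation Pi := (mxC P0).

Let five := coef_five hu ba a0 Psol Palg dD PU.
Let AC := coef_conj hu ba a0 Psol Palg dD PU.
Let AM := S1_coefM hu ba Psol dD PO.
Let AT := S1_coef_tr hu ba Psol dD PO.

Lemma refl_tr : s^T = s.
Proof. by rewrite sE trmxB trmxZ P0T trmx1. Qed.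

Lemma refl_sqr : s *m s = 1%:M.
Proof.
rewrite sE mulmxBl mulmxBr !mulmx1 mul1mx -scalemxAl -scalemxAr P0P0.
by apply/matrixP => i j; rewrite !mxE; ring.
Qed.

Lemma coef_sumE p : A 0 p + A 1 p + A 2 p + A 3 p + A 4 p = 1%:M.
Proof.
rewrite -(cf_sum1 Palg five p) !big_ord_recl big_ord0 /= /bump /= addr0 !addn0.
by rewrite !addrA.
Qed.

Lemma coef_commute_P0 p k : (k < 5)%N -> Pi *m A k p = A k p *m Pi.
Proof.
move=> k5.
have sPhi q : ~ D q -> forall l, circle l -> s *m (Phi q (- l) *m (Phi q (-1))^T) *m s = Phi q l.
  move=> nD l lc; have [_ /(_ l lc) E] := PT nD; rewrite -[RHS]E.
  have [[+ _ _] _] := Palg q => /(_ (-1))[|qO _]; first by rewrite /circle normrN normr1.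
  by have [_ ->] := O6_unit qO.
have := coef_commute Psol Palg dD five AM AT refl_tr refl_sqr sPhi p k5.
rewrite sE mxCB mxCZ mxC1 mulmxBl mulmxBr mul1mx mulmx1 -scalemxAl -scalemxAr.
move=> /(congr1 (fun M => M + A k p)); rewrite !subrK; apply: scalerI.
by apply/eqP => -[/eqP]; rewrite pnatr_eq0.
Qed.

Lemma coef_at_minus1E p : mxC (Phi p (-1)) = 1%:M - 2 *: (A 1 p + A 3 p).
Proof.
rewrite (coef_at_minus1 five) !big_ord_recl big_ord0 /= /bump /= !addn0 -(coef_sumE p).
by apply/matrixP => i j; rewrite !mxE !exprS expr0; ring.
Qed.

Lemma coef_idem p k : (k < 5)%N -> A k p *m A k p = A k p.
Proof. by move=> k5; rewrite AM// eqxx. Qed.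

Lemma coef_orth p j k : (j < 5)%N -> (k < 5)%N -> j != k -> A j p *m A k p = 0.
Proof. by move=> j5 k5 /negPf jk; rewrite AM// jk. Qed.

Lemma coef_rank p k r : (k < 5)%N ->
  \sum_j ((2 + weight a b j == k)%N + (2 - weight a b j == k)%N)%N = r -> \rank (A k p) = r.
Proof.
move=> k5 <-; have := S1_coef_trace hu ba Psol dD PO p k5; rewrite (idem_trace (coef_idem p k5)).
have -> : \sum_j ((2 + weight a b j == k)%N%:R + (2 - weight a b j == k)%N%:R) =
   (\sum_j ((2 + weight a b j == k)%N + (2 - weight a b j == k)%N)%N)%:R :> C.
  by rewrite natr_sum; apply: eq_bigr => j _; rewrite natrD.
by move=> /eqP; rewrite eqr_nat => /eqP.
Qed.

(** The derivative of Q in the conjugate variable has its image in that of X, hence in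
that of Q. *)
Lemma image_holo (Q X : sphere R -> 'M[C]_6) r : bsmooth Q -> (forall p, Q p *m Q p = Q p) ->
  (forall p, \rank (Q p) = r) -> (forall p, Q p *m X p = X p) ->
  (forall c z, exists be, d_zbar (fun w => Q (chart c w)) z = X (chart c z) *m be) ->
  holo_subbundle r (fun p => colspace (Q p)).
Proof.
move=> sQ QQ rQ QX dQ; apply: holo_subbundle_of_projection => // c z.
by have [be ->] := dQ c z; rewrite mulmxA mulmxBl mul1mx QX subrr mul0mx.
Qed.

Lemma bsmooth_coef k : bsmooth (fun p => A k p).
Proof. exact: bsmooth_cf. Qed.

Let eqns := coef_equations hu ba a0 Psol Palg dD PU.

(** In the lowest degree the term A_(k-1) of the equation drops out. *)
Lemma lowest_dzbar k c z : (k < 4)%N -> (forall p, (0 < k)%N -> A k.-1 p = 0) ->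
  exists be, d_zbar (fun w => A k (chart c w)) z = A k (chart c z) *m be.
Proof.
move=> k4 low; have [al [be /(_ z)[_ E]]] := eqns c; exists (2^-1 *: be z).
rewrite E; last exact: ltnW.
rewrite -scalemxAr; congr (_ *: (_ *m _)).
by case: (k) low => [|k'] low; rewrite ?subr0// low// subr0.
Qed.

Lemma lowest_dz k c z : (k < 4)%N ->
  exists al, d_z (fun w => A k (chart c w)) z = (A k (chart c z) - A k.+1 (chart c z)) *m al.
Proof.
move=> k4; have [al [be /(_ z)[E _]]] := eqns c; exists (2^-1 *: al z).
by rewrite E// -scalemxAr.
Qed.

(** The sum of the first two equations telescopes. *)
Lemma sum01_d c z : exists al be,
  d_z (fun w => A 0 (chart c w) + A 1 (chart c w)) z = (A 0 (chart c z) - A 2 (chart c z)) *m al /\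
  d_zbar (fun w => A 0 (chart c w) + A 1 (chart c w)) z = A 1 (chart c z) *m be.
Proof.
have [al [be /(_ z)[E1 E2]]] := eqns c; exists (2^-1 *: al z), (2^-1 *: be z).
have [_ -> ->] := pdiff2D (bsmooth_pdiff2 (bsmooth_coef 0) c z) (bsmooth_pdiff2 (bsmooth_coef 1) c z).
rewrite (E1 0%N)// (E1 1%N)// (E2 0%N)// (E2 1%N)// subr0 -!scalerDr -!mulmxDl -!scalemxAr.
split; congr (_ *: (_ *m _)).
  by rewrite addrA subrK.
by rewrite addrC subrK.
Qed.

Lemma sum01_idem p : (A 0 p + A 1 p) *m (A 0 p + A 1 p) = A 0 p + A 1 p.
Proof. by rewrite mulmxDl !mulmxDr !AM//= addr0 add0r. Qed.

Lemma sum01_rank p r : \rank (A 0 p) = r -> \rank (A 1 p) = r -> \rank (A 0 p + A 1 p)%R = r.*2.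
Proof.
move=> r0 r1; have := esym (idem_trace (sum01_idem p)).
rewrite mxtraceD (idem_trace (@coef_idem p 0 isT)) (idem_trace (@coef_idem p 1 isT)) r0 r1 -natrD addnn.
by move=> /eqP; rewrite eqr_nat => /eqP.
Qed.

Lemma memv_one_sub (N : 'M[C]_6) v : N *m v = 0 -> v \in colspace (1%:M - N).
Proof. by move=> Nv; apply/memv_colspace; exists v; rewrite mulmxBl mul1mx Nv subr0. Qed.

Lemma hperp_conjv (Q : 'M[C]_6) : Q *m Q = Q -> hperp (conjv (colspace Q)) = colspace (1%:M - Q^T).
Proof. by move=> QQ; rewrite /hperp !conjv_colspace mxconjK annih_colspace. Qed.

(** This expands (1 - 2 B) (2 P - 1) with B = A_1 + A_3: a reflection, because B and P
commute. *)
Lemma refl_at_minus1 p : mxC (Phi p (-1) *m s) =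
  2 *: (Pi - (A 1 p + A 3 p) *m Pi *+ 2 + (A 1 p + A 3 p)) - 1%:M.
Proof.
rewrite mxCM coef_at_minus1E sE mxCB mxCZ mxC1 mulmxBr mulmx1 mulmxBl mul1mx -scalemxAr -scalemxAl.
have -> : (2 : R)%:C = 2 :> C by apply/eqP; rewrite eq_complex /= addr0 !eqxx.
rewrite mulr2n; move: (A 1 p + A 3 p) Pi => B Q; move: (B *m Q) => X.
by apply/matrixP => i j; rewrite !mxE; ring.
Qed.

Local Notation T a b := (mexp (pi *: zeta u a b)).

(** The identification expresses the same reflection by g s_1 g^T; K collects the torus
elements that occur in it. *)
Lemma identified_proj z z' W p c d K : mexp (pi *: (z' - z)) = T c d ->
  identified u z z' W (Phi p (-1)) -> T c d *m T 1 0 = K -> K^T = K -> K *m K = 1%:M -> s1 u *m K = s ->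
  exists2 g, SO6 g & W = act g (x0 u) /\
    mxC (K *m (g *m px u *m g^T) *m K) = Pi - (A 1 p + A 3 p) *m Pi *+ 2 + (A 1 p + A 3 p).
Proof.
move=> ET /(identifiedE hu _ _ ET)[g gS [-> qE]] KE KT KK sK; exists g => //; split => //.
have [gO _] := gS.
have qs : Phi p (-1) *m s = 2 *: (K *m (g *m px u *m g^T) *m K) - 1%:M.
  rewrite qE KE -sK mulmxA -(mulmxA _ (s1 u) (s1 u)) (s1_sqr hu) mulmx1 (s1E hu).
  have gg := mulmx1C (gO : g^T *m g = 1%:M).
  rewrite (mulmxBr g) mulmx1 -scalemxAr mulmxBl gg -scalemxAl mulmxBr mulmx1 mulmxBl KK.
  by rewrite -scalemxAr -scalemxAl.
have := refl_at_minus1 p; rewrite qs mxCB mxCZ mxC1.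
have -> : (2 : R)%:C = 2 :> C by apply/eqP; rewrite eq_complex /= addr0 !eqxx.
move=> /(congr1 (fun M => M + 1%:M)); rewrite !subrK; apply: scalerI.
by rewrite pnatr_eq0.
Qed.

Lemma identified_refl z z' W p c d K : mexp (pi *: (z' - z)) = T c d ->
  identified u z z' W (Phi p (-1)) -> T c d *m T 1 0 = K -> K^T = K -> K *m K = 1%:M -> s1 u *m K = s ->
  cplx (act K W) = colspace (Pi - (A 1 p + A 3 p) *m Pi *+ 2 + (A 1 p + A 3 p)).
Proof.
move=> ET idn KE KT KK sK; have [g [gO _] [-> <-]] := identified_proj ET idn KE KT KK sK.
have [actE _ _ _ _] := annih_act_x0 hu gO.
rewrite actE act_colspace -(@colspace_mulr _ (K *m _) K) ?cplx_colspace//.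
by have [] := O6_unit (_ : O6 K); rewrite /O6 ?KT.
Qed.

End BundlesOfASolution.

(** * Symmetry under the reflection in V_0 *)

Section ReflectionInALine.
Variable R : realType.
Local Notation C := R[i].
Variable u : 'I_3 -> 'cV[C]_6.
Hypothesis hu : isotropic_frame u.
Variables (a b : nat) (Phi : sphere R -> C -> 'M[R]_6) (D : set (sphere R)).
Hypotheses (ba : (b <= a <= 2)%N) (a0 : (0 < a)%N).
Hypothesis Psol : extended_solution Phi.
Hypothesis Palg : forall p, Omega_alg (Phi p).
Hypothesis dD : discrete_set D.
Hypothesis PU : forall p, ~ D p -> U_ (zeta u a b) (Phi p).
Hypothesis PO : forall p, ~ D p -> Omega_ (zeta u a b) (Phi p).
Hypothesis PT : forall p, ~ D p -> Omega_tau (sigma u) (Phi p).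

Local Notation A k p := (cf (Phi p) k).
Local Notation Pi := (mxC (pxi u)).
Local Notation T a b := (mexp (pi *: zeta u a b)).

Lemma PT0 p : ~ D p -> Omega_tau (fun g => s0 u *m g *m s0 u) (Phi p).
Proof.
move=> nD; have := PT nD; have -> // : sigma u = fun g => s0 u *m g *m s0 u.
by apply/funext => g; rewrite (sigmaE hu).
Qed.

Let AC := coef_conj hu ba a0 Psol Palg dD PU.
Let AT := S1_coef_tr hu ba Psol dD PO.
Let orth := coef_orth hu ba Psol dD PO.
Let idem := coef_idem hu ba Psol dD PO.
Let comm := coef_commute_P0 hu ba a0 Psol Palg dD PU PO PT0 (s0E hu) (pxi_idem hu) (pxi_tr u).

Lemma Pi_idem : Pi *m Pi = Pi.
Proof. by rewrite -mxCM (pxi_idem hu). Qed.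

(** Commuting with the projection onto the line of xi, A_k acts there as a scalar t, and
so does its transpose A_(4-k). Their product is 0, hence t ^ 2 = 0. *)
Lemma coef_xi p k : (k < 5)%N -> k != 2%N -> A k p *m Pi = 0.
Proof.
move=> k5 k2; have k5' : (4 - k < 5)%N by lia.
pose t := (mxC (xi u)^T *m A k p *m mxC (xi u)) 0 0.
have tE : A k p *m Pi = t *: Pi.
  rewrite -{1}Pi_idem mulmxA -comm// /pxi mxCM -!mulmxA.
  rewrite (mulmxA (A k p)) (mulmxA (mxC (xi u)^T) (_ *m _)) (mulmxA (mxC (xi u)^T) (A k p)).
  have -> : mxC (xi u)^T *m A k p *m mxC (xi u) = t%:M.
    by apply/matrixP => i j; rewrite (ord1 i) (ord1 j) [RHS]mxE.
  by rewrite mul_scalar_mx -scalemxAr.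
have tE' : A (4 - k)%N p *m Pi = t *: Pi.
  have := congr1 trmx tE; rewrite trmx_mul trmxZ -mxC_tr (pxi_tr u) AT// => <-.
  exact/esym/comm.
have : A k p *m (A (4 - k)%N p *m Pi) = 0.
  by rewrite mulmxA orth ?mul0mx//; lia.
rewrite tE' -scalemxAr tE scalerA => tt0.
have : t = 0.
  have := congr1 (fun M => (mxC (xi u))^T *m M *m mxC (xi u)) tt0.
  rewrite mulmx0 mul0mx -scalemxAr -scalemxAl -mxC_tr -!mxCM /pxi !mulmxA (xi_norm hu) mul1mx (xi_norm hu).
  move=> /(congr1 (fun M : 'M[C]_1 => M 0 0)); rewrite !mxE /= mulr1 => /eqP.
  by rewrite mulf_eq0 orbb => /eqP.
by move=> ->; rewrite scale0r.
Qed.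

Lemma xi_coef p k : (k < 5)%N -> k != 2%N -> Pi *m A k p = 0.
Proof. by move=> k5 k2; rewrite comm// coef_xi. Qed.

Lemma projection_identified z z' W p : mexp (pi *: (z' - z)) = T 0 0 ->
  identified u z z' W (Phi p (-1)) -> cplx (act (T 1 0) W) = colspace (Pi + A 1 p + A 3 p).
Proof.
move=> ET idn; have T0 : T 0 0 = 1%:M.
  by rewrite (mexp_pi_zeta hu) -(tdiag1 hu); apply: tdiag_eq => j; rewrite /weight; case: ifP => // _; case: ifP.
have KE : T 0 0 *m T 1 0 = T 1 0 by rewrite T0 mul1mx.
have sK : s1 u *m T 1 0 = s0 u by rewrite (s1_T hu) (T_s0 hu) -mulmxA (T_sqr hu) mulmx1.
rewrite (identified_refl hu ba a0 Psol Palg dD PU (s0E hu) ET idn KE (T_tr hu 1 0) (T_sqr hu 1 0) sK).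
by rewrite mulmxDl !coef_xi// addr0 mul0rn subr0 addrA.
Qed.

Lemma cplx_annih_V0 : cplx (annih (V0 u)) = colspace (1%:M - Pi).
Proof. by rewrite (V0E hu) (annih_colspace (pxi_idem hu)) (pxi_tr u) cplx_colspace mxCB mxC1. Qed.

Lemma cplx_V0 : cplx (V0 u) = colspace Pi.
Proof. by rewrite (V0E hu) cplx_colspace. Qed.

Lemma sub_annih_V0 (Q : 'M[C]_6) : Pi *m Q = 0 -> (colspace Q <= cplx (annih (V0 u)))%VS.
Proof. by move=> PQ; rewrite cplx_annih_V0; apply: colspace_sub; rewrite mulmxBl mul1mx PQ subr0. Qed.

Lemma decomposes_A1 p : decomposes (colspace (Pi + A 1 p + A 3 p)) (cplx (V0 u)) (colspace (A 1 p)).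
Proof.
have c1 : mxconj (A 1 p) = A 3 p by rewrite AC.
rewrite cplx_V0 -c1; apply: decomposes_colspace; rewrite ?c1 ?Pi_idem ?idem ?orth ?xi_coef ?coef_xi//.
exact: mxconjC.
Qed.

(** A_1 is the lowest coefficient here, so its image is holomorphic. The space orthogonal
to the conjugate of this image is the kernel of A_1^T = A_3, and A_3 annihilates the
derivative (A_1 - A_2) al of A_1. *)
Lemma line_bundle : a = 1%N -> b = 0%N ->
  [/\ holo_subbundle 1 (fun p => colspace (A 1 p)), isotropic_bundle (fun p => colspace (A 1 p)),
      subbundle_of (fun p => colspace (A 1 p)) (cplx (annih (V0 u))) &
      d_sub (fun p => colspace (A 1 p)) (fun p => hperp (conjv (colspace (A 1 p))))].
Proof.
move=> aE bE.
have A0 p : A 0 p = 0 by apply: (coef_low hu ba a0 Psol Palg dD PU); rewrite aE.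
split.
- apply: (@image_holo _ _ (fun p => A 1 p)) => [||p|p|c z].
  + exact: bsmooth_cf.
  + by move=> p; exact: idem.
  + apply: (coef_rank hu ba Psol dD PO) => //.
    by rewrite aE bE !big_ord_recl big_ord0.
  + exact: idem.
  + exact: (lowest_dzbar hu ba a0 Psol Palg dD PU).
- by move=> p; apply: isotropic_colspace; rewrite AT// orth.
- by move=> p; apply: sub_annih_V0; rewrite xi_coef.
- apply: (@d_sub_colspace _ (fun p => A 1 p) (fun p => A 3 p)) => [|p|p|c z|p v Nv].
  + exact: bsmooth_cf.
  + exact: idem.
  + exact: orth.
  + have [al ->] := @lowest_dz R u hu a b Phi D ba a0 Psol Palg dD PU 1%N c z isT.
    by rewrite mulmxA mulmxBr !orth// subr0 mul0mx.
  + by rewrite hperp_conjv ?idem// AT//; exact: memv_one_sub.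
Qed.

Lemma plane_meets_perp p :
  (colspace (A 0 p + A 1 p) :&: hperp (colspace (A 0 p)))%VS = colspace (A 1 p).
Proof.
have c0 : (A 0 p)^T = mxconj (A 0 p) by rewrite AT// AC.
rewrite (hperp_colspace c0 (idem p (k := 0) isT)).
have i0 : (1%:M - A 0 p) *m (1%:M - A 0 p) = 1%:M - A 0 p.
  by rewrite mulmxBl mul1mx mulmxBr mulmx1 idem// subrr subr0.
have E1 : (A 0 p + A 1 p) *m (1%:M - A 0 p) = A 1 p.
  by rewrite mulmxBr mulmx1 mulmxDl idem// orth// addr0 addrAC subrr add0r.
have E2 : (1%:M - A 0 p) *m (A 0 p + A 1 p) = A 1 p.
  by rewrite mulmxBl mul1mx mulmxDr idem// orth// addr0 addrAC subrr add0r.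
by rewrite (colspaceI (sum01_idem hu ba Psol dD PO p) i0) ?E1 ?E2.
Qed.

(** V and W are the images of the spectral projections A_0 and A_0 + A_1 for the two
lowest weights; each differential condition is an equation for the coefficients
multiplied by a complementary projection. *)
Lemma flag_bundles : a = 2%N -> b = 1%N ->
  let V := fun p => colspace (A 0 p) in let W := fun p => colspace (A 0 p + A 1 p) in
  [/\ [/\ holo_subbundle 1 V, isotropic_bundle V & subbundle_of V (cplx (annih (V0 u)))],
      [/\ holo_subbundle 2 W, isotropic_bundle W & subbundle_of W (cplx (annih (V0 u)))],
      (forall p, (V p <= W p)%VS) &
      d_sub V W /\ d_sub W (fun p => hperp (conjv (W p)))].
Proof.
move=> aE bE V W.
have S2 p : (A 0 p + A 1 p) *m (A 0 p + A 1 p) = A 0 p + A 1 p := sum01_idem hu ba Psol dD PO p.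
have ST p : (A 0 p + A 1 p)^T = A 4 p + A 3 p by rewrite trmxD !AT.
have r0 p : \rank (A 0 p) = 1%N.
  by apply: (coef_rank hu ba Psol dD PO) => //; rewrite aE bE !big_ord_recl big_ord0.
have r1 p : \rank (A 1 p) = 1%N.
  by apply: (coef_rank hu ba Psol dD PO) => //; rewrite aE bE !big_ord_recl big_ord0.
have sS : bsmooth (fun p => A 0 p + A 1 p).
  by apply: (@bsmoothD _ _ _ (fun p => A 0 p) (fun p => A 1 p)); exact: bsmooth_cf.
have SA0 p : (A 0 p + A 1 p) *m A 0 p = A 0 p by rewrite mulmxDl idem// orth// addr0.
have SA1 p : (A 0 p + A 1 p) *m A 1 p = A 1 p by rewrite mulmxDl idem// orth// add0r.
split; [split|split|..].
- apply: (@image_holo _ _ (fun p => A 0 p)) => [||p|p|c z].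
  + exact: bsmooth_cf.
  + by move=> p; exact: idem.
  + exact: r0.
  + exact: idem.
  + exact: (lowest_dzbar hu ba a0 Psol Palg dD PU).
- by move=> p; apply: isotropic_colspace; rewrite AT// orth.
- by move=> p; apply: sub_annih_V0; rewrite xi_coef.
- apply: (@image_holo _ _ (fun p => A 1 p)) => [||p|p|c z].
  + exact: sS.
  + exact: S2.
  + exact: (sum01_rank hu ba Psol dD PO (r0 p) (r1 p)).
  + exact: SA1.
  + by have [al [be [_ E]]] := sum01_d hu ba a0 Psol Palg dD PU c z; exists be.
- move=> p; apply: isotropic_colspace.
  by rewrite ST mulmxDl !mulmxDr !orth// !addr0.
- by move=> p; apply: sub_annih_V0; rewrite mulmxDr !xi_coef// addr0.
- by move=> p; apply: colspace_sub.
split.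
- apply: (@d_sub_colspace _ (fun p => A 0 p) (fun p => 1%:M - (A 0 p + A 1 p))) => [|p|p|c z|p v Nv].
  + exact: bsmooth_cf.
  + exact: idem.
  + by rewrite mulmxBl mul1mx SA0 subrr.
  + have [al ->] := @lowest_dz R u hu a b Phi D ba a0 Psol Palg dD PU 0%N c z isT.
    by rewrite mulmxA mulmxBl mul1mx mulmxBr SA0 SA1 subrr mul0mx.
  + by have := memv_one_sub Nv; rewrite subKr.
- apply: (@d_sub_colspace _ (fun p => A 0 p + A 1 p) (fun p => A 4 p + A 3 p)) => [|p|p|c z|p v Nv].
  + exact: sS.
  + exact: S2.
  + by rewrite mulmxDl !mulmxDr !orth// !addr0.
  + have [al [be [-> _]]] := sum01_d hu ba a0 Psol Palg dD PU c z.
    by rewrite mulmxA mulmxDl !mulmxBr !orth// !subr0 addr0 mul0mx.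
  + by rewrite hperp_conjv// ST; exact: memv_one_sub.
Qed.

End ReflectionInALine.

(** * Symmetry under the reflection in x_0 *)

Section ReflectionInX0.
Variable R : realType.
Local Notation C := R[i].
Variable u : 'I_3 -> 'cV[C]_6.
Hypothesis hu : isotropic_frame u.
Variables (Phi : sphere R -> C -> 'M[R]_6) (D : set (sphere R)).
Hypothesis Psol : extended_solution Phi.
Hypothesis Palg : forall p, Omega_alg (Phi p).
Hypothesis dD : discrete_set D.
Hypothesis PU : forall p, ~ D p -> U_ (zeta u 1 1) (Phi p).
Hypothesis PO : forall p, ~ D p -> Omega_ (zeta u 1 1) (Phi p).
Hypothesis PT : forall p, ~ D p -> Omega_tau (sigma1 u) (Phi p).

Local Notation A k p := (cf (Phi p) k).
Local Notation Pi := (mxC (px u)).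
Local Notation Pj := (1%:M - mxC (px u)).
Local Notation T a b := (mexp (pi *: zeta u a b)).

Lemma PT1 p : ~ D p -> Omega_tau (fun g => s1 u *m g *m s1 u) (Phi p).
Proof.
move=> nD; have := PT nD; have -> // : sigma1 u = fun g => s1 u *m g *m s1 u.
by apply/funext => g; rewrite (sigma1E hu).
Qed.

Let ba : (1 <= 1 <= 2)%N := isT.
Let a0 : (0 < 1)%N := isT.
Let AC := coef_conj hu ba a0 Psol Palg dD PU.
Let AT := S1_coef_tr hu ba Psol dD PO.
Let orth := coef_orth hu ba Psol dD PO.
Let idem := coef_idem hu ba Psol dD PO.
Let comm := coef_commute_P0 hu ba a0 Psol Palg dD PU PO PT1 (s1E hu) (px_idem hu) (px_tr u).

Lemma px_idemC : Pi *m Pi = Pi.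
Proof. by rewrite -mxCM (px_idem hu). Qed.

Lemma px_compl_idem : Pj *m Pj = Pj.
Proof. by rewrite mulmxBl mul1mx mulmxBr mulmx1 px_idemC subrr subr0. Qed.

Lemma px_compl0 : Pi *m Pj = 0 /\ Pj *m Pi = 0.
Proof. by rewrite mulmxBr mulmxBl mulmx1 mul1mx px_idemC subrr. Qed.

Let B p := A 1 p + A 3 p.

Lemma projection_identified1 z z' W p : mexp (pi *: (z' - z)) = T 1 0 ->
  identified u z z' W (Phi p (-1)) -> exists2 g, SO6 g & W = act g (x0 u) /\
    mxC (g *m px u *m g^T) = (1%:M - B p) *m Pi + B p *m Pj.
Proof.
move=> ET idn.
have KE : T 1 0 *m T 1 0 = 1%:M by exact: T_sqr.
have [g gS [WE E]] := identified_proj hu ba a0 Psol Palg dD PU (s1E hu) ET idn KE (trmx1 _ _) (mulmx1 _) (mulmx1 _).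
exists g => //; split => //; move: E; rewrite mul1mx mulmx1 => ->.
rewrite mulr2n mulmxBl mul1mx mulmxBr mulmx1 -/(B p).
move: (B p) Pi => X Q; move: (X *m Q) => Y.
by apply/matrixP => i j; rewrite !mxE; ring.
Qed.

Lemma coef_low11 p : A 0 p = 0.
Proof. by apply: (coef_low hu ba a0 Psol Palg dD PU). Qed.

(** Applied to the projections onto x_0 and onto its complement: commuting with A_1, they
split its image of rank 2 into two lines and preserve the equation for d_zbar A_1. *)
Lemma half_line_bundle (Q : 'M[C]_6) : Q *m Q = Q -> Q^T = Q ->
  (forall p k, (k < 5)%N -> Q *m A k p = A k p *m Q) ->
  (forall p, \tr (A 1 p *m Q) = 1) ->
  holo_subbundle 1 (fun p => colspace (A 1 p *m Q)) /\ isotropic_bundle (fun p => colspace (A 1 p *m Q)).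
Proof.
move=> QQ QT QA trQ.
have iQ p : A 1 p *m Q *m (A 1 p *m Q) = A 1 p *m Q.
  by rewrite -mulmxA (mulmxA Q) QA// -(mulmxA (A 1 p)) QQ mulmxA idem.
split.
- apply: (@image_holo _ _ (fun p => A 1 p *m Q)) => [||p|p|c z].
  + by apply: (@bsmooth_mulr _ _ _ _ (fun p => A 1 p)); exact: bsmooth_cf.
  + exact: iQ.
  + by have := trQ p; rewrite (idem_trace (iQ p)) => /eqP; rewrite -[1]/(1%N%:R) eqr_nat => /eqP.
  + exact: iQ.
  + have [be E] := @lowest_dzbar R u hu 1 1 Phi D ba a0 Psol Palg dD PU 1%N c z isT (fun p _ => coef_low11 p).
    have dA := bsmooth_pdiff2 (@bsmooth_cf R Phi Psol 1) c z.
    have -> : (fun w => A 1 (chart c w) *m Q) = (fun w => Q *m A 1 (chart c w) *m Q).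
      by apply/funext => w; rewrite QA// -mulmxA QQ.
    have [d0 _ e0] := @pdiff2_cst R 5 5 Q z.
    have [d1 _ e1] := pdiff2_mulmx d0 dA.
    have [_ _ ->] := pdiff2_mulmx d1 d0.
    rewrite e1 e0 E mul0mx add0r mulmx0 addr0; exists (be *m Q).
    by rewrite mulmxA QA// !mulmxA.
- move=> p; apply: isotropic_colspace.
  rewrite trmx_mul QT AT// -mulmxA (mulmxA (A _ p)) orth//.
  by rewrite mul0mx mulmx0.
Qed.

Lemma trace_px : \tr Pi = 3.
Proof.
rewrite /px mxCD (mxC_unit_op u) conjc1 !scale1r !mxtraceD (mxtrace_mulC (u 0)) (mxtrace_mulC (mxconj _)).
rewrite (frame_cu hu) (frame_uc hu) eqxx mxtrace1 /pxi mxCM mxtrace_mulC -mxCM (xi_norm hu) mxC1 mxtrace1.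
by ring.
Qed.

(** The projection (1 - B) P + B (1 - P) has rank 3, as x_0. Since A_1 and A_3 have trace
2, this reads 7 - 4 tr (A_1 P) = 3. *)
Lemma traces p W z z' : mexp (pi *: (z' - z)) = T 1 0 -> identified u z z' W (Phi p (-1)) ->
  \tr (A 1 p *m Pi) = 1 /\ \tr (A 1 p *m Pj) = 1.
Proof.
move=> ET idn; have [g [gO _] [_ E]] := projection_identified1 ET idn.
have trA k : (k < 5)%N -> k = 1%N \/ k = 3 -> \tr (A k p) = 2.
  move=> k5 [->|->]; rewrite (S1_coef_trace hu ba Psol dD PO)// !big_ord_recl big_ord0 /=; ring.
have t3 : \tr (A 3 p *m Pi) = \tr (A 1 p *m Pi).
  by rewrite -mxtrace_tr trmx_mul AT// -mxC_tr (px_tr u) comm.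
have : \tr (mxC (g *m px u *m g^T)) = 3.
  by rewrite mxCM mxtrace_mulC -mxCM mulmxA (gO : g^T *m g = 1%:M) mul1mx trace_px.
rewrite E /B mxtraceD mulmxBl mul1mx raddfB /= mulmxDl mxtraceD t3 trace_px mulmxBr mulmx1 raddfB /=.
rewrite mulmxDl !mxtraceD t3 !trA; [|auto..].
rewrite mulmxBr mulmx1 raddfB /= trA; [|auto..].
move: (\tr (A 1 p *m Pi)) => t E1.
have : 4 * t = 4 * 1 by move: E1 => /(congr1 (fun x => 7 - x)) E1; transitivity (7 - (3 - (t + t) + (2 + 2 - (t + t)))); [ring|rewrite E1; ring].
have n4 : 4 != 0 :> C by rewrite pnatr_eq0.
by move=> /(mulfI n4) ->; split=> //; ring.
Qed.

Lemma X0_bundles : (forall p, exists z z' W, mexp (pi *: (z' - z)) = T 1 0 /\ identified u z z' W (Phi p (-1))) ->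
  let L1 := fun p => colspace (A 1 p *m Pi) in let L2 := fun p => colspace (A 1 p *m Pj) in
  [/\ [/\ holo_subbundle 1 L1, isotropic_bundle L1 & subbundle_of L1 (X0 u)],
      [/\ holo_subbundle 1 L2, isotropic_bundle L2 & subbundle_of L2 (hperp (X0 u))] &
      forall p, directv (L1 p + conjv (L1 p))].
Proof.
move=> idn L1 L2.
have Pjc p k : (k < 5)%N -> Pj *m A k p = A k p *m Pj.
  by move=> k5; rewrite mulmxBl mulmxBr mul1mx mulmx1 comm.
have PiT : Pi^T = Pi by rewrite -mxC_tr (px_tr u).
have PjT : Pj^T = Pj by rewrite trmxB trmx1 PiT.
have tr p : \tr (A 1 p *m Pi) = 1 /\ \tr (A 1 p *m Pj) = 1.
  by have [z [z' [W [ET Wp]]]] := idn p; exact: traces ET Wp.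
have [h1 i1] := half_line_bundle px_idemC PiT comm (fun p => (tr p).1).
have [h2 i2] := half_line_bundle px_compl_idem PjT Pjc (fun p => (tr p).2).
split; [split; [exact: h1|exact: i1|]|split; [exact: h2|exact: i2|]|].
- by move=> p; rewrite (X0E hu); apply: colspace_sub; rewrite mulmxA comm// -mulmxA px_idemC.
- move=> p; rewrite (X0E hu) (hperp_colspace _ px_idemC); last by rewrite PiT mxconjC.
  by apply: colspace_sub; rewrite mulmxA Pjc// -mulmxA px_compl_idem.
- move=> p; apply/directv_addP; rewrite conjv_colspace mxconjM mxconjC AC//.
  have id1 k : (k < 5)%N -> A k p *m Pi *m (A k p *m Pi) = A k p *m Pi.
    by move=> k5; rewrite -mulmxA (mulmxA Pi) comm// -(mulmxA (A k p)) px_idemC mulmxA idem.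
  rewrite colspace0I ?id1//.
  by rewrite -mulmxA (mulmxA Pi) comm// !mulmxA orth// !mul0mx.
Qed.

(** (1 - B) P cuts out in x_0 the complement of L_1 and its conjugate, and B (1 - P) is
the projection onto the sum of L_2 and its conjugate. *)
Lemma X0_decomposes p :
  decomposes (colspace ((1%:M - B p) *m Pi + B p *m Pj))
    (hperp (colspace (A 1 p *m Pi) + conjv (colspace (A 1 p *m Pi))) :&: X0 u)%VS (colspace (A 1 p *m Pj)).
Proof.
have BE : B p = A 1 p + A 3 p by [].
have Bc : Pi *m B p = B p *m Pi by rewrite BE mulmxDl mulmxDr !comm.
have BB : B p *m B p = B p by rewrite BE mulmxDl !mulmxDr !idem// !orth// addr0 add0r.
have BT : (B p)^T = B p by rewrite BE trmxD !AT// addrC.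
have cB : mxconj (B p) = B p by rewrite BE mxconjD !AC// addrC.
have id1 k : (k < 5)%N -> A k p *m Pi *m (A k p *m Pi) = A k p *m Pi.
  by move=> k5; rewrite -mulmxA (mulmxA Pi) comm// -(mulmxA (A k p)) px_idemC mulmxA idem.
have [PiPj PjPi] := px_compl0.
have PiT : Pi^T = Pi by rewrite -mxC_tr (px_tr u).
have BPi2 : B p *m Pi *m (B p *m Pi) = B p *m Pi.
  by rewrite -mulmxA (mulmxA Pi) Bc -(mulmxA (B p)) px_idemC mulmxA BB.
have E1 : (hperp (colspace (A 1 p *m Pi) + conjv (colspace (A 1 p *m Pi))) :&: X0 u)%VS =
    colspace ((1%:M - B p) *m Pi).
  have id0 j k : (j < 5)%N -> (k < 5)%N -> j != k -> A j p *m Pi *m (A k p *m Pi) = 0.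
    by move=> j5 k5 jk; rewrite -mulmxA (mulmxA Pi) comm// !mulmxA orth// !mul0mx.
  have id13 := id0 1%N 3 isT isT isT; have id31 := id0 3 1%N isT isT isT.
  rewrite conjv_colspace mxconjM mxconjC AC// (colspaceD (id1 1%N isT) (id1 3 isT) id13 id31).
  rewrite -mulmxDl -BE (hperp_colspace _ BPi2); last first.
    by rewrite trmx_mul PiT BT mxconjM mxconjC cB.
  have c2 : (1%:M - B p *m Pi) *m (1%:M - B p *m Pi) = 1%:M - B p *m Pi.
    by rewrite mulmxBl mul1mx mulmxBr mulmx1 BPi2 subrr subr0.
  have c3 : (1%:M - B p *m Pi) *m Pi = (1%:M - B p) *m Pi.
    by rewrite !mulmxBl !mul1mx -mulmxA px_idemC.
  have c4 : (1%:M - B p *m Pi) *m Pi = Pi *m (1%:M - B p *m Pi).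
    by rewrite c3 mulmxBr mulmx1 mulmxA Bc -mulmxA px_idemC mulmxBl mul1mx.
  by rewrite (X0E hu) (colspaceI c2 px_idemC c4) c3.
have cQ : mxconj (A 1 p *m Pj) = A 3 p *m Pj by rewrite mxconjM mxconjB mxconj1 mxconjC AC.
have Pjc k : (k < 5)%N -> Pj *m A k p = A k p *m Pj.
  by move=> k5; rewrite mulmxBl mulmxBr mul1mx mulmx1 comm.
have BPj : B p *m Pj = A 1 p *m Pj + mxconj (A 1 p *m Pj) by rewrite cQ BE mulmxDl.
rewrite E1 BPj addrA; apply: decomposes_colspace; rewrite ?cQ.
- have c1 : Pi *m (1%:M - B p) = (1%:M - B p) *m Pi by rewrite mulmxBr mulmxBl mulmx1 mul1mx Bc.
  have c2 : (1%:M - B p) *m (1%:M - B p) = 1%:M - B p.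
    by rewrite mulmxBl mul1mx mulmxBr mulmx1 BB subrr subr0.
  by rewrite -mulmxA (mulmxA Pi) c1 -(mulmxA (1%:M - B p) Pi) px_idemC mulmxA c2.
- by rewrite -mulmxA (mulmxA Pj) Pjc// -(mulmxA (A 1 p)) px_compl_idem mulmxA idem.
- by rewrite -mulmxA (mulmxA Pj) Pjc// !mulmxA orth// !mul0mx.
- by rewrite -mulmxA (mulmxA Pj) Pjc// !mulmxA orth// !mul0mx.
- by rewrite -mulmxA (mulmxA Pi) comm// -(mulmxA (A 1 p)) PiPj !mulmx0.
- have c1 : Pj *m (1%:M - B p) = (1%:M - B p) *m Pj.
    have : Pj *m B p = B p *m Pj by rewrite mulmxBl mulmxBr mul1mx mulmx1 Bc.
    by move: Pj => Q QB; rewrite mulmxBr mulmxBl mulmx1 mul1mx QB.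
  by rewrite -mulmxA (mulmxA Pj) c1 -(mulmxA (1%:M - B p)) PjPi !mulmx0.
- by rewrite mxconjM mxconjB mxconj1 mxconjC cB.
Qed.

End ReflectionInX0.

(** * Harmonic maps of the classes *)

Section Conclusion.
Variable R : realType.
Local Notation C := R[i].
Variable u : 'I_3 -> 'cV[C]_6.
Hypothesis hu : isotropic_frame u.
Local Notation T a b := (mexp (pi *: zeta u a b)).

Lemma discrete_setU (D1 D2 : set (sphere R)) : discrete_set D1 -> discrete_set D2 ->
  discrete_set (D1 `|` D2).
Proof.
move=> d1 d2 b z; apply: filterS2 (d1 b z) (d2 b z) => w n1 n2 [].
  exact: n1.
exact: n2.
Qed.

Lemma T00 : T 0 0 = 1%:M.
Proof.
rewrite (mexp_pi_zeta hu) -(tdiag1 hu); apply: tdiag_eq => j.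
by rewrite /weight; case: ifP => // _; case: ifP.
Qed.

Lemma T_parity a b : T a.+2 b.+2 = T a b.
Proof.
rewrite !(mexp_pi_zeta hu); apply: tdiag_eq => j; rewrite /weight.
by case: ifP => _; [|case: ifP => _ //]; rewrite !exprS !mulrA mulrNN mulr1 mul1r.
Qed.

Lemma Ad_T00 g : sigma u g = Ad (T 0 0) (sigma u g).
Proof. by rewrite T00 /Ad invmx1 mul1mx mulmx1. Qed.

Lemma corresponding_uniton a b tau phi Phi : (b <= a <= 2)%N -> (0 < a)%N ->
  corresponding u (zeta u a b) tau phi Phi -> uniton_number Phi a.*2.
Proof.
move=> ba a0 [ext alg [D dD PU] _].
by apply: (class_uniton_number hu ba a0 ext alg dD) => p /PU[].
Qed.

Lemma zeta1_S1_invariant phi Phi : corresponding u (zeta u 1 0) (sigma u) phi Phi ->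
  exists2 D, discrete_set D & forall p, ~ D p -> Omega_ (zeta u 1 0) (Phi p).
Proof. by move=> [_ alg [D dD PU] _]; exists D => // p /PU[/(zeta1_loop hu (alg p))]. Qed.

Lemma zeta1_maps phi Phi : corresponding u (zeta u 1 0) (sigma u) phi Phi ->
  exists2 a : 'M[R]_6, O6 a & exists V : bundle R,
    [/\ holo_subbundle 1 V, isotropic_bundle V, subbundle_of V (cplx (annih (V0 u))),
        d_sub V (fun p => hperp (conjv (V p))) &
        forall p, decomposes (cplx (act a (phi p))) (cplx (V0 u)) (V p)].
Proof.
move=> cP; have [D2 dD2 PO] := zeta1_S1_invariant cP; move: cP => [ext alg [D1 dD1 PU] [z' ad [c cO idn]]].
have ba : (0 <= 1 <= 2)%N by [].
have dD := discrete_setU dD1 dD2.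
have PU' p : ~ (D1 `|` D2) p -> U_ (zeta u 1 0) (Phi p) by move=> nD; have [|] := PU p => // ?; apply: nD; left.
have PO' p : ~ (D1 `|` D2) p -> Omega_ (zeta u 1 0) (Phi p) by move=> nD; apply: PO => ?; apply: nD; right.
have PT' p : ~ (D1 `|` D2) p -> Omega_tau (sigma u) (Phi p) by move=> nD; have [|] := PU p => // ?; apply: nD; left.
have ET := admissible_mexp hu ad (fun g _ => Ad_T00 g).
have [h1 h2 h3 h4] := line_bundle hu ba isT ext alg dD PU' PO' PT' erefl erefl.
exists (T 1 0 *m c); first by apply: O6M => //; exact: T_O6.
exists (fun p => colspace (cf (Phi p) 1)); split=> [||||p]; [exact: h1|exact: h2|exact: h3|exact: h4|].
rewrite -act_mul (projection_identified hu ba isT ext alg dD PU' PO' PT' ET (idn p)).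
exact: decomposes_A1 ba isT ext alg dD PU' PO' PT' p.
Qed.

Lemma zeta12_maps phi : S1_invariant u (zeta u 2 1) (sigma u) phi ->
  exists2 a : 'M[R]_6, O6 a & exists V W : bundle R,
    [/\ [/\ holo_subbundle 1 V, isotropic_bundle V & subbundle_of V (cplx (annih (V0 u)))],
        [/\ holo_subbundle 2 W, isotropic_bundle W & subbundle_of W (cplx (annih (V0 u)))],
        (forall p, (V p <= W p)%VS),
        d_sub V W /\ d_sub W (fun p => hperp (conjv (W p))) &
        forall p, decomposes (cplx (act a (phi p))) (cplx (V0 u)) (W p :&: hperp (V p))%VS].
Proof.
move=> [Phi [ext alg [D1 dD1 PU] [z' ad [c cO idn]]] [D2 dD2 PO]].
have ba : (1 <= 2 <= 2)%N by [].
have dD := discrete_setU dD1 dD2.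
have PU' p : ~ (D1 `|` D2) p -> U_ (zeta u 2 1) (Phi p) by move=> nD; have [|] := PU p => // ?; apply: nD; left.
have PO' p : ~ (D1 `|` D2) p -> Omega_ (zeta u 2 1) (Phi p) by move=> nD; apply: PO => ?; apply: nD; right.
have PT' p : ~ (D1 `|` D2) p -> Omega_tau (sigma u) (Phi p) by move=> nD; have [|] := PU p => // ?; apply: nD; left.
have ET := admissible_mexp hu ad (fun g _ => Ad_T00 g).
have [h1 h2 h3 h4] := flag_bundles hu ba isT ext alg dD PU' PO' PT' erefl erefl.
exists (T 1 0 *m c); first by apply: O6M => //; exact: T_O6.
exists (fun p => colspace (cf (Phi p) 0)), (fun p => colspace (cf (Phi p) 0 + cf (Phi p) 1)).
split=> [||||p]; [exact: h1|exact: h2|exact: h3|exact: h4|].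
rewrite (plane_meets_perp hu ba isT ext alg dD PU' PO').
rewrite -act_mul (projection_identified hu ba isT ext alg dD PU' PO' PT' ET (idn p)).
exact: decomposes_A1 ba isT ext alg dD PU' PO' PT' p.
Qed.

Lemma sigma1_Ad g : sigma1 u g = Ad (T 1 0) (sigma u g).
Proof. by rewrite /sigma1 (zeta1E hu). Qed.

Lemma zeta2_maps phi : S1_invariant u (zeta u 1 1) (sigma1 u) phi ->
  exists2 a : 'M[R]_6, O6 a & exists L1 L2 : bundle R,
    [/\ [/\ holo_subbundle 1 L1, isotropic_bundle L1 & subbundle_of L1 (X0 u)],
        [/\ holo_subbundle 1 L2, isotropic_bundle L2 & subbundle_of L2 (hperp (X0 u))],
        forall p, directv (L1 p + conjv (L1 p)) &
        forall p, decomposes (cplx (act a (phi p)))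
          (hperp (L1 p + conjv (L1 p)) :&: X0 u)%VS (L2 p)].
Proof.
move=> [Phi [ext alg [D1 dD1 PU] [z' ad [c cO idn]]] [D2 dD2 PO]].
have dD := discrete_setU dD1 dD2.
have PU' p : ~ (D1 `|` D2) p -> U_ (zeta u 1 1) (Phi p) by move=> nD; have [|] := PU p => // ?; apply: nD; left.
have PO' p : ~ (D1 `|` D2) p -> Omega_ (zeta u 1 1) (Phi p) by move=> nD; apply: PO => ?; apply: nD; right.
have PT' p : ~ (D1 `|` D2) p -> Omega_tau (sigma1 u) (Phi p) by move=> nD; have [|] := PU p => // ?; apply: nD; left.
have ET := admissible_mexp hu ad (fun g _ => sigma1_Ad g).
have [|h1 h2 h3] := X0_bundles hu ext alg dD PU' PO' PT'.
  by move=> p; exists (zeta u 1 1), z', (act c (phi p)).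
exists c => //; exists (fun p => colspace (cf (Phi p) 1 *m mxC (px u))),
  (fun p => colspace (cf (Phi p) 1 *m (1%:M - mxC (px u)))).
split=> [|||p]; [exact: h1|exact: h2|exact: h3|].
have [g [gO _] [-> E]] := projection_identified1 hu ext alg dD PU' ET (idn p).
have [-> _ _ _ _] := annih_act_x0 hu gO.
by rewrite cplx_colspace E; exact: (X0_decomposes hu ext alg dD PU' PO' PT').
Qed.

(** The conditions on zeta' = m1 zeta_1 + m2 zeta_2 and on
zeta' - zeta = k1 zeta_1 + k2 zeta_2, in the coordinates of [zeta]. *)
Lemma admissible_intro m1 m2 k1 k2 a b c d tau :
  zeta u a b = zeta1 u \/ zeta u a b = zeta2 u \/ zeta u a b = zeta1 u + zeta2 u ->
  (m1 <= 2)%N -> (m2 <= 2)%N -> (m1 + m2 = a + (k1 + k2))%N -> m2 = (b + k2)%N ->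
  P_comp (sigma u) (zeta u (m1 + m2) m2) = P_comp (sigma u) (zeta u 1 0) ->
  T (k1 + k2) k2 = T c d ->
  (forall g, SO6 g -> tau g = Ad (T c d) (sigma u g)) ->
  exists2 z'', admissible u (zeta u a b) z'' tau & mexp (pi *: (z'' - zeta u a b)) = T c d.
Proof.
move=> z3 m12 m22 Em1 Em2 Pc ET tauE; exists (zeta u (m1 + m2) m2).
  have E : zeta u (m1 + m2) m2 - zeta u a b = zeta u (k1 + k2) k2.
    by rewrite Em1 Em2 -(zetaD hu) addrC addKr.
  split.
  - exact: z3.
  - by exists m1, m2; rewrite (zeta_mulrn hu).
  - by exists k1, k2; rewrite (zeta_mulrn hu).
  - by rewrite (zeta1E hu).
  - by move=> g gS; rewrite E ET tauE.
by rewrite Em1 Em2 -(zetaD hu) [X in pi *: X]addrC addKr.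
Qed.

(** Both directions are [corresponding_complement]: used twice it adds 2 zeta_2 to zeta',
which leaves exp (pi (zeta' - zeta)) unchanged. *)
Lemma complement_iff z tau tau' a b phi :
  (forall g, SO6 g -> tau g = Ad (T a b) (sigma u g)) ->
  (forall g, SO6 g -> tau' g = Ad (T (1 + a) (1 + b)) (sigma u g)) ->
  (exists2 z'', admissible u z z'' tau & mexp (pi *: (z'' - z)) = T a b) ->
  (exists2 z'', admissible u z z'' tau' & mexp (pi *: (z'' - z)) = T (1 + a) (1 + b)) ->
  harmonic_map phi ->
  associated u z tau' phi <->
    exists psi, [/\ harmonic_map psi, associated u z tau psi & forall p, phi p = annih (psi p)].
Proof.
move=> tE tE' ad ad' harm; split=> [[Phi cP]|[psi [hpsi [Phi cP] E]]].
  have [h2 phiE] := harmonic_complement hu cP harm.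
  exists (fun p => annih (phi p)); split => //.
  eexists; apply: (corresponding_complement hu tE' _ _ cP); rewrite !add1n T_parity//.
have cP' := corresponding_complement hu tE tE' ad' cP.
have -> : phi = fun p => annih (psi p) by apply/funext.
by eexists; exact: cP'.
Qed.

End Conclusion.

Theorem theorem23 (R : realType) (u : 'I_3 -> 'cV[R[i]]_6)
  (hu : isotropic_frame u) :
  (forall phi : sphere R -> {vspace 'cV[R]_6}, harmonic_map phi ->
    [/\ associated u (zeta1 u) (sigma u) phi ->
          S1_invariant u (zeta1 u) (sigma u) phi /\
          exists2 a : 'M[R]_6, O6 a & exists V : bundle R,
            [/\ holo_subbundle 1 V, isotropic_bundle V,
                subbundle_of V (cplx (annih (V0 u))),
                d_sub V (fun p => hperp (conjv (V p))) &
                forall p, decomposes (cplx (act a (phi p))) (cplx (V0 u)) (V p)],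
        associated u (zeta1 u + zeta2 u) (sigma u) phi ->
        S1_invariant u (zeta1 u + zeta2 u) (sigma u) phi ->
          exists2 a : 'M[R]_6, O6 a & exists V W : bundle R,
            [/\ [/\ holo_subbundle 1 V, isotropic_bundle V &
                    subbundle_of V (cplx (annih (V0 u)))],
                [/\ holo_subbundle 2 W, isotropic_bundle W &
                    subbundle_of W (cplx (annih (V0 u)))],
                (forall p, (V p <= W p)%VS),
                d_sub V W /\ d_sub W (fun p => hperp (conjv (W p))) &
                forall p, decomposes (cplx (act a (phi p))) (cplx (V0 u))
                                     (W p :&: hperp (V p))%VS] &
        associated u (zeta2 u) (sigma1 u) phi ->
        S1_invariant u (zeta2 u) (sigma1 u) phi ->
          exists2 a : 'M[R]_6, O6 a & exists L1 L2 : bundle R,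
            [/\ [/\ holo_subbundle 1 L1, isotropic_bundle L1 &
                    subbundle_of L1 (X0 u)],
                [/\ holo_subbundle 1 L2, isotropic_bundle L2 &
                    subbundle_of L2 (hperp (X0 u))],
                forall p, directv (L1 p + conjv (L1 p)) &
                forall p, decomposes (cplx (act a (phi p)))
                  (hperp (L1 p + conjv (L1 p)) :&: X0 u)%VS (L2 p)]])
  /\
  (forall (phi : sphere R -> {vspace 'cV[R]_6}) (Phi : sphere R -> R[i] -> 'M[R]_6),
    harmonic_map phi ->
    [/\ corresponding u (zeta1 u) (sigma u) phi Phi -> uniton_number Phi 2,
        corresponding u (zeta1 u + zeta2 u) (sigma u) phi Phi ->
          uniton_number Phi 4 &
        corresponding u (zeta2 u) (sigma1 u) phi Phi -> uniton_number Phi 2])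
  /\
  (forall phi : sphere R -> {vspace 'cV[R]_6}, harmonic_map phi ->
    [/\ associated u (zeta1 u) (sigma2 u) phi <->
          exists psi, [/\ harmonic_map psi,
            associated u (zeta1 u) (sigma u) psi &
            forall p, phi p = annih (psi p)],
        associated u (zeta1 u + zeta2 u) (sigma2 u) phi <->
          exists psi, [/\ harmonic_map psi,
            associated u (zeta1 u + zeta2 u) (sigma u) psi &
            forall p, phi p = annih (psi p)] &
        associated u (zeta2 u)
            (fun g => Ad (mexp (pi *: zeta2 u)) (sigma1 u g)) phi <->
          exists psi, [/\ harmonic_map psi,
            associated u (zeta2 u) (sigma1 u) psi &
            forall p, phi p = annih (psi p)]]).
Proof.
have z1 := zeta1E hu; have z2 := zeta2E hu; have z12 := zeta12E hu.
have P0 : P_comp (sigma u) (zeta u 1 0) = P_comp (sigma u) (zeta u 1 0) by [].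
have P21 := P_comp_zeta21 hu.
have P32 : P_comp (sigma u) (zeta u 3 2) = P_comp (sigma u) (zeta u 1 0).
  by rewrite /P_comp T_parity.
have s0E g : SO6 g -> sigma u g = Ad (mexp (pi *: zeta u 0 0)) (sigma u g).
  by move=> _; exact: Ad_T00.
have s1E g : SO6 g -> sigma1 u g = Ad (mexp (pi *: zeta u 1 0)) (sigma u g).
  by move=> _; exact: sigma1_Ad.
have s2E g : SO6 g -> sigma2 u g = Ad (mexp (pi *: zeta u (1 + 0) (1 + 0))) (sigma u g).
  by move=> _; rewrite /sigma2 z2.
have s3E g : SO6 g -> Ad (mexp (pi *: zeta u 1 1)) (sigma1 u g) =
    Ad (mexp (pi *: zeta u (1 + 1) (1 + 0))) (sigma u g).
  move=> _; rewrite (sigma1_Ad hu) (Ad_mul _ (T_O6 hu 1 1) (T_O6 hu 1 0)).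
  by rewrite (mexp_pi_zetaD hu).
have c1 : zeta u 1 0 = zeta1 u \/ zeta u 1 0 = zeta2 u \/ zeta u 1 0 = zeta1 u + zeta2 u.
  by left; rewrite z1.
have c2 : zeta u 1 1 = zeta1 u \/ zeta u 1 1 = zeta2 u \/ zeta u 1 1 = zeta1 u + zeta2 u.
  by right; left; rewrite z2.
have c12 : zeta u 2 1 = zeta1 u \/ zeta u 2 1 = zeta2 u \/ zeta u 2 1 = zeta1 u + zeta2 u.
  by right; right; rewrite z12.
split; [|split].
- move=> phi _; split.
  + move=> [Phi cP]; rewrite z1 in cP *; split; last exact: zeta1_maps cP.
    by exists Phi => //; exact: zeta1_S1_invariant cP.
  + by move=> _; rewrite z12; exact: zeta12_maps.
  + by move=> _; rewrite z2; exact: zeta2_maps.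
- move=> phi Phi _; rewrite z12 z1 z2; split.
  + exact: (@corresponding_uniton _ u hu 1 0).
  + exact: (@corresponding_uniton _ u hu 2 1).
  + exact: (@corresponding_uniton _ u hu 1 1).
- move=> phi harm; rewrite z12 z1 z2.
  (* zeta' is zeta_1, zeta_1 + zeta_2 or zeta_1 + 2 zeta_2, according to the class *)
  have a1 := admissible_intro (k1 := 0) (k2 := 0) hu c1
    (isT : 1 <= 2)%N (isT : 0 <= 2)%N erefl erefl P0 erefl s0E.
  have a1' := admissible_intro (k1 := 0) (k2 := 1) hu c1
    (isT : 1 <= 2)%N (isT : 1 <= 2)%N erefl erefl P21 erefl s2E.
  have a12 := admissible_intro (k1 := 0) (k2 := 0) hu c12
    (isT : 1 <= 2)%N (isT : 1 <= 2)%N erefl erefl P21 erefl s0E.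
  have a12' := admissible_intro (k1 := 0) (k2 := 1) hu c12
    (isT : 1 <= 2)%N (isT : 2 <= 2)%N erefl erefl P32 erefl s2E.
  have a2 := admissible_intro (k1 := 1) (k2 := 0) hu c2
    (isT : 1 <= 2)%N (isT : 1 <= 2)%N erefl erefl P21 erefl s1E.
  have a2' := admissible_intro (k1 := 1) (k2 := 1) hu c2
    (isT : 1 <= 2)%N (isT : 2 <= 2)%N erefl erefl P32 erefl s3E.
  split.
  + exact: (complement_iff hu s0E s2E a1 a1' harm).
  + exact: (complement_iff hu s0E s2E a12 a12' harm).
  + exact: (complement_iff hu s1E s3E a2 a2' harm).
Qed.
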